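(* Let $L\in\{\operatorname{Im}(\mathbb{I}),\mathbb{I}_0\}$. The following assertions hold: (a) There is a set $U\subset\mathbb{S}^2$ of four $L^{(\tau,0,1)}$-directions such that, for all generic icosahedral model sets $\Lambda$ with underlying $\mathbb{Z}$-module $L$, the set $\mathcal{C}(\Lambda)$ is determined by the $X$-rays in the directions of $U$. (b) For all generic icosahedral model sets $\Lambda$ with underlying $\mathbb{Z}$-module $L$ and all sets $U\subset\mathbb{S}^2$ of three or less pairwise non-parallel $L^{(\tau,0,1)}$-directions, the set $\mathcal{C}(\Lambda)$ is not determined by the $X$-rays in the directions of $U$.
   Context: Notation: $\tau=(1+\sqrt5)/2$; $.'$ is the non-trivial Galois automorphism of $\mathbb{Q}(\tau)$, so $\tau'=1-\tau$; $\mathbb{Z}[\tau]=\mathbb{Z}\oplus\mathbb{Z}\tau$. Modules: The icosian ring $\mathbb{I}$ is the additive subgroup of the Hamiltonian quaternions $\mathbb{H}\cong\mathbb{R}^4$ (basis $1,i,j,k$) generated by all even permutations of the coordinates of $(\pm1,0,0,0)$, $\tfrac12(\pm1,\pm1,\pm1,\pm1)$, $\tfrac12(0,\pm1,\pm\tau',\tau)$. For $\alpha=a+bi+cj+dk$ put $\operatorname{Im}(\alpha)=(b,c,d)^t\in\mathbb{R}^3$. $\operatorname{Im}(\mathbb{I})$ is the set of imaginary parts of all elements of $\mathbb{I}$, and $\mathbb{I}_0$ is the set of imaginary parts of those elements of $\mathbb{I}$ with real part $0$. Explicitly, $\operatorname{Im}(\mathbb{I})=\tfrac12\{(\beta,\gamma,\delta)^t\in\mathbb{Z}[\tau]^3\mid\tau^2\beta+\tau\gamma+\delta\equiv0\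 (\mathrm{mod}\ 2)\}$ and $\mathbb{I}_0=\tfrac12\{(\beta,\gamma,\delta)^t\in\mathbb{Z}[\tau]^3\mid\beta\equiv\tau\gamma\equiv\tau^2\delta\ (\mathrm{mod}\ 2)\}$. The star map $.^\star$ applies $.'$ to each coordinate of an element of $\mathbb{Q}(\tau)^3\supset L$. Icosahedral model sets: A window is a set $W\subset\mathbb{R}^3$ with $\varnothing\neq\operatorname{int}(W)\subset W\subset\operatorname{cl}(\operatorname{int}(W))$ and $\operatorname{cl}(\operatorname{int}(W))$ compact. For a window $W$ and $t\in\mathbb{R}^3$, the icosahedral model set with underlying $\mathbb{Z}$-module $L$ is $\Lambda_{\rm ico}(t,W)=t+\{\alpha\in L\mid\alpha^\star\in W\}$. It is generic if $\operatorname{bd}(W)\cap L^\star=\varnothing$. Directions and $X$-rays: A direction is an element of the unit sphere $\mathbb{S}^2\subset\mathbb{R}^3$. $H^{(\tau,0,1)}$ is the plane through the origin orthogonal to $(\tau,0,1)^t$. An $L^{(\tau,0,1)}$-direction is a direction $u\in\mathbb{S}^2\cap H^{(\tau,0,1)}$ that is parallel to a non-zero element of $L-L=L$. For a finite set $F\subset\mathbb{R}^3$ and a direction $u$, the $X$-ray $X_uF$ is the function assigning to each line $\ell$ in $\mathbb{R}^3$ parallel to $u$ the number $\operatorname{card}(F\cap\ell)$. A set $\mathcal{E}$ of finite subsets of $\mathbb{R}^3$ is determined by the $X$-rays in the directions of a finite set $U\subset\mathbb{S}^2$ if for all $F,F'\in\mathcal{E}$, $X_uF=X_uF'$ for all $u\in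 U$ implies $F=F'$. Convex subsets: $\mathcal{C}(\Lambda)$ is the set of all finite $C\subset\Lambda$ with $C=\operatorname{conv}(C)\cap\Lambda$. *)

(* Defs.v *)
From HB Require Import structures.
From mathcomp Require Import all_boot all_order all_fingroup all_algebra.
From mathcomp Require Import finmap.
From mathcomp Require Import all_classical all_reals all_analysis.
Import Order.TTheory GRing.Theory Num.Theory.
Import numFieldNormedType.Exports.

Set Implicit Arguments.
Unset Strict Implicit.
Unset Printing Implicit Defensive.

Local Open Scope classical_set_scope.
Local Open Scope ring_scope.

Definition tau (R : realType) : R := (1 + Num.sqrt 5) / 2.

Definition tau' (R : realType) : R := 1 - tau R.

(* The non-trivial automorphism of the subfield Q(tau) of R: the rationals a, b
   with x = a + b tau are unique when they exist. Outside Q(tau) the value is 0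
   and carries no meaning. *)
Definition galois {R : realType} (x : R) : R :=
  let ab := xget (0, 0)
    [set ab : rat * rat | x = ratr ab.1 + ratr ab.2 * tau R] in
  ratr ab.1 + ratr ab.2 * tau' R.

Definition star {R : realType} (x : 'rV[R]_3) : 'rV[R]_3 := map_mx galois x.

(* The additive group of the quaternions: a + b i + c j + d k is encoded as the
   row vector of its coordinates (the multiplication is never used). *)
Definition quat {R : realType} (a b c d : R) : 'rV[R]_4 :=
  \row_(i < 4) nth 0 [:: a; b; c; d] i.

Definition Im_part {R : realType} (x : 'rV[R]_4) : 'rV[R]_3 :=
  \row_(i < 3) x ord0 (lift ord0 i).

(* Signs are (-1) ^+ s with s : bool; in the last vector only the signs written
   as independent in (0, +-1, +-tau', tau) / 2 vary. *)
Definition icosian_seed {R : realType} : set 'rV[R]_4 :=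
  [set v | exists s : bool, v = quat ((-1) ^+ s) 0 0 0]
  `|` [set v | exists s t p q : bool,
        v = 2^-1 *: quat ((-1) ^+ s) ((-1) ^+ t) ((-1) ^+ p) ((-1) ^+ q)]
  `|` [set v | exists s t : bool,
        v = 2^-1 *: quat 0 ((-1) ^+ s) ((-1) ^+ t * tau' R) (tau R)].

Definition icosian_generator {R : realType} : set 'rV[R]_4 :=
  [set col_perm s v | s in [set s : 'S_4 | ~~ odd_perm s] & v in icosian_seed].

Definition additive_span {V : zmodType} (G : set V) : set V :=
  smallest (fun A : set V => zmod_closed (mem A)) G.

Definition icosian {R : realType} : set 'rV[R]_4 :=
  additive_span icosian_generator.

Definition ImI {R : realType} : set 'rV[R]_3 := Im_part @` icosian.

Definition I0 {R : realType} : set 'rV[R]_3 :=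
  Im_part @` (icosian `&` [set x | x ord0 ord0 = 0]).

Definition boundary {T : topologicalType} (A : set T) : set T :=
  closure A `\` A°.

Definition window {R : realType} (W : set 'rV[R]_3) : Prop :=
  [/\ W° !=set0, W `<=` closure W° & compact (closure W°)].

Definition ico_model_set {R : realType} (L : set 'rV[R]_3) (t : 'rV[R]_3)
    (W : set 'rV[R]_3) : set 'rV[R]_3 :=
  [set t + x | x in L `&` [set x | W (star x)]].

Definition generic_ico_model_set {R : realType} (L Lambda : set 'rV[R]_3)
    : Prop :=
  exists (t : 'rV[R]_3) (W : set 'rV[R]_3),
    [/\ window W, boundary W `&` (star @` L) = set0
      & Lambda = ico_model_set L t W].

Definition dot {R : realType} (u v : 'rV[R]_3) : R :=
  \sum_(i < 3) u ord0 i * v ord0 i.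

(* The unit sphere for the Euclidean norm; the norm `|u| of the library on
   matrices is the maximum norm. *)
Definition direction {R : realType} : set 'rV[R]_3 := [set u | dot u u = 1].

(* For non-zero vectors. *)
Definition parallel {R : realType} (u v : 'rV[R]_3) : Prop :=
  exists2 c : R, c != 0 & v = c *: u.

Definition plane_tau01 {R : realType} : set 'rV[R]_3 :=
  [set u | dot u (\row_(i < 3) nth 0 [:: tau R; 0; 1] i) = 0].

Definition tau01_direction {R : realType} (L : set 'rV[R]_3) : set 'rV[R]_3 :=
  [set u | [/\ direction u, plane_tau01 u
    & exists x, [/\ L x, x != 0 & parallel u x]]].

Definition parallel_line {R : realType} (u : 'rV[R]_3) : set (set 'rV[R]_3) :=
  [set l | exists p : 'rV[R]_3, l = [set p + s *: u | s in [set: R]]].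

Definition Xray {R : realType} (u : 'rV[R]_3) (F : set 'rV[R]_3)
    (l : parallel_line u) : nat :=
  #|` fset_set (F `&` val l) |%fset.

Definition determined_by {R : realType} (E : set (set 'rV[R]_3))
    (U : set 'rV[R]_3) : Prop :=
  forall F F', E F -> E F' ->
    (forall u, U u -> @Xray R u F = @Xray R u F') -> F = F'.

Definition conv_hull {R : realType} (A : set 'rV[R]_3) : set 'rV[R]_3 :=
  smallest (@convex_set R 'rV[R]_3) A.

Definition convex_subsets {R : realType} (Lambda : set 'rV[R]_3)
    : set (set 'rV[R]_3) :=
  [set C | [/\ finite_set C, C `<=` Lambda & C = conv_hull C `&` Lambda]].

(* Main.v *)
Require Import Defs.
From HB Require Import structures.
From mathcomp Require Import all_boot all_order all_fingroup all_algebra.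
From mathcomp Require Import finmap complex.
From mathcomp Require Import all_classical all_reals all_analysis.
From mathcomp Require Import zify ring lra.
Import Order.TTheory GRing.Theory Num.Theory.
Import numFieldNormedType.Exports.

Set Implicit Arguments.
Unset Strict Implicit.
Unset Printing Implicit Defensive.

Local Open Scope ring_scope.

(** Part (a). The four directions are those with slopes 0, infinity, 1 and 8 in
    the basis (0, 1, 0), (-1, 0, tau) of the plane orthogonal to (tau, 0, 1).
    Suppose that two convex subsets F and F' have equal X-rays in these
    directions and differ. In a plane parallel to the directions that meets
    their difference, the points of F \ F' and of F' \ F form two finite classes
    with as many points of each class on every line of each direction, and no
    point of one class lies in the convex hull of the other. The classes have a
    common centre of mass, which is taken as the origin.

    Seen from the origin, the signs of the classes divide the circle of rays
    into an even number n of runs of equal sign. A direction pairs points of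
    opposite classes on its lines, and convexity forces this pairing to reverse
    the cyclic order of the runs (direction_reversal): if the runs are numbered
    modulo n, the labels of two partners sum to a constant that depends on the
    direction only (recut_labeling, run_reversal). Send each point to the vertex
    of a regular n-gon given by its label and take the first Fourier coefficient
    of the configuration, a vector A of the complexified plane. Each direction
    u relates A to its conjugate B by: A - z B is parallel to u, where z is a
    root of unity. A is not a complex multiple of a real vector, because its
    value at any nonzero linear form is nonzero (first_mode_line): a trigonometric
    polynomial with the same sign pattern as the form separates the points.
    Hence the cross-ratio of the four directions, which is 8, would be a
    cross-ratio of four roots of unity; this contradicts the fact that a
    difference 1 - z of roots of unity is divisible by 2 at most once
    (cross_ratio_unity_roots).

    Part (b). After scaling by elements of Z[tau] and, if necessary, adding
    directions, the given directions are those of three vectors v k of Z[tau]^3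
    with sum zero. The vertices ctr + v k and ctr - v k of an affinely regular
    hexagon have equal X-rays in all three directions, and removing either of
    the two triples from the points of the model set in the hexagon leaves a
    convex subset (hexagon_not_determined). Such a hexagon exists in the model
    set because the modules contain Z[tau]^3, whose star image is dense, and
    because multiplication by powers of tau enlarges the hexagon while its star
    image shrinks; it contains finitely many points of the model set since
    only finitely many numbers of Z[tau] are bounded together with their
    conjugates. *)

(** * Cross-ratios of four roots of unity *)

Lemma sum_geom_root (K : fieldType) (m : nat) (z : K) :
  z ^+ m = 1 -> z != 1 -> \sum_(i < m) z ^+ i = 0.
Proof.
move=> zm z1; have := subrX1 z m; rewrite zm subrr => /esym/eqP.
by rewrite mulf_eq0 subr_eq0 (negPf z1) => /eqP.
Qed.

Section Integral.
Variable K : numFieldType.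
Local Notation aint := (integralOver (intr : int -> K)).

Lemma aint_exp (z : K) n : aint z -> aint (z ^+ n).
Proof.
move=> az; elim: n => [|n IH]; first by rewrite expr0; exact: mxpoly.integral1.
by rewrite exprS; apply: mxpoly.integral_mul.
Qed.

Lemma aint_sum (I : Type) (r : seq I) (F : I -> K) :
  (forall i, aint (F i)) -> aint (\sum_(i <- r) F i).
Proof.
move=> aF; elim: r => [|i r IH]; first by rewrite big_nil; exact: mxpoly.integral0.
by rewrite big_cons; apply: mxpoly.integral_add.
Qed.

Lemma aint_unity_root n (z : K) : z ^+ n.+1 = 1 -> aint z.
Proof.
move=> zn; exists ('X^(n.+1) - 1); first by rewrite monicXnsubC.
rewrite rmorphB /= map_polyXn rmorph1.
by rewrite /root hornerD hornerN hornerC hornerXn zn subrr.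
Qed.

(** Clearing denominators in a monic equation of degree d satisfied by q / 2
    shows that 2 divides q ^+ d. *)
Lemma aint_half_odd (w : K) (q : nat) : aint w -> 2 * w = q%:R -> ~~ odd q.
Proof.
case=> p mon_p /rootP pw0 w2.
have sp : (size p).-1.+1 = size p.
  by rewrite prednK // size_poly_gt0 monic_neq0.
set d := (size p).-1 in sp.
have dbl : 2 ^+ d * (map_poly (intr : int -> K) p).[w] =
  (\sum_(i < d.+1) p`_i * 2 ^+ (d - i) * (q%:Z) ^+ i)%:~R.
  rewrite horner_coef size_map_inj_poly ?rmorph0 //; last exact: intr_inj.
  rewrite -sp mulr_sumr rmorph_sum /=; apply: eq_bigr => i _.
  rewrite coef_map /= !rmorphM !rmorphXn /= -[q%:~R]/(q%:R) -w2 exprMn.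
  have id : (i <= d)%N by rewrite -ltnS.
  by rewrite -{1}(subnK id) exprD; ring.
move: dbl; rewrite pw0 mulr0 => /esym/eqP; rewrite intr_eq0 big_ord_recr /=.
rewrite subnn expr0 mulr1.
have -> : p`_d = 1 by move: mon_p; rewrite monicE /lead_coef -/d => /eqP.
rewrite mul1r => /eqP eq0; apply/negP => oq.
have /eqP := eq0; rewrite addr_eq0 => /eqP S.
have : (2 %| (q%:Z ^+ d))%Z.
  have -> : q%:Z ^+ d = - \sum_(i < d) p`_i * 2 ^+ (d - i) * q%:Z ^+ i by rewrite S
    opprK.
  rewrite rpredN; apply: rpred_sum => i _.
  rewrite -(@prednK (d - i)) ?subn_gt0 // exprS.
  by rewrite mulrCA -mulrA dvdz_mulr.
by rewrite dvdzE abszX dvdn2 oddX /= oq orbT.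
Qed.

(** The norm of 1 - z is 1 or a prime, so that 2 divides 1 - z at most once.
    Squaring z lowers the power of 2 in its order, and 1 - z divides 1 - z ^+
    2; when z has odd order m, it divides the sum of the 1 - z ^+ i over i < m,
    which is m. *)
Lemma unity_root_sub1_dvd r m (z : K) :
    odd m -> z ^+ (2 ^ r * m) = 1 -> z != 1 ->
  exists m' y, [/\ odd m', aint y & (1 - z) * y = 2 * m'%:R].
Proof.
move=> om; elim: r z => [|r IH] z zn z1.
  move: zn; rewrite mul1n => zm; have az : aint z.
    by move: om zm; case: m => // m _; exact: aint_unity_root.
  exists m, (2 * \sum_(i < m) \sum_(j < i) z ^+ j); split=> //.
    apply: mxpoly.integral_mul; first exact: (mxpoly.integral_nat _ 2).
    by apply: aint_sum => i; apply: aint_sum => j; apply: aint_exp.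
  rewrite mulrCA mulr_sumr; congr (_ * _).
  have -> : m%:R = \sum_(i < m) (1 - z ^+ i) :> K.
    by rewrite sumrB sum_geom_root // subr0 sumr_const card_ord.
  apply: eq_bigr => i _; rewrite -opprB mulNr -subrX1; ring.
have zz : (z ^+ 2) ^+ (2 ^ r * m) = 1 by rewrite -exprM mulnA -expnS.
have [z21|z21] := eqVneq (z ^+ 2) 1.
  exists 1, 1; split=> //; first exact: mxpoly.integral1.
  move/eqP: z21; rewrite sqrf_eq1 (negPf z1) /= => /eqP ->; ring.
have [m' [y [om' ay e]]] := IH _ zz z21.
have az : aint z.
  apply: (@aint_unity_root (2 ^ r.+1 * m).-1).
  by rewrite prednK // muln_gt0 expn_gt0 /= odd_gt0.
exists m', ((1 + z) * y); split=> //; last by rewrite -e; ring.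
by apply: mxpoly.integral_mul => //; apply: mxpoly.integral_add => //;
  exact: mxpoly.integral1.
Qed.

(** Up to odd integers, each of the two differences on the left contributes at
    most one factor 2, while there are three such factors on the right. *)
Theorem cross_ratio_unity_roots n (z1 z2 z3 z4 : K) :
    (0 < n)%N -> z1 ^+ n = 1 -> z2 ^+ n = 1 -> z3 ^+ n = 1 -> z4 ^+ n = 1 ->
    z2 != z3 -> z1 != z4 ->
  (z2 - z3) * (z1 - z4) = 8 * ((z1 - z3) * (z2 - z4)) -> False.
Proof.
move=> n0 e1 e2 e3 e4 n23 n14 E.
have [r [m [om nE]]] : exists r m, odd m /\ n = (2 ^ r * m)%N.
  have [m c2m ->] := pfactor_coprime (isT : prime 2) n0.
  by exists (logn 2 n), m; rewrite -coprime2n mulnC.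
have unz (z : K) : z ^+ n = 1 -> z != 0.
  by apply: contra_eqN => /eqP->; rewrite expr0n gtn_eqF //= mulr0n eq_sym oner_neq0.
have az (z : K) : z ^+ n = 1 -> aint z.
  by move=> zn; apply: (@aint_unity_root n.-1); rewrite prednK.
have q1 (x y : K) : x ^+ n = 1 -> y ^+ n = 1 -> (y / x) ^+ n = 1.
  by move=> xn yn; rewrite expr_div_n xn yn divr1.
have ne (x y : K) : x ^+ n = 1 -> x != y -> y / x != 1.
  move=> /unz x0; apply: contra_neq => h.
  by rewrite -[y](divfK x0) h mul1r.
have [ma [ya [oa aya Ea]]] := @unity_root_sub1_dvd r m (z3 / z2) om
  (eq_rect n (fun n => _ ^+ n = 1) (q1 _ _ e2 e3) _ nE) (ne _ _ e2 n23).
have [mb [yb [ob ayb Eb]]] := @unity_root_sub1_dvd r m (z4 / z1) om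
  (eq_rect n (fun n => _ ^+ n = 1) (q1 _ _ e1 e4) _ nE) (ne _ _ e1 n14).
have u1 := unz _ e1; have u2 := unz _ e2.
pose w := (1 - z3 / z1) * (1 - z4 / z2) * ya * yb.
have aw : aint w.
  have aq x y : x ^+ n = 1 -> y ^+ n = 1 -> aint (1 - y / x).
    by move=> xn yn; apply: mxpoly.integral_sub (mxpoly.integral1 _) (az _ (q1 _ _ xn
      yn)).
  by do 3?apply: mxpoly.integral_mul => //; apply: aq.
have : 2 * w = (ma * mb)%:R.
  apply: (@mulfI _ 4); first by rewrite pnatr_eq0.
  rewrite natrM.
  have -> : 4 * (ma%:R * mb%:R) = (2 * ma%:R) * (2 * mb%:R) :> K by ring.
  rewrite -Ea -Eb /w.
  have -> : (1 - z3 / z2) * ya * ((1 - z4 / z1) * yb)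
     = (z2 - z3) * (z1 - z4) / (z1 * z2) * (ya * yb) by field; apply/andP.
  by rewrite E; field; apply/andP.
by move/(aint_half_odd aw); rewrite oddM oa ob.
Qed.
End Integral.

(** * Runs of equal signs on a line and on a circle *)

Section Labels.
Variables (R : realDomainType) (I : finType) (sg : I -> bool).

(** Points with signs sg i sit at positions a i on a line or on a circle that
    has been cut, and T i counts the sign changes met before reaching i: T
    numbers the maximal runs of equal signs from 0 to n - 1. The clauses on
    order and parity say this without sorting the points. *)
Record run_labeling (a : I -> R) (n : nat) (T : I -> nat) : Prop := RunLabeling {
  run_lt : forall i, (T i < n)%N;
  run_onto : forall v, (v < n)%N -> exists i, T i = v;
  run_mono : forall i j, a i <= a j -> (T i <= T j)%N;
  run_sign : forall i j, (sg i == sg j) = (odd (T i) == odd (T j)) }.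

(** Points are added in increasing order of position: the last one opens a new
    run exactly when its sign differs from that of its predecessor. *)
Lemma run_labeling_exists (a : I -> R) (i0 : I) :
    (forall i j, a i = a j -> sg i = sg j) ->
  exists n T, run_labeling a n T.
Proof.
move=> same.
suff H k (S : {set I}) : #|S| = k -> exists n T,
    [/\ forall i, i \in S -> (T i < n)%N,
        forall v, (v < n)%N -> exists2 i, i \in S & T i = v,
        forall i j, i \in S -> j \in S -> a i <= a j -> (T i <= T j)%N
      & forall i j, i \in S -> j \in S ->
          (sg i == sg j) = (odd (T i) == odd (T j))].
  have [n [T [h1 h2 h3 h4]]] := H _ (finset.setT) erefl; exists n, T; split.
  - by move=> i; apply: h1; rewrite inE.
  - by move=> v /h2[i _ <-]; exists i.
  - by move=> i j; apply: h3; rewrite inE.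
  - by move=> i j; apply: h4; rewrite inE.
elim: k S => [|k IH] S.
  move/eqP; rewrite cards_eq0 => /eqP->; exists 0%N, (fun=> 0%N).
  by split=> // i; rewrite inE.
move=> cS; have /card_gt0P[s0 s0S] : (0 < #|S|)%N by rewrite cS.
have [z zS zmax] := @arg_maxP _ R _ s0 (fun i => i \in S) a s0S.
have cz : #|S :\ z| = k by move: (cardsD1 z S); rewrite zS cS => -[].
have [n [T [h1 h2 h3 h4]]] := IH _ cz.
have SD i : i \in S -> i != z -> i \in S :\ z by rewrite !inE => -> ->.
have [S0|[l1 l1S]] := set_0Vmem (S :\ z).
  have Sz i : i \in S -> i = z.
    by move=> iS; apply/eqP/negPn/negP => /(SD _ iS); rewrite S0 inE.
  exists 1%N, (fun=> 0%N); split=> //.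
  - by case=> // _; exists z.
  - by move=> i j /Sz-> /Sz->; rewrite !eqxx.
have [l lS lmax] := @arg_maxP _ R _ l1 (fun i => i \in S :\ z) a l1S.
have lz : a l <= a z by apply: zmax; move: lS; rewrite !inE => /andP[].
have nT : n = (T l).+1.
  apply/eqP; rewrite eqn_leq h1 // andbT.
  case: n h1 h2 {h4} => // n h1 h2; rewrite ltnS.
  by have [i iS <-] := h2 n (ltnSn _); apply: h3 => //; exact: lmax.
pose tz := (T l + (sg l != sg z))%N.
pose T' i := if i == z then tz else T i.
exists tz.+1, T'; split.
- move=> i iS; rewrite /T'; case: eqVneq => // iz; rewrite ltnS /tz.
  by apply: leq_trans (leq_addr _ _); rewrite -ltnS -nT h1 // SD.
- move=> v; rewrite ltnS leq_eqVlt => /predU1P[->|vz].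
    by exists z; rewrite // /T' eqxx.
  have /h2[i iS <-] : (v < n)%N.
    by apply: (leq_trans vz); rewrite nT /tz -addn1 leq_add2l; case: (_ != _).
  by exists i; [move: iS; rewrite inE => /andP[] | rewrite /T'; move: iS; rewrite !inE;
    case: eqP].
- move=> i j iS jS ij; rewrite /T'.
  have [iz|iz] := eqVneq i z; have [jz|jz] := eqVneq j z => //.
  + have aE : a j = a z by apply: le_anti; rewrite -{2}iz ij andbT; apply: zmax.
    have aE' : a l = a z by apply: le_anti; rewrite lz -aE; apply: lmax; exact: SD.
    rewrite /tz (same l z) // eqxx addn0; apply: h3 => //; first exact: SD.
    by rewrite aE' aE.
  + by apply: leq_trans (leq_addr _ _); apply: h3 => //; [exact: SD | apply/lmax/SD].
  + by apply: h3 => //; exact: SD.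
- have zl i : i \in S :\ z -> (sg i == sg z) = (odd (T i) == odd tz).
    move=> iS; have := h4 _ _ iS lS; rewrite /tz oddD.
    by case: (sg i) (sg l) (sg z) (odd (T i)) (odd (T l)) => [] [] [] [] [].
  move=> i j iS jS; rewrite /T'.
  have [iz|iz] := eqVneq i z; have [jz|jz] := eqVneq j z.
  + by rewrite iz jz !eqxx.
  + by rewrite iz eq_sym zl ?SD // eq_sym.
  + by rewrite jz zl ?SD.
  + by apply: h4; exact: SD.
Qed.

Lemma run_lt_opp a n T (L : run_labeling a n T) i j :
  sg i != sg j -> a i < a j -> (T i < T j)%N.
Proof.
move=> o ij; rewrite ltn_neqAle (run_mono L (ltW ij)) andbT.
by apply: contra o => /eqP e; rewrite (run_sign L) e.
Qed.

Lemma lt_run_opp a n T (L : run_labeling a n T) i j :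
  (T i < T j)%N -> a i < a j.
Proof. by rewrite ltnNge ltNge; apply: contra => /(run_mono L). Qed.

(** Only pairs of opposite signs are compared, since the order inside a run
    does not influence the labels and is not reversed in general. *)
Definition reverses (s : I -> I) (a : I -> R) :=
  forall i j, sg i != sg j -> a i < a j -> a (s j) < a (s i).

Section Reversal.
Variable s : I -> I.
Hypothesis s_sg : forall i, sg (s i) != sg i.

Lemma flip_opposite i j : sg i != sg j -> sg (s j) != sg (s i).
Proof. by move: (s_sg i) (s_sg j); do 4!case: (sg _). Qed.

(** The map that sends i to n.-1 - T (s i) is increasing on pairs of opposite
    signs. Following chains of consecutive runs down to label 0, respectively
    up to label n - 1, shows that such a map with values below n is at least T,
    respectively at most T. *)
Lemma run_reversal a n T :
  run_labeling a n T -> reverses s a -> forall i, (T i + T (s i) = n.-1)%N.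
Proof.
move=> L rv.
have Tn i := run_lt L i.
pose U i := (n.-1 - T (s i))%N.
have UU i j : sg i != sg j -> a i < a j -> (U i < U j)%N.
  move=> o ij; have := run_lt_opp L (flip_opposite o) (rv _ _ o ij).
  by rewrite /U; move: (Tn (s i)) (Tn (s j)); lia.
have opp i j : T i = (T j).+1 -> sg j != sg i.
  by move=> e; rewrite (run_sign L) e /=; case: odd.
have le i : (T i <= U i)%N.
  move e: (T i) => t; elim: t i e => // t IH i e.
  have [|j ej] := run_onto L (v := t).
    by apply: ltn_trans (Tn i); rewrite e.
  apply: leq_ltn_trans (IH _ ej) _; apply: UU; first by apply: opp; rewrite ej.
  by apply: (lt_run_opp L); rewrite e ej.
have ge i : (U i <= T i)%N.
  move e: (n.-1 - T i)%N => t; elim: t i e => [|t IH] i e.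
    by move: (Tn i) e; rewrite /U; lia.
  have [|j ej] := run_onto L (v := (T i).+1); first by move: (Tn i) e; lia.
  have /IH : (n.-1 - T j = t)%N by rewrite ej; lia.
  rewrite ej; suff : (U i < U j)%N by lia.
  by apply: UU; [apply: opp | apply: (lt_run_opp L); rewrite ej].
move=> i; apply/eqP; rewrite eqn_leq; move: (le i) (ge i) (Tn i) (Tn (s i)).
by rewrite /U; lia.
Qed.

(** The labels of i and s i have different parities and sum to n - 1. *)
Lemma run_reversal_even a n T : I ->
  run_labeling a n T -> reverses s a -> ~~ odd n.
Proof.
move=> i0 L rv; have := run_reversal L rv i0; have := run_lt L i0.
case: n L => // n L _ /= e; rewrite negbK -e oddD.
by have := run_sign L i0 (s i0); have := s_sg i0; rewrite eq_sym => /negPf->;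
  do 2!case: odd.
Qed.

End Reversal.

Section Cut.
Variables (P gam : R) (a : I -> R).
Hypothesis aP : forall i, 0 <= a i < P.
(** Positions on a circle of length P, read from gam instead of 0. *)
Definition recut i := if a i < gam then a i - gam + P else a i - gam.

(** Read from gam, the first and the last point have opposite signs: otherwise
    reversal would move the last point in front of the first one. Hence the cut
    does not fall inside a run. *)
Lemma recut_gap s : involutive s -> (forall i, sg (s i) != sg i) ->
  reverses s recut -> (forall i j, a i = a j -> sg i = sg j) ->
  forall i j, a i < gam -> gam <= a j -> exists f l,
   [/\ sg f != sg l, a i <= a l, a l < gam & gam <= a f <= a j].
Proof.
move=> sK s_sg rv same i j ig jg.
have [f _ fmin] := @arg_minP _ _ _ i xpredT recut isT.
have [l _ lmax] := @arg_maxP _ _ _ i xpredT recut isT.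
have aiP := aP i; have ajP := aP j; have afP := aP f; have alP := aP l.
have H1 := fmin j isT; have H2 := lmax i isT; have H3 := lmax j isT.
have H4 := fmin i isT.
have recE k k' : recut k = recut k' -> a k = a k'.
  have akP := aP k; have akP' := aP k'.
  by rewrite /recut; case: ifP => ?; case: ifP => ?; lra.
exists f, l; split.
- apply/negP => /eqP e.
  have o : sg f != sg (s l) by rewrite e eq_sym.
  have flt : recut f < recut (s l).
    rewrite lt_neqAle fmin // andbT; apply: contra o => /eqP/recE/same ->.
    exact: eqxx.
  have := rv _ _ o flt; rewrite sK ltNge => /negP; apply; exact: lmax.
all: move: H1 H2 H3 H4; rewrite /recut ig (ltNge (a j)) jg /=;
  case: (ltrP (a f) gam) => ?; case: (ltrP (a l) gam) => ?; lra.
Qed.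

(** Since the cut at gam falls between two runs, moving the origin there shifts
    all labels by a constant modulo n. *)
Lemma recut_labeling s n T : involutive s -> (forall i, sg (s i) != sg i) ->
  reverses s recut -> (forall i j, a i = a j -> sg i = sg j) -> ~~ odd n ->
  run_labeling a n T ->
  exists m T', [/\ (m <= n)%N, run_labeling recut n T' &
    forall i, (T' i + m = T i \/ T' i + m = T i + n)%N].
Proof.
move=> sK s_sg rv same en L.
have gap i j : a i < gam -> gam <= a j -> (T i < T j)%N.
  move=> ig jg; have [f [l [opp ile lg /andP[gf fj]]]] := recut_gap sK s_sg rv same ig
    jg.
  apply: (leq_ltn_trans (run_mono L ile)).
  apply: leq_trans (run_mono L fj).
  by apply: (run_lt_opp L); [rewrite eq_sym | exact: lt_le_trans gf].
pose m := \max_(i | a i < gam) (T i).+1.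
have mA i : a i < gam -> (T i < m)%N.
  by move=> ig; apply: (@leq_bigmax_cond _ _ (fun i => (T i).+1)).
have mB i : gam <= a i -> (m <= T i)%N.
  by move=> ig; apply/bigmax_leqP => j jg; apply: gap.
have mn : (m <= n)%N by apply/bigmax_leqP => j _; apply: (run_lt L).
exists m, (fun i => if a i < gam then (T i + n - m)%N else (T i - m)%N); split=> //.
  have Tn i := run_lt L i; split.
  - move=> i; move: mn (Tn i).
    by case: (ltrP (a i) gam) => [/mA|/mB]; clear; lia.
  - move=> v vn; have [vm|vm] := ltnP v (n - m).
      have [|i e] := run_onto L (v := (v + m)%N); first by move: vm; clear; lia.
      exists i; move: mn e vm; case: (ltrP (a i) gam) => [/mA|/mB]; clear; lia.
    have [|i e] := run_onto L (v := (v + m - n)%N).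
      by move: mn vn vm; clear; lia.
    exists i; move: mn vn e vm.
    by case: (ltrP (a i) gam) => [/mA|/mB]; clear; lia.
  - move=> i j ij.
    have TT : recut i <= recut j -> a i < gam = (a j < gam) -> (T i <= T j)%N.
      by move=> h e; apply: (run_mono L); move: h; rewrite /recut e; case: ifP; lra.
    have wrap : a i < gam -> gam <= a j -> recut j < recut i.
      move: (aP i) (aP j) => ai aj ig jg; rewrite /recut ig (ltNge (a j)) jg /=; lra.
    move: mn (Tn i) (Tn j) TT.
    case: (ltrP (a i) gam) => ig; case: (ltrP (a j) gam) => jg mn' Ti Tj TT.
    + by rewrite leq_sub2r // leq_add2r TT.
    + by have := wrap ig jg; rewrite ltNge ij.
    + by move: (mA _ jg) (mB _ ig) mn' Ti Tj; clear; lia.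
    + by rewrite leq_sub2r // TT.
  - move=> i j; rewrite (run_sign L).
    have oA k : a k < gam -> odd (T k + n - m) = odd (T k) (+) odd m.
      move=> _; rewrite oddB ?oddD ?(negPf en) ?addbF //.
      exact: leq_trans mn (leq_addl _ _).
    have oB k : gam <= a k -> odd (T k - m) = odd (T k) (+) odd m.
      by move=> /mB km; rewrite oddB.
    have od k : odd (if a k < gam then (T k + n - m)%N else (T k - m)%N) =
        odd (T k) (+) odd m.
      by case: ltrP => ?; [apply: oA | apply: oB].
    by rewrite !od; case: (odd m); do 2!case: odd.
move=> i; move: mn (run_lt L i).
by case: (ltrP (a i) gam) => [/mA|/mB]; clear; lia.
Qed.
End Cut.
End Labels.

(** * Angles of plane vectors *)

Section Angles.
Variable R : realType.
Local Notation pi := (@pi R).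
Implicit Types p q g : R * R.

Definition cross p q : R := p.1 * q.2 - p.2 * q.1.
Definition inner p q : R := p.1 * q.1 + p.2 * q.2.

(** The rays of g, p, q are met in this order counterclockwise. This holds when
    at least two of the three cross products are positive; the third one may
    fail to be, because two of the rays may span an angle of pi or more. *)
Definition ccw g p q : Prop :=
  [\/ 0 < cross g p /\ 0 < cross p q, 0 < cross p q /\ 0 < cross q g
    | 0 < cross q g /\ 0 < cross g p].

Lemma sin_lt0_pi2 (x : R) : pi < x < pi *+ 2 -> sin x < 0.
Proof.
move=> /andP[h1 h2]; rewrite -(subrK pi x) sinDpi oppr_lt0 sin_gt0_pi //.
by rewrite subr_gt0 h1 /= ltrBlDr -mulr2n.
Qed.

Lemma sin_le0_Npi (x : R) : - pi <= x <= 0 -> sin x <= 0.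
Proof.
by move=> h; rewrite -[x]opprK sinN oppr_le0 sin_ge0_pi //; lra.
Qed.

Lemma sin_ccw (x y : R) : 0 < x < pi *+ 2 -> 0 < y < pi *+ 2 ->
  [\/ 0 < sin x /\ 0 < sin (y - x), 0 < sin (y - x) /\ sin y < 0
    | sin y < 0 /\ 0 < sin x] <-> x < y.
Proof.
move=> hx hy; split.
  move=> h; rewrite ltNge; apply/negP => yx.
  have nx z : 0 < sin z -> ~ (pi <= z <= pi *+ 2).
    move=> s0 zz; have := @sin_ge0_pi R (z - pi).
    by move: s0; rewrite -{1}(subrK pi z) sinDpi; lra.
  case: h => -[h1 h2].
  - have := nx _ h1 => h3.
    by have := @sin_le0_Npi (y - x); lra.
  - have h3 : ~ (0 <= y <= pi) by move=> h; have := @sin_ge0_pi R y h; lra.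
    by have := @sin_le0_Npi (y - x); lra.
  - have := nx _ h2 => h3.
    have h4 : ~ (0 <= y <= pi) by move=> h; have := @sin_ge0_pi R y h; lra.
    lra.
move=> xy.
have [x1|x1|x1] := ltgtP x pi.
- have [d|d] := ltrP (y - x) pi.
    by apply: Or31; rewrite !sin_gt0_pi //; lra.
  apply: Or33; rewrite sin_gt0_pi ?sin_lt0_pi2 //; lra.
- by apply: Or32; rewrite sin_gt0_pi ?sin_lt0_pi2 //; lra.
- by apply: Or32; rewrite sin_gt0_pi ?sin_lt0_pi2 //; lra.
Qed.

Definition radius p := Num.sqrt (p.1 ^+ 2 + p.2 ^+ 2).
Definition angle p : R :=
  let c := acos (p.1 / radius p) in if 0 <= p.2 then c else pi *+ 2 - c.

Lemma radius_gt0 p : p != 0 -> 0 < radius p.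
Proof.
move=> p0; rewrite sqrtr_gt0; case: p p0 => x y /=.
rewrite xpair_eqE negb_and /= => /orP[h|h].
  by rewrite ltr_pwDl ?sqr_ge0 // exprn_even_gt0.
by rewrite ltr_wpDl ?sqr_ge0 // exprn_even_gt0.
Qed.

Lemma angle_polar p : p != 0 -> [/\ 0 <= angle p < pi *+ 2,
  p.1 = radius p * cos (angle p) & p.2 = radius p * sin (angle p)].
Proof.
move=> p0; have r0 := radius_gt0 p0.
have r2 : radius p ^+ 2 = p.1 ^+ 2 + p.2 ^+ 2.
  by rewrite sqr_sqrtr // addr_ge0 ?sqr_ge0.
set c := p.1 / radius p.
have c2 : c ^+ 2 + (p.2 / radius p) ^+ 2 = 1.
  by rewrite /c !expr_div_n -mulrDl -r2 divff // sqrf_eq0 gt_eqF.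
have cle : -1 <= c <= 1.
  by rewrite -ler_norml -(@expr_le1 _ 2) // real_normK ?num_real //;
    have := sqr_ge0 (p.2 / radius p); lra.
have sE : sin (acos c) = `|p.2| / radius p.
  rewrite sin_acos // -c2 addrAC subrr add0r sqrtr_sqr normrM normfV.
  by rewrite (gtr0_norm r0).
have cE : cos (acos c) = c by rewrite acosK.
have a0 := acos_ge0 cle; have a1 := acos_lepi cle.
have pi0 := @pi_gt0 R.
rewrite /angle -/c; case: (lerP 0 p.2) => y0.
  split; first by rewrite a0 /= (le_lt_trans a1) // mulr2n ltrDl.
    by rewrite cE /c mulrC divfK // gt_eqF.
  by rewrite sE ger0_norm // mulrC divfK // gt_eqF.
split.
- have : 0 < acos c.
    rewrite lt_neqAle a0 andbT; apply/negP => /eqP e.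
    move: sE; rewrite -e sin0 ltr0_norm // => /esym/eqP.
    by rewrite mulf_eq0 invr_eq0 (gt_eqF r0) oppr_eq0 (lt_eqF y0).
  lra.
- by rewrite addrC cosD2pi cosN cE /c mulrC divfK // gt_eqF.
- by rewrite addrC sinD2pi sinN sE ltr0_norm // mulNr opprK mulrC divfK // gt_eqF.
Qed.

Lemma cross_polar p q : p != 0 -> q != 0 ->
  cross p q = radius p * radius q * sin (angle q - angle p).
Proof.
move=> /angle_polar[_ p1 p2] /angle_polar[_ q1 q2].
by rewrite /cross p1 p2 q1 q2 sinB; ring.
Qed.

Lemma angle_eq_ray p q : p != 0 -> q != 0 -> angle p = angle q ->
  p = (radius p / radius q * q.1, radius p / radius q * q.2).
Proof.
move=> p0 q0 e; have [_ p1 p2] := angle_polar p0; have [_ q1 q2] := angle_polar q0.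
have r0 := radius_gt0 q0.
rewrite {1}(surjective_pairing p) p1 p2 q1 q2 e.
by congr pair; field; rewrite gt_eqF.
Qed.

(** Transfers the polynomial orientation test to real positions on a circle,
    where moving the cut is a translation. *)
Lemma ccw_recut (I : finType) (P : I -> R * R) g i j :
    g != 0 -> P i != 0 -> P j != 0 -> angle (P i) != angle g ->
    angle (P j) != angle g ->
  ccw g (P i) (P j) <->
  recut (pi *+ 2) (angle g) (angle \o P) i < recut (pi *+ 2) (angle g) (angle \o P) j.
Proof.
move=> g0 i0 j0 ig jg; set al := recut _ _ _ i; set be := recut _ _ _ j.
have [gb _ _] := angle_polar g0.
have [ib _ _] := angle_polar i0.
have [jb _ _] := angle_polar j0.
have ab : 0 < al < pi *+ 2.
  by rewrite /al /recut /=; move/eqP: ig; case: ltrP; lra.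
have bb : 0 < be < pi *+ 2.
  by rewrite /be /recut /=; move/eqP: jg; case: ltrP; lra.
rewrite -sin_ccw // /ccw !cross_polar //.
have sal : sin (angle (P i) - angle g) = sin al.
  by rewrite /al /recut /=; case: ifP; rewrite ?sinD2pi.
have cal : cos (angle (P i) - angle g) = cos al.
  by rewrite /al /recut /=; case: ifP; rewrite ?cosD2pi.
have sbe : sin (angle (P j) - angle g) = sin be.
  by rewrite /be /recut /=; case: ifP; rewrite ?sinD2pi.
have cbe : cos (angle (P j) - angle g) = cos be.
  by rewrite /be /recut /=; case: ifP; rewrite ?cosD2pi.
have sab : sin (angle (P j) - angle (P i)) = sin (be - al).
  have -> : angle (P j) - angle (P i) = angle (P j) - angle g - (angle (P i) - angle g)
    by ring.
  by rewrite sinB sal cal sbe cbe -sinB.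
rewrite -(opprB (angle (P j)) (angle g)) sinN.
have := radius_gt0 g0; have := radius_gt0 i0; have := radius_gt0 j0.
move=> rj ri rg.
rewrite sal sbe sab !(pmulr_rgt0 _ (mulr_gt0 _ _)) // oppr_gt0.
by [].
Qed.

End Angles.

(** * Two classes of points that avoid each other's hulls *)

Section Separated.
Variables (R : realType) (I : finType) (sg : I -> bool).

(** The origin stands for a common point of the convex hulls of the two
    classes. A convex combination of the origin and two points of one class
    then lies in the hull of that class, and so is not a point of the other
    class. *)
Definition separated (p : I -> R * R) := forall a b j (be ga : R),
  sg a = sg b -> sg j != sg a -> 0 <= be -> 0 <= ga -> be + ga <= 1 ->
  p j <> (be * (p a).1 + ga * (p b).1, be * (p a).2 + ga * (p b).2).

Section Horizontal.
Variables (p : I -> R * R) (s : I -> I).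
Hypotheses (sep : separated p) (s_sg : forall i, sg (s i) != sg i).
Hypothesis s_h : forall i, (p (s i)).2 = (p i).2.

Lemma separated_pair a b j be ga x y : p j = (x, y) ->
  sg a = sg b -> sg j != sg a -> 0 <= be -> 0 <= ga -> be + ga <= 1 ->
  x = be * (p a).1 + ga * (p b).1 -> y = be * (p a).2 + ga * (p b).2 -> False.
Proof. by move=> e h1 h2 h3 h4 h5 ex ey; apply: (sep h1 h2 h3 h4 h5);
  rewrite e ex ey. Qed.

(** The points a and c b lie in the hull of their class, at the height of j, so
    that the segment between them does not contain j. *)
Lemma no_enclosing a b j (c : R) : sg a = sg b -> sg j != sg a ->
    (p a).2 = (p j).2 -> (p j).2 = c * (p b).2 -> 0 <= c <= 1 ->
  0 < ((p a).1 - (p j).1) * (c * (p b).1 - (p j).1).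
Proof.
move=> ab ja ha hj c01; rewrite ltNge; apply/negP => le.
have [e|ne] := eqVneq (p a).1 (p j).1.
  apply: (@separated_pair a a j 1 0 _ _ (surjective_pairing _)) => //; try lra.
have d0 : (p a).1 - c * (p b).1 != 0.
  apply: contra_neq ne => e; have e' : c * (p b).1 = (p a).1 by lra.
  move: le; rewrite e' -expr2 => le; apply/eqP; rewrite -subr_eq0 -sqrf_eq0.
  by rewrite eq_le le sqr_ge0.
pose t := ((p j).1 - c * (p b).1) / ((p a).1 - c * (p b).1).
have tE : t * ((p a).1 - c * (p b).1) = (p j).1 - c * (p b).1 by rewrite /t divfK.
have d2 : 0 < ((p a).1 - c * (p b).1) ^+ 2 by rewrite exprn_even_gt0.
have t0 : 0 <= t.
  rewrite -(pmulr_lge0 _ d2) expr2 mulrA tE; nra.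
have t1 : t <= 1.
  rewrite -subr_ge0 -(pmulr_lge0 _ d2) expr2 mulrA mulrBl tE; nra.
apply: (@separated_pair a b j t ((1 - t) * c) _ _ (surjective_pairing _)) => //;
  try nra.
Qed.

Definition left_pt i := (p i).1 < (p (s i)).1.

Lemma nonzero i : p i <> (0, 0).
Proof.
move=> e; have si : sg i != sg (s i) by rewrite eq_sym.
by apply: (@separated_pair (s i) (s i) i 0 0 _ _ e erefl si) => //; lra.
Qed.

Lemma right_ptE i : ~~ left_pt i -> (p (s i)).1 < (p i).1.
Proof.
rewrite /left_pt -leNgt le_eqVlt => /predU1P[e|//].
exfalso; apply: (@separated_pair (s i) (s i) i 1 0 _ _ (surjective_pairing _)) => //;
  try lra.
- by rewrite eq_sym.
- by rewrite s_h; lra.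
Qed.

Lemma left0 i : left_pt i -> (p i).2 = 0 -> (p i).1 < 0.
Proof.
rewrite /left_pt => l h; rewrite ltNge; apply/negP => x0.
have := @no_enclosing (s i) (s i) i 0 erefl; rewrite eq_sym s_sg s_h h !mul0r.
by move=> /(_ isT erefl erefl); nra.
Qed.

Lemma right0 i : ~~ left_pt i -> (p i).2 = 0 -> 0 < (p i).1.
Proof.
move=> /right_ptE r h; rewrite ltNge; apply/negP => x0.
have := @no_enclosing (s i) (s i) i 0 erefl; rewrite eq_sym s_sg s_h h !mul0r.
by move=> /(_ isT erefl erefl); nra.
Qed.

Lemma ratio_le1 (x y : R) : 0 < x * y -> x ^+ 2 <= y ^+ 2 ->
  [/\ 0 <= x / y <= 1, x = x / y * y & y != 0].
Proof.
move=> xy le; have y0 : y != 0 by apply: contraTneq xy => ->; rewrite mulr0 ltxx.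
have d2 : 0 < y ^+ 2 by rewrite exprn_even_gt0.
have q0 : 0 <= x / y by rewrite -(pmulr_lge0 _ d2) expr2 mulrA divfK // ltW.
split=> //; last by rewrite divfK.
rewrite q0 -(@expr_le1 _ 2) // expr_div_n ler_pdivrMr ?mul1r //.
Qed.

Lemma sg_choice i (b : bool) : {k | k = i \/ k = s i & sg k = b}.
Proof.
have [<-|h] := eqVneq (sg i) b; first by exists i; [left|].
exists (s i); first by right.
by move: (s_sg i) h; case: (sg (s i)); case: (sg i); case: b.
Qed.

(** Consider the pair that is nearer to the horizontal axis. At its height, the
    segments from the origin to the two points of the other pair both lie on
    the wrong side if the rays of i and j are in the wrong order. One of these
    segments has the sign of the partner of the nearer point, and together they
    enclose that point. *)
Lemma left_right_sep i j : left_pt i -> ~~ left_pt j -> 0 < (p i).2 * (p j).2 ->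
  ((p i).1 * (p j).2 - (p j).1 * (p i).2) * (p i).2 < 0.
Proof.
move=> l /right_ptE r hh; rewrite /left_pt in l.
rewrite ltNge; apply/negP => ge.
have [le|lt] := lerP ((p j).2 ^+ 2) ((p i).2 ^+ 2).
- have [c01 ce i0] := ratio_le1 (eq_ind _ (fun x =>
    is_true (0 < x)) hh _ (mulrC _ _)) le.
  set c := (p j).2 / (p i).2 in c01 ce.
  have [b bE sb] := sg_choice i (sg (s j)).
  have xb : (p i).1 <= (p b).1 by case: bE => -> //; exact: ltW.
  have hb : (p b).2 = (p i).2 by case: bE => ->; rewrite ?s_h.
  have := @no_enclosing (s j) b j c; rewrite sb eq_sym s_sg s_h hb -ce c01.
  move=> /(_ erefl isT erefl erefl isT).
  have : 0 <= (c * (p i).1 - (p j).1) * ((p i).2 ^+ 2).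
    by apply: le_trans ge _; rewrite [in leLHS]ce; rewrite le_eqVlt; apply/orP; left;
      apply/eqP; ring.
  rewrite pmulr_lge0 ?exprn_even_gt0 // => h.
  have cx : c * (p i).1 <= c * (p b).1 by rewrite ler_wpM2l //; case/andP: c01.
  rewrite nmulr_rgt0 ?subr_lt0 //; lra.
- have [c01 ce j0] := ratio_le1 hh (ltW lt).
  set c := (p i).2 / (p j).2 in c01 ce.
  have [b bE sb] := sg_choice j (sg (s i)).
  have xb : (p b).1 <= (p j).1 by case: bE => -> //; exact: ltW.
  have hb : (p b).2 = (p j).2 by case: bE => ->; rewrite ?s_h.
  have := @no_enclosing (s i) b i c; rewrite sb eq_sym s_sg s_h hb -ce c01.
  move=> /(_ erefl isT erefl erefl isT).
  have : 0 <= ((p i).1 - c * (p j).1) * ((p i).2 * (p j).2).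
    by apply: le_trans ge _; rewrite [X in _ - _ * X]ce; rewrite le_eqVlt; apply/orP;
      left; apply/eqP; ring.
  rewrite pmulr_lge0 // => h.
  have cx : c * (p b).1 <= c * (p j).1 by rewrite ler_wpM2l //; case/andP: c01.
  rewrite pmulr_rgt0 ?subr_gt0 //; lra.
Qed.

(** When the left points have opposite signs, the pair nearer to the horizontal
    axis is seen from the origin under the wider angle. Otherwise the nearer
    left point would be enclosed by its partner and by the segment from the
    origin to the other left point, which have the same sign. *)
Lemma left_left_ccw i j : left_pt i -> left_pt j -> sg i != sg j ->
    0 < (p i).2 * (p j).2 -> (p j).2 < (p i).2 ->
  0 < cross (p i) (p j).
Proof.
move=> li lj o hh ij; rewrite /left_pt in li lj; rewrite /cross.
have osj : sg (s j) = sg i by move: (s_sg j) o; do 3!case: (sg _).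
have osi : sg (s i) = sg j by move: (s_sg i) o; do 3!case: (sg _).
rewrite ltNge; apply/negP => le.
have [i0|i0] := ltrP 0 (p i).2.
- have j0 : 0 < (p j).2 by rewrite -(pmulr_rgt0 _ i0).
  have [|c01 ce _] := @ratio_le1 (p j).2 (p i).2 (mulr_gt0 j0 i0);
    first by rewrite ler_sqr ?nnegrE ltW.
  set c := (p j).2 / (p i).2 in c01 ce.
  have := @no_enclosing (s j) i j c; rewrite osj eq_sym o s_h -ce c01.
  move=> /(_ erefl isT erefl erefl isT).
  have : 0 <= ((p j).1 - c * (p i).1) * (p i).2.
    by rewrite mulrBl mulrAC -ce; lra.
  rewrite pmulr_lge0 //; nra.
- have [|c01 ce j0] := @ratio_le1 (p i).2 (p j).2 hh; first by nra.
  set c := (p i).2 / (p j).2 in c01 ce.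
  have := @no_enclosing (s i) j i c; rewrite osi o s_h -ce c01.
  move=> /(_ erefl isT erefl erefl isT).
  have : 0 <= (c * (p j).1 - (p i).1) * (p j).2.
    by rewrite mulrBl mulrAC -ce; lra.
  have j1 : (p j).2 < 0 by lra.
  rewrite nmulr_lge0 //; nra.
Qed.

Lemma left_left_neq i j : left_pt i -> left_pt j -> sg i != sg j ->
  (p i).2 != (p j).2.
Proof.
move=> li lj o; apply/negP => /eqP h.
have osj : sg (s j) = sg i by move: (s_sg j) o; do 3!case: (sg _).
have osi : sg (s i) = sg j by move: (s_sg i) o; do 3!case: (sg _).
have := @no_enclosing (s j) i j 1 osj; rewrite osj eq_sym o s_h h !mul1r ler01 lexx.
move=> /(_ isT erefl erefl isT).
have := @no_enclosing (s i) j i 1 osi; rewrite osi o s_h h !mul1r ler01 lexx.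
move=> /(_ isT erefl erefl isT).
rewrite /left_pt in li lj; nra.
Qed.

End Horizontal.
End Separated.

(** * Each direction reverses the angular order *)

Lemma finite_gap (R : realFieldType) (I : finType) (A B : pred I) (f : I -> R) :
    (forall i j, A i -> B j -> f i < f j) ->
  exists k, (forall i, A i -> f i < k) /\ (forall j, B j -> k < f j).
Proof.
move=> AB; have [i0 Ai0|A0] := pickP A; last first.
  have [j0 Bj0|B0] := pickP B; last first.
    by exists 0; split=> i; rewrite ?A0 ?B0.
  have [j Bj jmin] := @arg_minP _ R _ j0 B f Bj0.
  exists (f j - 1); split=> i; first by rewrite A0.
  by move=> /jmin; lra.
have [i Ai imax] := @arg_maxP _ R _ i0 A f Ai0.
have [j0 Bj0|B0] := pickP B; last first.
  exists (f i + 1); split=> k; last by rewrite B0.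
  by move=> /imax /=; lra.
have [j Bj jmin] := @arg_minP _ R _ j0 B f Bj0.
have := AB _ _ Ai Bj => ij.
exists ((f i + f j) / 2); split=> k.
  by move=> /imax /=; lra.
by move=> /jmin; lra.
Qed.

Section HorizontalCut.
Variables (R : realType) (I : finType) (sg : I -> bool).
Implicit Types (p : I -> R * R) (s : I -> I).

(** The ray of (k, 1) separates the left points from the right points of the
    upper half plane. It is the place where the angular order is cut. *)
Definition splits p s (k : R) := forall i, 0 < (p i).2 ->
  if left_pt p s i then (p i).1 < k * (p i).2 else k * (p i).2 < (p i).1.

Lemma splits_exists p s : separated sg p -> (forall i, sg (s i) != sg i) ->
  (forall i, (p (s i)).2 = (p i).2) -> exists k, splits p s k.
Proof.
move=> sep s_sg s_h.
have [|k [kL kR]] := @finite_gap R I (fun i => (0 < (p i).2) && left_pt p s i)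
    (fun i => (0 < (p i).2) && ~~ left_pt p s i) (fun i => (p i).1 / (p i).2).
  move=> i j /andP[i0 li] /andP[j0 rj].
  have := left_right_sep sep s_sg s_h li rj (mulr_gt0 i0 j0).
  rewrite pmulr_llt0 // subr_lt0 => h.
  by rewrite ltr_pdivrMr // mulrAC ltr_pdivlMr.
exists k => i i0; case: ifP => li.
  by have := kL i; rewrite i0 li ltr_pdivrMr //; apply.
by have := kR i; rewrite i0 li ltr_pdivlMr //; apply.
Qed.

(** The counterclockwise order read from the ray of (k, 1), for points of
    opposite signs: left points by decreasing height, then right points by
    increasing height. Exchanging partners visibly reverses it. *)
Definition left_before p s i j :=
  [|| left_pt p s i && ~~ left_pt p s j,
      [&& left_pt p s i, left_pt p s j & (p j).2 < (p i).2]
    | [&& ~~ left_pt p s i, ~~ left_pt p s j & (p i).2 < (p j).2]].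

Section Order.
Variables (p : I -> R * R) (s : I -> I) (k : R).
Hypotheses (sep : separated sg p) (s_sg : forall i, sg (s i) != sg i).
Hypotheses (s_h : forall i, (p (s i)).2 = (p i).2) (kP : splits p s k).

Lemma ccw_left_right i j :
  left_pt p s i -> ~~ left_pt p s j -> ccw (k, 1) (p i) (p j).
Proof.
move=> li rj; have L := left_right_sep sep s_sg s_h li rj.
have i0 := left0 sep s_sg s_h li; have j0 := right0 sep s_sg s_h rj.
have ki := kP (i := i); have kj := kP (i := j); rewrite li in ki;
  rewrite (negPf rj) in kj.
rewrite /ccw /cross /= !mul1r !mulr1.
have [hi|hi] := lerP 0 (p i).2.
- have xi : 0 < k * (p i).2 - (p i).1.
    move: hi; rewrite le_eqVlt => /predU1P[h|h]; last by rewrite subr_gt0 ki.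
    by rewrite -h mulr0 sub0r oppr_gt0 i0.
  have [hj|hj] := lerP 0 (p j).2.
    apply: Or33; split=> //; move: hj; rewrite le_eqVlt => /predU1P[h|h].
      by rewrite -h mul0r subr0 j0.
    by rewrite subr_gt0 mulrC kj.
  have [xj|xj] := lerP ((p j).1) (k * (p j).2).
    apply: Or31; split=> //; nra.
  by apply: Or33; split=> //; lra.
- have [hj|hj] := lerP 0 (p j).2.
  have xj : 0 < (p j).1 - (p j).2 * k.
    move: hj; rewrite le_eqVlt => /predU1P[h|h]; last by rewrite subr_gt0 mulrC kj.
    by rewrite -h mul0r subr0 j0.
  have [xi|xi] := lerP (k * (p i).2) ((p i).1).
    by apply: Or32; split=> //; nra.
  by apply: Or33; split=> //; lra.
have c0 : 0 < (p i).1 * (p j).2 - (p i).2 * (p j).1.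
  have /L : 0 < (p i).2 * (p j).2 by nra.
  by rewrite nmulr_llt0 //; lra.
have [xj|xj] := lerP ((p j).1) (k * (p j).2).
  apply: Or31; split=> //; nra.
by apply: Or32; split=> //; lra.
Qed.

Lemma ccw_left_left i j : left_pt p s i -> left_pt p s j -> sg i != sg j ->
  (p j).2 < (p i).2 -> ccw (k, 1) (p i) (p j).
Proof.
move=> li lj o ij; have L := left_left_ccw sep s_sg s_h li lj o.
have i0 := left0 sep s_sg s_h li; have j0 := left0 sep s_sg s_h lj.
have ki := kP (i := i); have kj := kP (i := j); rewrite li in ki; rewrite lj in kj.
rewrite /cross in L; rewrite /ccw /cross /= !mul1r !mulr1.
have [hi|hi] := lerP 0 (p i).2.
- have xi : 0 < k * (p i).2 - (p i).1.
    move: hi; rewrite le_eqVlt => /predU1P[h|h]; last by rewrite subr_gt0 ki.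
    by rewrite -h mulr0 sub0r oppr_gt0 i0.
  have [hj|hj|hj] := ltgtP 0 (p j).2.
  + apply: Or31; split=> //; apply: L => //; nra.
  + have [xj|xj] := lerP ((p j).1) (k * (p j).2).
      apply: Or31; split=> //; nra.
    by apply: Or33; split=> //; lra.
  + apply: Or31; split=> //; rewrite -hj mulr0 sub0r oppr_gt0 pmulr_rlt0 ?j0 //.
    by rewrite hj.
- have c0 : 0 < (p i).1 * (p j).2 - (p i).2 * (p j).1.
    apply: L => //; nra.
  have [xj|xj] := lerP ((p j).1) (k * (p j).2).
    apply: Or31; split=> //; nra.
  by apply: Or32; split=> //; lra.
Qed.

Lemma not_on_cut i : cross (k, 1) (p i) = 0 -> 0 < inner (k, 1) (p i) -> False.
Proof.
have ki := kP (i := i); rewrite /cross /inner /= !mul1r => c0.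
have xE : (p i).1 = k * (p i).2 by lra.
rewrite xE -[X in _ + X]mul1r mulrA -mulrDl pmulr_rgt0; last first.
  by rewrite ltr_wpDl // -expr2 sqr_ge0.
by move/ki; rewrite xE; case: ifP; rewrite ltxx.
Qed.

End Order.

(** The mirror image of the configuration exchanges left and right points. *)
Lemma ccw_right_right p s k i j : separated sg p -> (forall i, sg (s i) != sg i) ->
  (forall i, (p (s i)).2 = (p i).2) -> splits p s k ->
  ~~ left_pt p s i -> ~~ left_pt p s j -> sg i != sg j ->
  (p i).2 < (p j).2 -> ccw (k, 1) (p i) (p j).
Proof.
move=> sep s_sg s_h kP ri rj o ij.
pose q i := (- (p i).1, (p i).2).
have sepq : separated sg q.
  move=> a b c be ga h1 h2 h3 h4 h5 [e1 e2].
  apply: (separated_pair sep (surjective_pairing _) h1 h2 h3 h4 h5 _ e2); lra.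
have lq m : left_pt q s m = ~~ left_pt p s m.
  apply/idP/idP; first by rewrite /left_pt /= -leNgt ltrN2; apply: ltW.
  by move=> /(right_ptE sep s_sg s_h); rewrite /left_pt /= ltrN2.
have kq : splits q s (- k).
  move=> m /= m0; have := kP m m0; rewrite lq; case: left_pt => /=; lra.
have := @ccw_left_left q s (- k) sepq s_sg s_h kq j i.
rewrite !lq eq_sym => /(_ rj ri o ij).
have cE a b : cross (q a) (q b) = cross (p b) (p a) by rewrite /cross /q /=; ring.
have gE a : cross (- k, 1) (q a) = cross (p a) (k, 1) by rewrite /cross /q /=; ring.
have gE' a : cross (q a) (- k, 1) = cross (k, 1) (p a) by rewrite /cross /q /=; ring.
rewrite /ccw cE gE gE' => -[[]|[]|[]] *; [apply: Or32|apply: Or31|apply: Or33] => //.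
Qed.

Lemma ccw_left_before p s k i j : separated sg p -> (forall i, sg (s i) != sg i) ->
  (forall i, (p (s i)).2 = (p i).2) -> splits p s k ->
  sg i != sg j -> left_before p s i j -> ccw (k, 1) (p i) (p j).
Proof.
move=> sep s_sg s_h kP o /or3P[/andP[li rj]|/and3P[li lj h]|/and3P[ri rj h]].
- exact: ccw_left_right.
- exact: ccw_left_left.
- exact: ccw_right_right.
Qed.

Lemma left_before_total p s i j : separated sg p -> (forall i, sg (s i) != sg i) ->
  (forall i, (p (s i)).2 = (p i).2) -> involutive s ->
  sg i != sg j -> left_before p s i j || left_before p s j i.
Proof.
move=> sep s_sg s_h sK o; rewrite /left_before.
have h : left_pt p s i = left_pt p s j -> (p i).2 != (p j).2.
  case li: (left_pt p s i) => /esym lj; first exact: (left_left_neq sep s_sg s_h).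
  have ls m : left_pt p s m = false -> left_pt p s (s m).
    by move/negbT => /(right_ptE sep s_sg s_h); rewrite /left_pt sK.
  rewrite -s_h -(s_h j); apply: (left_left_neq sep s_sg s_h (ls _ li) (ls _ lj)).
  by move: (s_sg i) (s_sg j) o; do 4!case: (sg _).
case li: (left_pt p s i) h => h; case lj: (left_pt p s j) h => h //=; rewrite ?orbF;
  by have := h erefl; rewrite neq_lt orbC.
Qed.

Lemma left_before_rev p s i j : separated sg p -> (forall i, sg (s i) != sg i) ->
  (forall i, (p (s i)).2 = (p i).2) -> involutive s ->
  left_before p s i j -> left_before p s (s j) (s i).
Proof.
move=> sep s_sg s_h sK; rewrite /left_before !s_h.
have ls m : left_pt p s (s m) = ~~ left_pt p s m.
  apply/idP/idP; first by rewrite /left_pt sK -leNgt; apply: ltW.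
  by move/(right_ptE sep s_sg s_h); rewrite /left_pt sK.
by rewrite !ls !negbK; case: left_pt; case: left_pt; rewrite /= ?orbF.
Qed.

End HorizontalCut.

Section DirectionReversal.
Variables (R : realType) (I : finType) (sg : I -> bool).
Variables (p : I -> R * R) (s : I -> I) (u : R * R).
Hypotheses (sep : separated sg p) (s_sg : forall i, sg (s i) != sg i).
Hypotheses (sK : involutive s) (u0 : u != 0).
Hypothesis s_u : forall i, cross u (p (s i)) = cross u (p i).

(** Of two points on a common ray, the one nearer to the origin is a convex
    combination of the origin and the other. *)
Lemma separated_angle i j : sg i != sg j -> angle (p i) != angle (p j).
Proof.
have nz m : p m != 0 by apply/eqP; apply: (nonzero sep s_sg).
move=> o; apply/eqP => e.
wlog le : i j o e / radius (p i) <= radius (p j).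
  move=> W; have [l|l] := lerP (radius (p i)) (radius (p j)); first exact: (W i j).
  by apply: (W j i); rewrite 1?eq_sym // ltW.
have E := angle_eq_ray (nz i) (nz j) e.
have ri := radius_gt0 (nz i); have rj := radius_gt0 (nz j).
apply: (separated_pair sep E (be := radius (p i) / radius (p j)) (ga := 0) erefl o) =>
  //.
- by rewrite divr_ge0 // ltW.
- by rewrite addr0 ler_pdivrMr // mul1r.
- by rewrite mul0r addr0.
- by rewrite mul0r addr0.
Qed.

(** Coordinates along and across u make the lines of direction u horizontal,
    and multiply all cross products by the same positive constant. *)
Theorem direction_reversal : exists2 gam : R,
  0 <= gam < pi *+ 2 & reverses sg s (recut (pi *+ 2) gam (@angle R \o p)).
Proof.
have nz m : p m != 0 by apply/eqP; apply: (nonzero sep s_sg).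
pose q i := (inner u (p i), cross u (p i)).
pose N := u.1 ^+ 2 + u.2 ^+ 2.
have N0 : 0 < N by have := radius_gt0 u0; rewrite sqrtr_gt0.
have sepq : separated sg q.
  move=> a b c be ga h1 h2 h3 h4 h5 [e1 e2].
  have nzN := gt_eqF N0.
  apply: (separated_pair sep (surjective_pairing _) h1 h2 h3 h4 h5).
    apply: (@mulfI _ N); first by rewrite nzN.
    have -> : N * (p c).1 = u.1 * inner u (p c) - u.2 * cross u (p c) by rewrite /N
      /inner /cross; ring.
    by rewrite e1 e2 /N /inner /cross; ring.
  apply: (@mulfI _ N); first by rewrite nzN.
  have -> : N * (p c).2 = u.2 * inner u (p c) + u.1 * cross u (p c) by rewrite /N
    /inner /cross; ring.
  by rewrite e1 e2 /N /inner /cross; ring.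
have s_h i : (q (s i)).2 = (q i).2 by rewrite /q /= s_u.
have [k kP] := splits_exists sepq s_sg s_h.
pose g : R * R := (u.1 * k - u.2, u.2 * k + u.1).
have gi i : cross (k, 1) (q i) = cross g (p i) by rewrite /q /g /cross /inner /=; ring.
have ig i : cross (q i) (k, 1) = cross (p i) g by rewrite /q /g /cross /inner /=; ring.
have ii i : inner (k, 1) (q i) = inner g (p i) by rewrite /q /g /cross /inner /=; ring.
have qq i j : cross (q i) (q j) = N * cross (p i) (p j) by rewrite /q /N /cross /inner
  /=; ring.
have g0 : g != 0.
  apply/eqP => -[h1 h2]; have /eqP :
    g.1 ^+ 2 + g.2 ^+ 2 = 0 by rewrite /g /= h1 h2 expr0n addr0.
  have -> : g.1 ^+ 2 + g.2 ^+ 2 = N * (k ^+ 2 + 1) by rewrite /g /N /=; ring.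
  by rewrite gt_eqF // mulr_gt0 // ltr_wpDl // sqr_ge0.
have ag i : angle (p i) != angle g.
  apply/eqP => e; have E := angle_eq_ray (nz i) g0 e.
  have r0 : 0 < radius (p i) / radius g by rewrite divr_gt0 // radius_gt0.
  apply: (not_on_cut kP (i := i)); rewrite ?gi ?ii E /cross /inner /=; first by ring.
  set r := radius _ / _ in r0 *.
  have -> : g.1 * (r * g.1) + g.2 * (r * g.2) = r * (g.1 ^+ 2 + g.2 ^+ 2) by ring.
  by rewrite mulr_gt0 //; have := radius_gt0 g0; rewrite sqrtr_gt0.
have ccwE i j : ccw (k, 1) (q i) (q j) <-> ccw g (p i) (p j).
  rewrite /ccw gi ig qq (pmulr_rgt0 _ N0); tauto.
exists (angle g); first by have [] := angle_polar g0.
move=> i j o /(ccw_recut g0 (nz i) (nz j) (ag i) (ag j))/ccwE ij.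
apply/(ccw_recut g0 (nz _) (nz _) (ag _) (ag _))/ccwE.
apply: (ccw_left_before sepq s_sg s_h kP (flip_opposite s_sg o)).
apply: (left_before_rev sepq s_sg s_h sK).
have /orP[//|ji] := left_before_total sepq s_sg s_h sK o.
have o' : sg j != sg i by rewrite eq_sym.
have /ccwE := ccw_left_before sepq s_sg s_h kP o' ji.
move: ij => /ccwE /(ccw_recut g0 (nz i) (nz j) (ag i) (ag j)) ij.
by move=> /(ccw_recut g0 (nz j) (nz i) (ag j) (ag i)) /(lt_trans ij); rewrite ltxx.
Qed.

End DirectionReversal.

(** * The first Fourier mode of a balanced configuration *)

Lemma nat_pinch (y1 y2 z A B : nat) : (y1 < A)%N -> (y1 < B)%N -> (A < y2)%N ->
  (B < y2)%N -> z = A \/ z = B -> (z < y1)%N \/ (y2 < z)%N -> False.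
Proof. lia. Qed.

Lemma nat_two_values (x y i A B : nat) : i = A \/ i = B -> x = A \/ x = B ->
  y = A \/ y = B -> i <> y -> x <> y -> i = x.
Proof. lia. Qed.

(** The points r i (cos (a i), sin (a i)) carry signs sg i and run labels T i,
    and moment0 says that the centre of mass of each sign class is the origin.
    Each point is sent to the vertex with number T i of a regular n-gon, that
    is, to the angle 2 pi T i / n, which is twice half_angle (T i). *)
Section FirstMode.
Variables (R : realType) (I : finType) (sg : I -> bool).
Variables (a r : I -> R) (n : nat) (T : I -> nat).
Local Notation pi := (@pi R).
Hypotheses (a_2pi : forall i, 0 <= a i < pi *+ 2) (r_gt0 : forall i, 0 < r i).
Hypothesis L : run_labeling sg a n T.
Hypothesis inhab : forall b, exists i, sg i = b.
Hypothesis same : forall i j, a i = a j -> sg i = sg j.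
Hypothesis moment0 : forall b be, \sum_(i | sg i == b) r i * sin (a i - be) = 0.

Let Tn i : (T i < n)%N := run_lt L i.
Let opp_lt i j : sg i != sg j -> a i < a j ->
  (T i < T j)%N := @run_lt_opp _ _ _ _ _ _ L i j.

Definition half_angle (t : R) := pi * t / n%:R.

Lemma half_angle_lt_pi (s t : nat) : (s < n)%N -> (t < n)%N ->
  - pi < half_angle (s%:R - t%:R) < pi.
Proof.
move=> sn tn; have n0 : 0 < n%:R :> R by rewrite ltr0n; apply: leq_ltn_trans sn.
have p0 := @pi_gt0 R.
have bnd : `|s%:R - t%:R : R| < n%:R.
  have : (s%:R < n%:R :> R) && (t%:R < n%:R :> R) by rewrite !ltr_nat sn.
  have := ler0n R s; have := ler0n R t; rewrite ltr_norml; lra.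
rewrite -ltr_norml /half_angle normrM normfV (gtr0_norm n0) ltr_pdivrMr //.
by rewrite normrM (gtr0_norm p0) ltr_pM2l.
Qed.

Lemma sin_half_gt0 (s t : nat) : (s < n)%N -> (t < s)%N ->
  0 < sin (half_angle (s%:R - t%:R)).
Proof.
move=> sn ts; have /andP[_ h] := half_angle_lt_pi sn (ltn_trans ts sn).
rewrite sin_gt0_pi // h andbT.
have n0 : 0 < n%:R :> R by rewrite ltr0n; apply: leq_ltn_trans sn.
by rewrite /half_angle divr_gt0 // mulr_gt0 ?pi_gt0 // subr_gt0 ltr_nat.
Qed.

Lemma half_angle0 : half_angle 0 = 0. Proof. by rewrite /half_angle mulr0 mul0r. Qed.

Lemma sin_half_ge0 (s t : nat) : (s < n)%N -> (t <= s)%N ->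
  0 <= sin (half_angle (s%:R - t%:R)).
Proof.
move=> sn; rewrite leq_eqVlt => /predU1P[->|/(sin_half_gt0 sn)/ltW//].
by rewrite subrr half_angle0 sin0.
Qed.

Lemma sin_halfC x y : sin (half_angle (x - y)) = - sin (half_angle (y - x)).
Proof. by rewrite -(opprB y) /half_angle mulrN mulNr sinN. Qed.

Lemma sin_half_neq0 (s t : nat) : (s < n)%N -> (t < n)%N ->
  sin (half_angle (s%:R - t%:R)) = 0 -> s = t.
Proof.
move=> sn tn; have [h|h|//] := ltngtP s t => e.
  by have := sin_half_gt0 tn h; rewrite sin_halfC e oppr0 ltxx.
by have := sin_half_gt0 sn h; rewrite e ltxx.
Qed.

(** The moment of the class along that ray would be a sum of positive numbers.
    *)
Lemma class_not_constant b (c : R) : ~ (forall i, sg i = b -> a i = c).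
Proof.
move=> h; have := moment0 b (c - pi / 2%:R).
rewrite (eq_bigr r); last first.
  move=> i /eqP/h ->; have -> : c - (c - pi / 2%:R) = pi / 2%:R by ring.
  by rewrite sin_pihalf mulr1.
have [i ib] := inhab b; rewrite (bigD1 i) ?ib ?eqxx //=.
have : 0 <= \sum_(j | (sg j == b) && (j != i)) r j.
  by apply: sumr_ge0 => j _; apply: ltW.
by have := r_gt0 i; lra.
Qed.

(** If the class b preceded the other class, then b would lie in the angles
    from 0 to pi, or the other class in those from pi to 2 pi. That class,
    having moment zero, would then lie on a single ray. *)
Lemma classes_interleave b : ~ (forall i j, sg i = b -> sg j = ~~ b -> a i < a j).
Proof.
move=> h; have [[y yb yp]|hi] := pselect (exists2 y, sg y = ~~ b & a y < pi).
  apply: (@class_not_constant b 0) => i ib.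
  have s0 j : sg j == b -> 0 <= r j * sin (a j - 0).
    move=> /eqP jb; rewrite subr0 mulr_ge0 ?(ltW (r_gt0 _)) // sin_ge0_pi //.
    by have := h j y jb yb; have := a_2pi j; lra.
  have /eqP := moment0 b 0; rewrite psumr_eq0 // => /allP /(_ i (mem_index_enum _)).
  rewrite ib eqxx /= mulf_eq0 (gt_eqF (r_gt0 _)) /= subr0 => /eqP si.
  have := h i y ib yb; have /andP[a0 a1] := a_2pi i; move=> iy.
  apply/eqP; rewrite eq_le a0 andbT leNgt; apply/negP => ai.
  by have := @sin_gt0_pi R (a i); rewrite si ltxx ai (lt_trans iy yp) => /(_ isT).
apply: (@class_not_constant (~~ b) pi) => i ib.
have pj j : sg j = ~~ b -> pi <= a j.
  by move=> jb; rewrite leNgt; apply/negP => jp; apply: hi; exists j.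
have s0 j : sg j == ~~ b -> 0 <= r j * sin (a j - pi).
  move=> /eqP jb; rewrite mulr_ge0 ?(ltW (r_gt0 _)) // sin_ge0_pi //.
  by have := pj j jb; have := a_2pi j; lra.
have /eqP := moment0 (~~ b) pi; rewrite psumr_eq0 // => /allP /(_ i (mem_index_enum _)).
rewrite ib eqxx /= mulf_eq0 (gt_eqF (r_gt0 _)) /= => /eqP si.
have := a_2pi i; have := pj i ib => h1 h2.
have [//|d] := eqVneq (a i) pi.
have : pi < a i by rewrite lt_neqAle eq_sym d.
have : 0 < a i - pi < pi by lra.
by move/sin_gt0_pi; rewrite si ltxx.
Qed.

Section Line.
Variable be : R.
Hypotheses (be_ge0 : 0 <= be) (be_ltpi : be < pi).
Let v i := r i * sin (a i - be).

Lemma v_gt0 i : (0 < v i) = (be < a i < be + pi).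
Proof.
have b1 := be_ge0; have b2 := be_ltpi.
rewrite pmulr_rgt0 //; have ai := a_2pi i; apply/idP/idP => [s0|h]; last first.
  by rewrite sin_gt0_pi //; lra.
rewrite ltNge; have [h1|h1] /= := lerP (a i) be.

  have : - pi <= a i - be <= 0 by lra.
  by move/sin_le0_Npi; rewrite leNgt s0.
rewrite ltNge; apply/negP => h2.
have e : sin (a i - be) = - sin (a i - be - pi) by rewrite -sinDpi subrK.
have : 0 <= a i - be - pi <= pi by lra.
by move/sin_ge0_pi; lra.
Qed.

Lemma v_lt0 i : v i < 0 -> a i < be \/ be + pi < a i.
Proof.
have b1 := be_ge0; have b2 := be_ltpi.
move=> v0; have [h|h] := ltrP (a i) be; [by left|right].
rewrite ltNge; apply/negP => h'; move: v0; rewrite ltNge => /negP; apply.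
by rewrite mulr_ge0 ?(ltW (r_gt0 _)) // sin_ge0_pi //; lra.
Qed.

Lemma v_eq0 i : v i = 0 -> a i = be \/ a i = be + pi.
Proof.
have b1 := be_ge0; have b2 := be_ltpi.
move=> v0; have ai := a_2pi i; have s0 : sin (a i - be) = 0.
  by move/eqP: v0; rewrite mulf_eq0 (gt_eqF (r_gt0 _)) => /eqP.
have [h|h|h] := ltgtP (a i) be; [|right|by left].
  have : 0 < be - a i < pi by lra.
  by move/sin_gt0_pi; rewrite -opprB sinN s0 oppr0 ltxx.
have [h'|h'|//] := ltgtP (a i) (be + pi).
  have : 0 < a i - be < pi by lra.
  by move/sin_gt0_pi; rewrite s0 ltxx.
have e : sin (a i - be) = - sin (a i - be - pi) by rewrite -sinDpi subrK.
have : 0 < a i - be - pi < pi by lra.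
by move/sin_gt0_pi; lra.
Qed.

Lemma pos_neg b i : sg i = b -> v i != 0 ->
  exists x y, [/\ sg x = b, sg y = b, 0 < v x & v y < 0].
Proof.
move=> ib vi; have [x /andP[xb vx]|np] := pickP (fun x => (sg x == b) && (0 < v x));
  last first.
  exfalso; have : \sum_(i | sg i == b) - v i = 0 by rewrite sumrN moment0 oppr0.
  move/eqP; rewrite psumr_eq0.
    move=> /allP /(_ i (mem_index_enum _)); rewrite ib eqxx /= oppr_eq0.
    by rewrite (negPf vi).
  by move=> j jb; have := np j; rewrite jb /= oppr_ge0 leNgt => ->.
have [y /andP[yb vy]|nn] := pickP (fun x => (sg x == b) && (v x < 0)); last first.
  exfalso; have /eqP := moment0 b be; rewrite psumr_eq0.
    move=> /allP /(_ i (mem_index_enum _)); rewrite ib eqxx /=.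
    by rewrite -/(v i) (negPf vi).
  by move=> j jb; have := nn j; rewrite jb /= leNgt => ->.
by exists x, y; rewrite (eqP xb) (eqP yb).
Qed.

Lemma flat_class b : (forall i, sg i = b -> v i = 0) ->
  (exists2 x, sg x = b & a x = be) /\ (exists2 y, sg y = b & a y = be + pi).
Proof.
move=> fl; split.
  have [//|h] := pselect (exists2 x, sg x = b & a x = be).
  exfalso; apply: (@class_not_constant b (be + pi)) => i ib.
  by have [e|//] := v_eq0 (fl i ib); exfalso; apply: h; exists i.
have [//|h] := pselect (exists2 x, sg x = b & a x = be + pi).
exfalso; apply: (@class_not_constant b be) => i ib.
by have [//|e] := v_eq0 (fl i ib); exfalso; apply: h; exists i.
Qed.

(** Suppose that off the line only the extreme labels A and B of its positive
    side occur. If one class lies on the line, it has points at both ends of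
    it, and the negative points of the other class have labels outside the
    interval from A to B. Otherwise each class has a single label off the line,
    and one class precedes the other. *)
Lemma two_labels_false A B : (exists2 k, 0 < v k & T k = A) ->
    (exists2 k, 0 < v k & T k = B) ->
  ~ (forall i, v i != 0 -> T i = A \/ T i = B).
Proof.
have b1 := be_ge0; have b2 := be_ltpi.
move=> [kA vA TA] [kB vB TB] hE.
have nz_gt i : 0 < v i -> v i != 0 by move=> h; rewrite gt_eqF.
have nz_lt i : v i < 0 -> v i != 0 by move=> h; rewrite lt_eqF.
have p0 := @pi_gt0 R.
have nb b x y : sg x = b -> sg y = ~~ b -> sg x != sg y by move=> -> ->; case: b.
have lt b x y : sg x = b -> sg y = ~~ b -> a x < a y -> (T x < T y)%N.
  by move=> xb yb; apply: opp_lt; apply: nb xb yb.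
have lt' b x y : sg x = ~~ b -> sg y = b -> a x < a y -> (T x < T y)%N.
  by move=> xb yb; apply: opp_lt; rewrite eq_sym; apply: nb yb xb.
have nflat b : ~ (forall i, sg i = ~~ b -> v i = 0).
  move=> fl; have Pb k : 0 < v k -> sg k = b.
    move=> vk; apply/eqP/negPn/negP => /negPf h.
    have /fl : sg k = ~~ b by move: h; case: (sg k); case: (b).
    by move=> e; rewrite e ltxx in vk.
  have [[y1 y1b y1E] [y2 y2b y2E]] := flat_class fl.
  have [x [z [xb zb vx vz]]] := pos_neg (Pb _ vA) (nz_gt _ vA).
  have := vA; have := vB; rewrite !v_gt0 => /andP[B1 B2] /andP[A1 A2].
  have t1 : (T y1 < A)%N.
    by rewrite -TA; apply: (lt' b) => //; [exact: Pb | rewrite y1E].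
  have t2 : (B < T y2)%N.
    by rewrite -TB; apply: (lt b) => //; [exact: Pb | rewrite y2E].
  have t3 : (T y1 < B)%N.
    by rewrite -TB; apply: (lt' b) => //; [exact: Pb | rewrite y1E].
  have t4 : (A < T y2)%N.
    by rewrite -TA; apply: (lt b) => //; [exact: Pb | rewrite y2E].
  apply: (nat_pinch t1 t3 t4 t2 (hE _ (nz_lt _ vz))).
  case: (v_lt0 vz) => az; [left; apply: (lt b)|right; apply: (lt' b)] => //.
    by rewrite y1E.
  by rewrite y2E.
have full b : exists x x', [/\ sg x = b, sg x' = b, 0 < v x & v x' < 0].
  have [[i ib vi]|h] := pselect (exists2 i, sg i = b & v i != 0).
    exact: (pos_neg ib vi).
  exfalso; apply: (nflat (~~ b)) => i; rewrite negbK => ib.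
  by apply/eqP/negPn/negP => vi; apply: h; exists i.
have par b x y : sg x = b -> sg y = ~~ b -> T x <> T y.
  by move=> xb yb e; have := nb _ _ _ xb yb; rewrite (run_sign L) e eqxx.
have key b C D : (C < D)%N -> (forall i, sg i = b -> v i != 0 -> T i = C) ->
    (forall i, sg i = ~~ b -> v i != 0 -> T i = D) -> False.
  move=> CD hC hD; apply: (@classes_interleave b) => x y xb yb.
  have [x1 [x2 [x1b x2b x1v x2v]]] := full b.
  have [y1 [y2 [y1b y2b y1v y2v]]] := full (~~ b).
  have off x' y' : sg x' = b -> sg y' = ~~ b -> v x' != 0 -> v y' != 0 -> a x' < a y'.
    by move=> xb' yb' vx vy; apply: (lt_run_opp L); rewrite (hC _ xb' vx) (hD _ yb' vy).
  have x1y1 := off _ _ x1b y1b (nz_gt _ x1v) (nz_gt _ y1v).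
  have x2y1 := off _ _ x2b y1b (nz_lt _ x2v) (nz_gt _ y1v).
  have x1y2 := off _ _ x1b y2b (nz_gt _ x1v) (nz_lt _ y2v).
  have /andP[x1l x1r] : be < a x1 < be + pi by rewrite -v_gt0.
  have /andP[y1l y1r] : be < a y1 < be + pi by rewrite -v_gt0.
  have bepi : be < be + pi by rewrite ltrDl.
  have ax2 : a x2 < be.
    case: (v_lt0 x2v) => // h.
    by have := lt_trans h (lt_trans x2y1 y1r); rewrite ltxx.
  have ay2 : be + pi < a y2.
    case: (v_lt0 y2v) => // h.
    by have := lt_trans (lt_trans x1l x1y2) h; rewrite ltxx.
  have yon : v y = 0 -> a y = be + pi.
    case/v_eq0 => // ay.
    have h1 : (T x2 < T y)%N by apply: (lt b) => //; rewrite ay.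
    have h2 : (T y < T x1)%N by apply: (lt' b) => //; rewrite ay.
    have := ltn_trans h1 h2; rewrite (hC x1) ?nz_gt // (hC x2) ?nz_lt //.
    by rewrite ltnn.
  have xon : v x = 0 -> a x = be.
    case/v_eq0 => // ax.
    have h1 : (T y1 < T x)%N by apply: (lt' b) => //; rewrite ax.
    have h2 : (T x < T y2)%N by apply: (lt b) => //; rewrite ax.
    have := ltn_trans h1 h2; rewrite (hD y1) ?nz_gt // (hD y2) ?nz_lt //.
    by rewrite ltnn.
  have sgn z : v z != 0 -> 0 < v z \/ v z < 0.
    by case: (ltgtP (v z) 0) => //; [right|left].
  have [vx|vx] := eqVneq (v x) 0; have [vy|vy] := eqVneq (v y) 0.
  + by rewrite xon // yon.
  + rewrite xon //; case: (sgn _ vy) => [|vy']; first by rewrite v_gt0 => /andP[].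
    case: (v_lt0 vy') => h; last exact: lt_trans h.
    exact: lt_trans x1l (off _ _ x1b yb (nz_gt _ x1v) vy).
  + rewrite yon //; case: (sgn _ vx) => [|vx']; first by rewrite v_gt0 => /andP[].
    case: (v_lt0 vx') => h; first exact: lt_trans bepi.
    exact: lt_trans (off _ _ xb y1b vx (nz_gt _ y1v)) y1r.
  + exact: off.
have [x [_ [xb _ xv _]]] := full true; have [y [_ [yb _ yv _]]] := full false.
have hT i : sg i = true -> v i != 0 -> T i = T x.
  move=> ib vi; apply: (nat_two_values (hE _ vi) (hE _ (nz_gt _ xv)) (hE _ (nz_gt _
    yv))).
    exact: (par true).
  exact: (par true).
have hF i : sg i = false -> v i != 0 -> T i = T y.
  move=> ib vi; apply: (nat_two_values (hE _ vi) (hE _ (nz_gt _ yv)) (hE _ (nz_gt _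
    xv))).
    exact/nesym/(par true).
  exact/nesym/(par true).
have := par true _ _ xb yb.
have [h|h|//] := ltngtP (T x) (T y); first by move=> _; apply: (key true _ _ h).
by move=> _; apply: (key false _ _ h).
Qed.

(** Let A and B be the extreme labels on the positive side of the line. The
    product of the sines of half_angle (t - A) and half_angle (B - t) has the
    sign of (t - A) (B - t), and is a linear combination of 1 and of the cosine
    and the sine of 2 half_angle t. Its sum against v has no negative term
    because the labels are monotone; if the sum is zero, all terms vanish and
    only the labels A and B occur off the line. *)
Lemma first_mode_line :
  ~ (\sum_i v i * cos (2 * half_angle (T i)%:R) = 0 /\
     \sum_i v i * sin (2 * half_angle (T i)%:R) = 0).
Proof.
have b1 := be_ge0; have b2 := be_ltpi.
move=> [hc hs].
have vsum : \sum_i v i = 0.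
  rewrite (bigID (fun i => sg i == true)) /= moment0 add0r.
  by rewrite (eq_bigl (fun i => sg i == false)) ?moment0 // => i; case: (sg i).
have [k0 vk0|np] := pickP (fun x => 0 < v x); last first.
  have v0 i : v i = 0.
    have : \sum_i - v i = 0 by rewrite sumrN vsum oppr0.
    move/eqP; rewrite psumr_eq0; last by move=> j _; rewrite oppr_ge0 leNgt np.
    by move=> /allP /(_ i (mem_index_enum _)); rewrite oppr_eq0 => /eqP.
  have [[x xb xE] _] := @flat_class true (fun i _ => v0 i).
  have [[y yb yE] _] := @flat_class false (fun i _ => v0 i).
  by have := @same x y; rewrite xE yE xb yb => /(_ erefl).
have [kA vA minA] := @arg_minP _ _ _ k0 (fun i => 0 < v i) T vk0.
have [kB vB maxB] := @arg_maxP _ _ _ k0 (fun i => 0 < v i) T vk0.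
set A := T kA in minA *; set B := T kB in maxB *.
apply: (@two_labels_false A B); [by exists kA|by exists kB|].
pose F t := sin (half_angle (t%:R - A%:R)) * sin (half_angle (B%:R - t%:R)).
have FE t : F t =
    (cos (half_angle A%:R) * sin (half_angle B%:R)
      + sin (half_angle A%:R) * cos (half_angle B%:R)) / 2 * sin (2 * half_angle t%:R)
  + (cos (half_angle A%:R) * cos (half_angle B%:R)
      - sin (half_angle A%:R) * sin (half_angle B%:R)) / 2 * cos (2 * half_angle t%:R)
  - (cos (half_angle A%:R) * cos (half_angle B%:R)
      + sin (half_angle A%:R) * sin (half_angle B%:R)) / 2.
  have hB x y : half_angle (x - y) = half_angle x - half_angle y.
    by rewrite /half_angle mulrBr mulrBl.
  rewrite /F !hB !sinB mulr_natl sin_mulr2n cos_mulr2n !mulr2n.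
  have s2 : sin (half_angle t%:R) * sin (half_angle t%:R) =
      1 - cos (half_angle t%:R) * cos (half_angle t%:R).
    by rewrite -!expr2 sin2cos2.
  move: (cos (half_angle t%:R)) (sin (half_angle t%:R)) s2 => ct st s2.
  move: (cos (half_angle A%:R)) (sin (half_angle A%:R)) => ca sa.
  move: (cos (half_angle B%:R)) (sin (half_angle B%:R)) => cb sb.
  have -> : (st * ca - ct * sa) * (sb * ct - cb * st) =
    st * ct * (ca * sb + sa * cb) - st * st * (ca * cb) - ct * ct * (sa * sb) by ring.
  by rewrite s2; field.
have Fsum : \sum_i v i * F (T i) = 0.
  under eq_bigr => i _ do rewrite FE mulrBr mulrDr !(mulrCA (v i)).
  rewrite sumrB big_split /= -!mulr_sumr hc hs.
  by rewrite -mulr_suml vsum mul0r !mulr0 addr0 subr0.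
have Fterm i : 0 <= v i * F (T i).
  have AB : (A <= B)%N by apply: minA.
  have [vi|vi|<-] := ltgtP 0 (v i); last by rewrite mul0r.
    have Ai : (A <= T i)%N by apply: minA.
    have iB : (T i <= B)%N by apply: maxB.
    by rewrite mulr_ge0 ?(ltW vi) // mulr_ge0 // sin_half_ge0 ?Tn.
  rewrite nmulr_rge0 // /F; have aA := vA; rewrite v_gt0 in aA.
  have aB := vB; rewrite v_gt0 in aB.
  case: (v_lt0 vi) => ai.
    have iA : (T i <= A)%N by apply: (run_mono L); lra.
    rewrite sin_halfC mulNr oppr_le0 mulr_ge0 // sin_half_ge0 ?Tn //.
    exact: leq_trans AB.
  have iB : (B <= T i)%N by apply: (run_mono L); lra.
  rewrite [X in _ * X]sin_halfC mulrN oppr_le0 mulr_ge0 // sin_half_ge0 ?Tn //.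
  exact: leq_trans iB.
move=> i vi; move/eqP: Fsum; rewrite psumr_eq0 //.
move=> /allP /(_ i (mem_index_enum _)); rewrite /= mulf_eq0 (negPf vi) /= /F mulf_eq0.
case/orP => /eqP; first by move=> /(sin_half_neq0 (Tn _) (Tn _)); left.
by move=> /(sin_half_neq0 (Tn _) (Tn _)); right.
Qed.

End Line.
End FirstMode.

(** * Plane configurations with equal X-rays in four directions *)

Lemma recut_recut (R : realType) (I : finType) (P g1 g : R) (th : I -> R) :
    0 <= g1 < P -> 0 <= g < P -> (forall i, 0 <= th i < P) ->
  exists g', forall i, recut P g' (recut P g1 th) i = recut P g th i.
Proof.
move=> h1 h hth; exists (if g < g1 then g - g1 + P else g - g1) => i.
have := hth i; rewrite /recut; case: (ltrP g g1) => a; case: (ltrP (th i) g1) => b;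
  case: (ltrP (th i) g) => c; case: ltrP => d; lra.
Qed.

Section Direction.
Variables (I : finType) (n : nat) (K : comNzRingType) (w : K).
Hypothesis wn : w ^+ n = 1.

(** The labels of i and s i sum to a constant modulo n: s acts on the vertices
    of the regular n-gon as a reflection. *)
Lemma recut_character (R : realType) (sg : I -> bool) (s : I -> I) (P gam : R)
    (a : I -> R) T :
    (forall i, 0 <= a i < P) -> involutive s -> (forall i, sg (s i) != sg i) ->
    (forall i j, a i = a j -> sg i = sg j) -> reverses sg s (recut P gam a) ->
    ~~ odd n -> run_labeling sg a n T ->
  exists2 z, z ^+ n = 1 & forall i, w ^+ T i * w ^+ T (s i) = z.
Proof.
move=> aP sK s_sg same rv en L.
have [m [T' [mn L' TT]]] := recut_labeling aP sK s_sg rv same en L.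
have TE i : w ^+ T i = w ^+ (T' i + m).
  by have [->//|->] := TT i; rewrite exprD wn mulr1.
exists (w ^+ (n.-1 + m + m)); first by rewrite -exprM mulnC exprM wn expr1n.
move=> i; rewrite !TE -exprD; congr (_ ^+ _).
by have := run_reversal s_sg L' rv i; lia.
Qed.
End Direction.

Lemma sum_complex (R : realType) (I : finType) (F G : I -> R) :
  \sum_i (F i +i* G i)%C = ((\sum_i F i) +i* (\sum_i G i))%C.
Proof. by elim: (index_enum I) => [|i r IH]; rewrite ?big_nil // !big_cons IH. Qed.

Section Core.
Variables (R : realType) (I : finType) (i0 : I) (sg : I -> bool) (p : I -> R * R).
Variables (s1 s2 s3 s4 : I -> I).
Hypothesis sep : separated sg p.
Hypotheses (K1 : involutive s1) (K2 : involutive s2).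
Hypotheses (K3 : involutive s3) (K4 : involutive s4).
Hypotheses (S1 : forall i, sg (s1 i) != sg i) (S2 : forall i, sg (s2 i) != sg i).
Hypotheses (S3 : forall i, sg (s3 i) != sg i) (S4 : forall i, sg (s4 i) != sg i).
Hypothesis U1 : forall i, (p (s1 i)).2 = (p i).2.
Hypothesis U2 : forall i, (p (s2 i)).1 = (p i).1.
Hypothesis U3 : forall i, (p (s3 i)).2 - (p (s3 i)).1 = (p i).2 - (p i).1.
Hypothesis U4 : forall i, (p (s4 i)).2 - 8 * (p (s4 i)).1 = (p i).2 - 8 * (p i).1.
Hypothesis sum1 : forall b, \sum_(i | sg i == b) (p i).1 = 0.
Hypothesis sum2 : forall b, \sum_(i | sg i == b) (p i).2 = 0.
Local Notation pi := (@pi R).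
Local Notation C := (R[i])%type.

(** Let A f be the sum of the w ^+ T i f i, for w a primitive n-th root of
    unity, and B f its conjugate. A form f invariant under a reflection of the
    n-gon satisfies A f = z B f for a root of unity z. The forms y, x, y - x
    and y - 8 x give four such relations between the values of A and B at x and
    y, and eliminating these values exhibits the cross-ratio 8 of the four
    directions as a cross-ratio of roots of unity. The elimination is possible
    because A vanishes at no real linear form other than zero. *)
Lemma no_centered_configuration : False.
Proof.
have nz i : p i != 0 by apply/eqP; apply: (nonzero sep S1).
have th2 i : 0 <= angle (p i) < pi *+ 2 by have [] := angle_polar (nz i).
have u1x (x : R) : (1, x) != 0 :> R * R by apply/eqP => -[/eqP]; rewrite oner_eq0.
have u01 : (0, 1) != 0 :> R * R by apply/eqP => -[/eqP]; rewrite oner_eq0.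
have c1 i : cross (1, 0) (p (s1 i)) = cross (1, 0) (p i).
  by rewrite /cross /= U1; ring.
have c2 i : cross (0, 1) (p (s2 i)) = cross (0, 1) (p i).
  by rewrite /cross /= U2; ring.
have c3 i : cross (1, 1) (p (s3 i)) = cross (1, 1) (p i).
  by rewrite /cross /= !mul1r U3.
have c4 i : cross (1, 8) (p (s4 i)) = cross (1, 8) (p i).
  by rewrite /cross /= !mul1r U4.
have [g1 g1b r1] := direction_reversal sep S1 K1 (u1x 0) c1.
pose a := recut (pi *+ 2) g1 (@angle R \o p).
have aP i : 0 <= a i < pi *+ 2.
  by rewrite /a /recut /=; have := th2 i; case: ltrP; lra.
have same i j : a i = a j -> sg i = sg j.
  move=> e; apply/eqP/negPn/negP => o; have /negP := separated_angle sep S1 o; apply.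
  apply/eqP; move: e; rewrite /a /recut /=; have := th2 i; have := th2 j.
  by case: ltrP => ?; case: ltrP => ?; lra.
have [n [T L]] := run_labeling_exists i0 same.
have en : ~~ odd n := run_reversal_even S1 i0 L r1.
have n0 : (0 < n)%N by apply: leq_ltn_trans (run_lt L i0).
pose x t : R := 2 * half_angle n t%:R.
pose w : C := (cos (x 1) +i* sin (x 1))%C.
have wt t : w ^+ t = (cos (x t) +i* sin (x t))%C.
  elim: t => [|t IH]; first by rewrite expr0 /x half_angle0 mulr0 cos0 sin0.
  rewrite exprS IH /w /GRing.mul /=.
  have -> : x t.+1 = x 1%N + x t by rewrite /x /half_angle -natr1; ring.
  by rewrite sinD cosD addrC [X in (_ +i* X)%C]addrC.
have wn : w ^+ n = 1.
  rewrite wt; have -> : x n = pi *+ 2.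
    by rewrite /x /half_angle mulfK ?mulr_natl // pnatr_eq0 -lt0n.
  by rewrite cos2pi sin2pi.
have char s u : involutive s -> (forall i, sg (s i) != sg i) -> u != 0 ->
    (forall i, cross u (p (s i)) = cross u (p i)) ->
    exists2 z, z ^+ n = 1 & forall i, w ^+ T i * w ^+ T (s i) = z.
  move=> sK sS u0 su; have [g gb rv] := direction_reversal sep sS sK u0 su.
  have [g' g'E] := recut_recut g1b gb th2.
  apply: (recut_character wn aP sK sS same (gam := g') _ en L) => i j o.
  by rewrite !g'E; apply: rv.
have [z1 e1 Z1] := char _ _ K1 S1 (u1x 0) c1.
have [z2 e2 Z2] := char _ _ K2 S2 u01 c2.
have [z3 e3 Z3] := char _ _ K3 S3 (u1x 1) c3.
have [z4 e4 Z4] := char _ _ K4 S4 (u1x 8) c4.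
have wU : w \is a GRing.unit.
  by rewrite unitfE; apply: contra_eqN wn => /eqP ->;
    rewrite expr0n gtn_eqF //= eq_sym oner_neq0.
pose A (f : I -> R) : C := \sum_i w ^+ T i * (f i)%:C%C.
pose B (f : I -> R) : C := \sum_i w ^- T i * (f i)%:C%C.
have rel s z f : involutive s -> (forall i, w ^+ T i * w ^+ T (s i) = z) ->
    (forall i, f (s i) = f i) -> A f = z * B f.
  move=> sK zE fs; rewrite /A (reindex_inj (inv_inj sK)) /= mulr_sumr.
  apply: eq_bigr => i _; rewrite fs -(zE i) mulrA; congr (_ * _).
  by rewrite mulrAC mulrV ?mul1r // unitrX.
have AL f g c : A (fun i => f i - c * g i) = A f - c%:C%C * A g.
  rewrite /A mulr_sumr -sumrB; apply: eq_bigr => i _.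
  by rewrite rmorphB rmorphM /=; ring.
have BL f g c : B (fun i => f i - c * g i) = B f - c%:C%C * B g.
  rewrite /B mulr_sumr -sumrB; apply: eq_bigr => i _.
  by rewrite rmorphB rmorphM /=; ring.
have BA f : B f = conjc (A f).
  rewrite /A rmorph_sum; apply: eq_bigr => i _;
    rewrite rmorphM /= oppr0 wt -[(f i +i* 0)%C]/((f i)%:C%C).
  congr (_ * _); apply: (mulfI (x := (cos (x (T i)) +i* sin (x (T i)))%C)).
    by rewrite -wt -unitfE unitrX.
  rewrite divff; last by rewrite -wt -unitfE unitrX.
  apply/eqP; rewrite eq_complex /=; apply/andP; split; apply/eqP.
    by rewrite mulrN opprK -!expr2 cos2Dsin2.
  by ring.
have nonvanish (u : R * R) : u != 0 -> A (fun i => inner u (p i)) != 0.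
  move=> u0; apply/eqP => A0.
  pose q : R * R := (u.2, - u.1).
  have q0 : q != 0.
    apply: contra_neq u0 => -[h1 /eqP]; rewrite oppr_eq0 => /eqP h2.
    by rewrite (surjective_pairing u) h1 h2.
  have [qb _ _] := angle_polar q0.
  pose b := if angle q < g1 then angle q - g1 + pi *+ 2 else angle q - g1.
  have bb : 0 <= b < pi *+ 2 by rewrite /b; case: ltrP; lra.
  have sinE c i : sin (a i - c) = sin (angle (p i) - g1 - c).
    by rewrite /a /recut /= sinB [RHS]sinB; case: ifP; rewrite ?sinD2pi ?cosD2pi.
  have innerE i : inner u (p i) = radius q * (radius (p i) * sin (a i - b)).
    have -> : inner u (p i) = cross q (p i) by rewrite /cross /inner /q /=; ring.
    rewrite cross_polar // mulrA sinE; congr (_ * _).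
    have -> : angle (p i) - angle q = angle (p i) - g1 - (angle q - g1) by ring.
    by rewrite /b sinB [RHS]sinB; case: ifP; rewrite ?sinD2pi ?cosD2pi.
  have sums : \sum_i inner u (p i) * cos (x (T i)) = 0 /\
      \sum_i inner u (p i) * sin (x (T i)) = 0.
    have AE : A (fun i => inner u (p i)) = ((\sum_i inner u (p i) * cos (x (T i))) +i*
       (\sum_i inner u (p i) * sin (x (T i))))%C.
      rewrite /A -sum_complex; apply: eq_bigr => i _; rewrite wt; apply/eqP;
        rewrite eq_complex /=; apply/andP.
      by split; apply/eqP; ring.
    by move: A0; rewrite AE => -[].
  have mom b' c : \sum_(i | sg i == b') radius (p i) * sin (a i - c) = 0.
    rewrite (eq_bigr (fun i => cos (g1 + c) * (p i).2 - sin (g1 + c) * (p i).1)).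
      by rewrite sumrB -!mulr_sumr sum1 sum2 !mulr0 subr0.
    move=> i _; have [_ -> ->] := angle_polar (nz i); rewrite sinE.
    have -> : angle (p i) - g1 - c = angle (p i) - (g1 + c) by ring.
    by rewrite sinB; ring.
  have inh b' : exists i, sg i = b'.
    by have [k _ kb] := sg_choice S1 i0 b'; exists k.
  have rp i : 0 < radius (p i) by apply: radius_gt0.
  have rq := radius_gt0 q0.
  have [bpi|bpi] := ltrP b pi.
    apply: (first_mode_line aP rp L inh same mom (be := b)) => //;
      first by case/andP: bb.
    have [sc ss] := sums; split; apply: (mulfI (lt0r_neq0 rq)); rewrite mulr0 mulr_sumr.
      by rewrite -[RHS]sc; apply: eq_bigr => i _; rewrite innerE /x; ring.
    by rewrite -[RHS]ss; apply: eq_bigr => i _; rewrite innerE /x; ring.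
  have flip i : sin (a i - (b - pi)) = - sin (a i - b).
    by rewrite -sinDpi; congr sin; ring.
  apply: (first_mode_line aP rp L inh same mom (be := b - pi)); [lra|lra|].
  have [sc ss] := sums; split; apply: (mulfI (lt0r_neq0 rq)); rewrite mulr0 mulr_sumr.
    transitivity (- (\sum_i inner u (p i) * cos (x (T i)))); last by rewrite sc oppr0.
    by rewrite -sumrN; apply: eq_bigr => i _; rewrite innerE flip /x; ring.
  transitivity (- (\sum_i inner u (p i) * sin (x (T i)))); last by rewrite ss oppr0.
  by rewrite -sumrN; apply: eq_bigr => i _; rewrite innerE flip /x; ring.
pose f1 i := (p i).1; pose f2 i := (p i).2.
have E1 := rel _ _ f2 K1 Z1 U1.
have E2 := rel _ _ f1 K2 Z2 U2.
have E3 : A f2 - A f1 = z3 * (B f2 - B f1).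
  have := rel _ _ (fun i => f2 i - 1 * f1 i) K3 Z3; rewrite AL BL !mul1r; apply.
  by move=> i; rewrite !mul1r; apply: U3.
have E4 : A f2 - 8 * A f1 = z4 * (B f2 - 8 * B f1).
  have := rel _ _ (fun i => f2 i - 8 * f1 i) K4 Z4; rewrite AL BL rmorph_nat; apply.
  exact: U4.
have A1 : A f1 != 0.
  have -> : A f1 = A (fun i => inner (1, 0) (p i)).
    by apply: eq_bigr => i _; rewrite /inner /= mul1r mul0r addr0.
  by apply: nonvanish; apply/eqP => -[/eqP]; rewrite oner_eq0.
have A2 : A f2 != 0.
  have -> : A f2 = A (fun i => inner (0, 1) (p i)).
    by apply: eq_bigr => i _; rewrite /inner /= mul1r mul0r add0r.
  by apply: nonvanish; apply/eqP => -[/eqP]; rewrite oner_eq0.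
have B1 : B f1 != 0 by apply: contra_neq A1 => e; rewrite E2 e mulr0.
have B2 : B f2 != 0 by apply: contra_neq A2 => e; rewrite E1 e mulr0.
have z12 : z1 != z2.
  apply/eqP => z12; pose r := A f2 / A f1.
  have rr : conjc r = r.
    rewrite /r rmorphM fmorphV /= -!BA E1 E2 z12.
    have z20 : z2 != 0 by apply: contra_neq A1 => e; rewrite E2 e mul0r.
    by field; rewrite B1 z20.
  have rE : r = (complex.Re r)%:C%C.
    move: rr; case: r => x0 y0 [] /eqP; rewrite eq_sym -addr_eq0 -mulr2n mulrn_eq0 /=.
    by move/eqP->.
  have : (- complex.Re r, 1) != 0 :> R * R by apply/eqP => -[_ /eqP]; rewrite oner_eq0.
  move/nonvanish; rewrite (_ : A _ = A f2 - (complex.Re r)%:C%C * A f1); last first.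
    by rewrite -AL; apply: eq_bigr => i _; rewrite /inner /f1 /f2 /= mul1r mulNr addrC.
  by rewrite -rE divfK // subrr eqxx.
have E3' : (z1 - z3) * B f2 = (z2 - z3) * B f1.
  apply/eqP; rewrite -subr_eq0; move/eqP: E3; rewrite E1 E2 -subr_eq0 => /eqP <-.
  by apply/eqP; ring.
have E4' : (z1 - z4) * B f2 = 8 * (z2 - z4) * B f1.
  apply/eqP; rewrite -subr_eq0; move/eqP: E4; rewrite E1 E2 -subr_eq0 => /eqP <-.
  by apply/eqP; ring.
apply: (@cross_ratio_unity_roots _ n z1 z2 z3 z4) => //.
- apply: contra_neq z12 => z23; move: E3'; rewrite z23 subrr mul0r => /eqP.
  by rewrite mulf_eq0 (negPf B2) orbF subr_eq0 => /eqP.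
- apply: contra_neq z12 => z14; move: E4'; rewrite z14 subrr mul0r => /esym/eqP.
  by rewrite !mulf_eq0 (negPf B1) orbF pnatr_eq0 /= subr_eq0 => /eqP ->.
apply: (mulIf B1); apply: (mulIf B2).
transitivity ((z2 - z3) * B f1 * ((z1 - z4) * B f2)); first by ring.
by rewrite -E3' E4'; ring.
Qed.
End Core.

Lemma fiber_involution (I : finType) (E : eqType) (sg : I -> bool) (f : I -> E) :
    (forall c, #|[pred i | sg i && (f i == c)]| = #|[pred i | ~~ sg i && (f i == c)]|)
      ->
  exists s : I -> I, [/\ involutive s, forall i, sg (s i) != sg i & forall i,
    f (s i) = f i].
Proof.
move=> card_eq.
pose M b c := enum [pred i | (sg i == b) && (f i == c)].
have sM b c : size (M b c) = size (M (~~ b) c).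
  have eT : #|[pred i | (sg i == true) && (f i == c)]| = #|[pred i | (sg i == false) &&
    (f i == c)]|.
    rewrite (eq_card (B := [pred i | sg i && (f i == c)])); last by move=> i;
      rewrite !inE eqb_id.
    by rewrite card_eq; apply: eq_card => i; rewrite !inE eqbF_neg.
  by rewrite /M -!cardE; case: b => /=; rewrite eT.
have iM i : i \in M (sg i) (f i) by rewrite mem_enum inE !eqxx.
have lt i : (index i (M (sg i) (f i)) < size (M (~~ sg i) (f i)))%N.
  by rewrite -sM index_mem.
pose s i := nth i (M (~~ sg i) (f i)) (index i (M (sg i) (f i))).
have sP i : (sg (s i) == ~~ sg i) && (f (s i) == f i).
  by have := mem_nth i (lt i); rewrite mem_enum inE.
exists s; split=> i.
- have /andP[/eqP h1 /eqP h2] := sP i.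
  rewrite {1}/s h1 h2 negbK {2}/s index_uniq ?lt ?enum_uniq //.
  by rewrite (set_nth_default i) ?nth_index // index_mem.
- by case/andP: (sP i) => /eqP-> _; case: (sg i).
- by case/andP: (sP i) => _ /eqP.
Qed.

Section Planar.
Variables (R : realType) (I : finType) (i0 : I) (sg : I -> bool) (p : I -> R * R).

Hypothesis no_mixing : forall b (la : I -> R) j, (forall i, 0 <= la i) ->
  \sum_(i | sg i == b) la i = 1 -> sg j != b ->
  p j <> (\sum_(i | sg i == b) la i * (p i).1, \sum_(i | sg i == b) la i * (p i).2).

Definition balanced (f : I -> R) := forall c,
  #|[pred i | sg i && (f i == c)]| = #|[pred i | ~~ sg i && (f i == c)]|.

(** The two classes have the same number of points and the same sums of
    coordinates, hence the same centre of mass. It lies in both convex hulls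
    and is taken as the origin. *)
Theorem no_balanced_configuration :
  balanced (fun i => (p i).2) -> balanced (fun i => (p i).1) ->
  balanced (fun i => (p i).2 - (p i).1) -> balanced (fun i => (p i).2 - 8 * (p i).1) ->
  False.
Proof.
move=> /fiber_involution[s1 [K1 S1 U1]] /fiber_involution[s2 [K2 S2 U2]].
move=> /fiber_involution[s3 [K3 S3 U3]] /fiber_involution[s4 [K4 S4 U4]].
have swap s f b : involutive s -> (forall i, sg (s i) != sg i) ->
  (forall i, f (s i) = f i) ->
    \sum_(i | sg i == b) f i = \sum_(i | sg i == ~~ b) f i :> R.
  move=> sK sS fs; rewrite (reindex_inj (inv_inj sK)) /=; apply: eq_big => i;
    last by rewrite fs.
  by move: (sS i); case: (sg _); case: (sg _); case: b.
pose N b : R := \sum_(i | sg i == b) 1.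
have NC b : N (~~ b) = N b by rewrite /N (swap s1 (fun=> 1)) ?negbK.
have N0 b : 0 < N b.
  have Ni : 0 < N (sg i0).
    rewrite /N (bigD1 i0) ?eqxx //= ltr_pwDl // sumr_ge0 //.
  by have [<-//|] := eqVneq (sg i0) b; move: Ni; rewrite -NC; case: (sg i0); case: b.
pose o1 := (\sum_(i | sg i == true) (p i).1) / N true.
pose o2 := (\sum_(i | sg i == true) (p i).2) / N true.
have o1E b : \sum_(i | sg i == b) (p i).1 = o1 * N b.
  rewrite /o1; have N1 := lt0r_neq0 (N0 true); case: b; first by rewrite divfK.
  by rewrite -(NC false) /= divfK // (swap s2).
have o2E b : \sum_(i | sg i == b) (p i).2 = o2 * N b.
  rewrite /o2; have N1 := lt0r_neq0 (N0 true); case: b; first by rewrite divfK.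
  by rewrite -(NC false) /= divfK // (swap s1).
have cst b (c : R) : \sum_(i | sg i == b) c = c * N b.
  by rewrite mulr_sumr; apply: eq_bigr => i _; rewrite mulr1.
pose q i := ((p i).1 - o1, (p i).2 - o2).
have sep : separated sg q.
  move=> a b j be ga ab ja be0 ga0 bg [e1 e2].
  pose la i := be * (i == a)%:R + ga * (i == b)%:R + (1 - be - ga) / N (sg a).
  have split_sum (f : I -> R) : \sum_(i | sg i == sg a) la i * f i =
      be * f a + ga * f b + (1 - be - ga) / N (sg a) * \sum_(i | sg i == sg a) f i.
    rewrite /la; under eq_bigr => i _ do rewrite mulrDl mulrDl -!mulrA.
    rewrite !big_split /= -!mulr_sumr mulrA; congr (_ * _ + _ * _ + _).
      rewrite (bigD1 a) //= eqxx mul1r big1 ?addr0 // => i /andP[_ /negPf->].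
      by rewrite mul0r.
    rewrite (bigD1 b) ?ab ?eqxx //= mul1r big1 ?addr0 // => i /andP[_ /negPf->].
    by rewrite mul0r.
  have Na := lt0r_neq0 (N0 (sg a)).
  apply: (@no_mixing (sg a) la j) => //.
  - move=> i; rewrite /la !addr_ge0 ?mulr_ge0 ?ler0n //; first lra.
    by rewrite invr_ge0 ltW.
  - have := split_sum (fun=> 1); rewrite (eq_bigr la); last by move=> i _;
      rewrite mulr1.
    by move=> ->; rewrite !mulr1 -/(N (sg a)) divfK //; ring.
  - rewrite (split_sum (fun i => (p i).1)) (split_sum (fun i => (p i).2)) o1E o2E.
    rewrite (surjective_pairing (p j)); congr pair.
      by rewrite [_ * (o1 * _)]mulrCA divfK //; move: e1 => /=; lra.
    by rewrite [_ * (o2 * _)]mulrCA divfK //; move: e2 => /=; lra.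
apply: (@no_centered_configuration R I i0 sg q s1 s2 s3 s4 sep K1 K2 K3 K4 S1 S2 S3 S4).
- by move=> i; rewrite /q /= U1.
- by move=> i; rewrite /q /= U2.
- by move=> i; rewrite /q /=; have := U3 i; lra.
- by move=> i; rewrite /q /=; have := U4 i; lra.
- by move=> b; rewrite /q /= sumrB o1E cst subrr.
- by move=> b; rewrite /q /= sumrB o2E cst subrr.
Qed.
End Planar.

Local Open Scope classical_set_scope.
Local Open Scope card_scope.
Local Open Scope ring_scope.

(** * Convex sets, lines and slices in space *)

Section Convex.
Variables (R : realType).
Implicit Types (A B : set 'rV[R]_3).

Lemma convex_setP A : @convex_set R 'rV[R]_3 A <->
  (forall x y t, 0 <= t -> t <= 1 -> A x -> A y -> A (t *: x + (1 - t) *: y)).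
Proof.
split=> [cA x y t t0 t1 Ax Ay|cA x y l].
  by have := cA x y (Itv01 t0 t1) (mem_set Ax) (mem_set Ay) => /set_mem.
by move=> /set_mem Ax /set_mem Ay; apply/mem_set; apply: cA.
Qed.

Lemma conv_hull_convex A : @convex_set R 'rV[R]_3 (conv_hull A).
Proof.
apply/convex_setP => x y t t0 t1 hx hy B [/= cB AB].
by move/convex_setP: (cB); apply => //; [apply: hx|apply: hy].
Qed.

Lemma conv_hull_min A B : @convex_set R 'rV[R]_3 B -> A `<=` B -> conv_hull A `<=` B.
Proof. exact: smallest_sub. Qed.

Lemma sub_conv_hull A : A `<=` conv_hull A.
Proof. exact: sub_gen_smallest. Qed.

Lemma convex_sum A (I : finType) (P : pred I) (la : I -> R) (x : I -> 'rV[R]_3) :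
    @convex_set R 'rV[R]_3 A -> (forall i, 0 <= la i) -> \sum_(i | P i) la i = 1 ->
    (forall i, P i -> A (x i)) ->
  A (\sum_(i | P i) la i *: x i).
Proof.
move=> /convex_setP cA la0 la1 xA.
suff : forall r, let S := \sum_(i <- r | P i) la i in
    let V := \sum_(i <- r | P i) la i *: x i in
    (S = 0 /\ V = 0) \/ (0 < S /\ A (S^-1 *: V)).
  move=> /(_ (index_enum I)) /=; rewrite la1 invr1 scale1r.
  by case=> -[] // /eqP; rewrite oner_eq0.
elim=> [|i r IH] /=; first by left; rewrite !big_nil.
rewrite !big_cons; case: ifP => // Pi.
set S := \sum_(_ <- _ | _) _ in IH *; set V := \sum_(_ <- _ | _) _ *: _ in IH *.
have := la0 i; rewrite le_eqVlt => /predU1P[<-|l0].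
  by rewrite add0r scale0r add0r.
right; case: IH => -[S0 VA].
  rewrite S0 VA !addr0; split=> //; rewrite scalerA mulVf ?scale1r ?gt_eqF //.
  exact: xA.
have SS : 0 < la i + S by apply: addr_gt0.
split=> //.
have -> : (la i + S)^-1 *: (la i *: x i + V) =
    (la i / (la i + S)) *: x i + (1 - la i / (la i + S)) *: (S^-1 *: V).
  rewrite scalerDr !scalerA [_^-1 * _]mulrC; congr (_ + _ *: _).
  by field; rewrite !gt_eqF.
apply: cA => //; last exact: xA.
  by rewrite divr_ge0 // ltW.
by rewrite ler_pdivrMr // mul1r lerDl ltW.
Qed.

End Convex.

Section Coordinates.
Variable R : realType.
Implicit Types (x y z u : 'rV[R]_3).

Definition coord1 : 'I_3 := lift ord0 ord0.
Definition coord2 : 'I_3 := lift ord0 (lift ord0 ord0).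

Lemma row3P x y : x ord0 ord0 = y ord0 ord0 -> x ord0 coord1 = y ord0 coord1 ->
  x ord0 coord2 = y ord0 coord2 -> x = y.
Proof.
move=> h0 h1 h2; apply/rowP => i.
have [->|->|->] : [\/ i = ord0, i = coord1 | i = coord2] => //.
case: i => -[|[|[|//]]] hi; [apply: Or31|apply: Or32|apply: Or33]; exact: val_inj.
Qed.

Lemma dot3 x y : dot x y =
  x ord0 ord0 * y ord0 ord0 + x ord0 coord1 * y ord0 coord1 + x ord0 coord2 * y ord0
    coord2.
Proof. by rewrite /dot !big_ord_recl big_ord0 addr0 addrA. Qed.

Definition row3 (a b c : R) : 'rV[R]_3 := \row_(i < 3) nth 0 [:: a; b; c] i.

Lemma row3E a b c : (row3 a b c ord0 ord0 = a) * (row3 a b c ord0 coord1 = b) *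
  (row3 a b c ord0 coord2 = c).
Proof. by rewrite !mxE. Qed.

(** Coordinates in the basis (0, 1, 0), (-1, 0, tau) of the plane orthogonal to
    (tau, 0, 1). *)
Definition plane_vec (a b : R) : 'rV[R]_3 := row3 (- b) a (tau R * b).

(** The level sets are the planes orthogonal to (tau, 0, 1). *)
Definition height x : R := tau R * x ord0 ord0 + x ord0 coord2.

Lemma plane_tau01E x : plane_tau01 x <-> height x = 0.
Proof.
rewrite /plane_tau01 /= -/(row3 (tau R) 0 1) dot3 !row3E /height.
by rewrite mulr0 mulr1 addr0 mulrC.
Qed.

(** Together with height these are coordinates on space; they invert plane_vec.
    *)
Definition planar x : R * R := (x ord0 coord1, - x ord0 ord0).

Lemma mem_line y z c al be : c != 0 -> (al, be) != 0 -> height y = height z ->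
  [set y + s *: (c *: plane_vec al be) | s in [set: R]] z <->
  al * (planar z).2 - be * (planar z).1 = al * (planar y).2 - be * (planar y).1.
Proof.
move=> c0 ab h; split=> [[s _ <-]|e].
  by rewrite /planar /= !mxE /= -/coord1; ring.
have ab0 : 0 < al ^+ 2 + be ^+ 2.
  move: ab; rewrite xpair_eqE negb_and => /orP[h'|h'].
    by rewrite ltr_pwDl ?sqr_ge0 // exprn_even_gt0.
  by rewrite ltr_wpDl ?sqr_ge0 // exprn_even_gt0.
have abn : al ^+ 2 + be ^+ 2 != 0 by rewrite gt_eqF.
pose d0 := z ord0 ord0 - y ord0 ord0; pose d1 := z ord0 coord1 - y ord0 coord1.
have de : al * d0 = - (be * d1) by move: e; rewrite /d0 /d1 /planar /=; lra.
pose s := (al * d1 - be * d0) / (c * (al ^+ 2 + be ^+ 2)).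
have sc : s * c = (al * d1 - be * d0) / (al ^+ 2 + be ^+ 2).
  by rewrite /s; field; rewrite c0 abn.
have s1 : s * c * al = d1.
  rewrite sc; transitivity ((al * (al * d1) - be * (- (be * d1))) / (al ^+ 2 + be ^+
    2)).
    by rewrite -de; field.
  by field.
have s0 : s * c * be = - d0.
  rewrite sc; transitivity ((- (al * (al * d0)) - be * (be * d0)) / (al ^+ 2 + be ^+
    2)).
    by rewrite de; field.
  by field.
have h' : z ord0 coord2 - y ord0 coord2 = - tau R * d0 by move: h; rewrite /height /d0;
  lra.
exists s => //; apply: row3P; rewrite !mxE /= -?/coord1 -?/coord2.
- have -> : s * (c * - be) = - (s * c * be) by ring.
  by rewrite s0 /d0; ring.
- by rewrite mulrA s1 /d1; ring.
- have -> : s * (c * (tau R * be)) = tau R * (s * c * be) by ring.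
  by rewrite s0; move: h'; lra.
Qed.

Lemma height_line y s c al be :
  height (y + s *: (c *: plane_vec al be)) = height y.
Proof. by rewrite /height !mxE /= -/coord2; ring. Qed.

End Coordinates.

Lemma card_fset_pred (K : choiceType) (X : {fset K}) (P : pred K) :
  #|[pred i : X | P (val i)]| = #|` [fset z in X | P z]%fset|.
Proof.
have -> : [fset z in X | P z]%fset = [fset val i | i in [pred i : X | P (val i)]]%fset.
  apply/fsetP => z; rewrite !inE; apply/andP/imfsetP => /= [[zX Pz]|[ j]].
    by exists [` zX]%fset.
  by move=> Pj ->; rewrite (valP j).
by rewrite card_imfset /= -?cardE //; exact: val_inj.
Qed.

Section Slice.
Variables (R : realType) (F F' : set 'rV[R]_3) (h : R).
Hypotheses (fF : finite_set F) (fF' : finite_set F').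

Definition slice_diff : set 'rV[R]_3 :=
  [set x | height x = h /\ ((F x /\ ~ F' x) \/ (F' x /\ ~ F x))].

Lemma finite_slice_diff : finite_set slice_diff.
Proof.
apply: (@sub_finite_set _ _ (F `|` F')); last by rewrite finite_setU.
by move=> x [_ [[]|[]]]; [left|right].
Qed.

(** Splitting off the common points of G and G' relates the X-ray of G to the
    number of its points on l that are not in G'. *)
Lemma card_line_diff (G G' : set 'rV[R]_3) (fG : finite_set G) (fG' : finite_set G')
    (l : set 'rV[R]_3) (X : {fset 'rV[R]_3}) (P : pred 'rV[R]_3) :
    (forall z, z \in X -> P z <-> (G z /\ ~ G' z /\ l z)) ->
    (forall z, G z -> ~ G' z -> l z -> z \in X) ->
  #|` fset_set (G `&` l)| =
  (#|` fset_set (G `&` G' `&` l)| + #|[pred i : X | P (val i)]|)%N.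
Proof.
move=> XP GX; rewrite card_fset_pred.
have f1 : finite_set (G `&` l) by apply: finite_setIl.
have f2 : finite_set (G `&` G' `&` l) by do 2!apply: finite_setIl.
have eI : (fset_set (G `&` l) `&` fset_set G')%fset = fset_set (G `&` G' `&` l).
  by rewrite -fset_setI // setIAC.
have eD : (fset_set (G `&` l) `\` fset_set G')%fset = [fset z in X | P z]%fset.
  apply/fsetP => z; rewrite !inE !in_fset_set //; apply/andP/andP.
    move=> [zG' zGl]; have [zG zl] := set_mem zGl.
    have nG' : ~ G' z by move=> /mem_set; apply/negP.
    by have zX := GX z zG nG' zl; split=> //; apply/XP.
  move=> [zX Pz]; have [zG [zG' zl]] := (XP z zX).1 Pz.
  by split; [apply/negP => /set_mem | apply: mem_set].
by rewrite -(cardfsID (fset_set G') (fset_set (G `&` l))) eI eD.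
Qed.
End Slice.

(** * Four directions that determine convex sets *)

Section PartA.
Variable R : realType.
Implicit Types (Lam F G : set 'rV[R]_3).

(** In a slice of constant height, plane coordinates decide equality in space.
    *)
Lemma convex_subset_combination Lam G (I : finType) (P : pred I) (la : I -> R)
    (x : I -> 'rV[R]_3) (y : 'rV[R]_3) (h : R) :
    convex_subsets Lam G -> (forall i, 0 <= la i) -> \sum_(i | P i) la i = 1 ->
    (forall i, P i -> G (x i)) -> (forall i, P i -> height (x i) = h) ->
    height y = h -> Lam y ->
    planar y = (\sum_(i | P i) la i * (planar (x i)).1,
      \sum_(i | P i) la i * (planar (x i)).2) ->
  G y.
Proof.
move=> [fG GL GE] la0 la1 xG xh yh yL [e1 e2]; rewrite GE; split=> //.
suff -> : y = \sum_(i | P i) la i *: x i.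
  by apply: convex_sum => //; [exact: conv_hull_convex | move=> i /xG;
    exact: sub_conv_hull].
have sE k : (\sum_(i | P i) la i *: x i) ord0 k = \sum_(i | P i) la i * x i ord0 k.
  by rewrite summxE; apply: eq_bigr => i _; rewrite mxE.
have c0 : y ord0 ord0 = \sum_(i | P i) la i * x i ord0 ord0.
  apply: oppr_inj; rewrite e2 /= -sumrN; apply: eq_bigr => i _; ring.
apply: row3P; rewrite sE //.
have h2 (z : 'rV[R]_3) : z ord0 coord2 = height z - tau R * z ord0 ord0 by rewrite
  /height; ring.
rewrite h2 yh c0 [RHS](eq_bigr (fun i => la i * h - tau R * (la i * x i ord0 ord0))).
  by rewrite sumrB -mulr_suml la1 mul1r mulr_sumr.
by move=> i Pi; rewrite h2 xh //; ring.
Qed.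

Section TwoSets.
Variables (F F' : set 'rV[R]_3) (h : R).
Hypotheses (fF : finite_set F) (fF' : finite_set F').
Let X := fset_set (slice_diff F F' h).

Let inX z : z \in X <-> slice_diff F F' h z.
Proof.
have fS : finite_set (slice_diff F F' h) by exact: finite_slice_diff.
by rewrite /X in_fset_set //; split=> [/set_mem|/mem_set].
Qed.

(** A line of the given direction through a point of the slice stays in the
    slice, and on it the X-rays of F and F' count, apart from their common
    points, the two classes. *)
Lemma balanced_slice c al be : c != 0 -> (al, be) != 0 ->
    @Xray R (c *: plane_vec al be) F = @Xray R (c *: plane_vec al be) F' ->
  @balanced R X (fun i => `[< F (val i) >])
    (fun i => al * (planar (val i)).2 - be * (planar (val i)).1).
Proof.
move=> c0 ab xE d; set f := fun z : 'rV[R]_3 => al * (planar z).2 - be * (planar z).1.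
have [i1 /eqP fi1|none] := pickP (fun i : X => f (val i) == d); last first.
  by rewrite !eq_card0 // => i; rewrite !inE; have := none i; rewrite /f => ->;
    rewrite andbF.
pose y := val i1; pose u := c *: plane_vec al be.
have [yh _] := (inX y).1 (valP i1).
pose l := [set y + s *: u | s in [set: R]].
have lu : parallel_line u l by exists y.
have lP z : height z = h -> l z <-> f z = d.
  by move=> zh; rewrite -fi1; apply: mem_line => //; rewrite yh zh.
have lh z : l z -> height z = h by move=> [s _ <-]; rewrite height_line.
have := congr1 (fun g => g (exist _ l (mem_set lu))) xE; rewrite /Xray /= => cE.
pose P z := `[< F z >] && (f z == d); pose P' z := ~~ `[< F z >] && (f z == d).
have PX z : z \in X -> P z <-> F z /\ ~ F' z /\ l z.
  move=> /inX[zh zD]; split=> [/andP[/asboolP zF /eqP fz]|[zF [_ zl]]].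
    by case: zD => -[] // _ nF'; split=> //; split=> //; apply/lP.
  by apply/andP; split; [apply/asboolP | apply/eqP/lP].
have P'X z : z \in X -> P' z <-> F' z /\ ~ F z /\ l z.
  move=> /inX[zh zD]; split=> [/andP[/asboolPn zF /eqP fz]|[zF' [nF zl]]].
    by case: zD => -[] // zF'; split=> //; split=> //; apply/lP.
  by apply/andP; split; [apply/asboolPn | apply/eqP/lP].
have XF z : F z -> ~ F' z -> l z -> z \in X.
  by move=> zF nF' zl; apply/inX; split; [exact: lh | left].
have XF' z : F' z -> ~ F z -> l z -> z \in X.
  by move=> zF' nF zl; apply/inX; split; [exact: lh | right].
have e1 := card_line_diff fF fF' PX XF; have e2 := card_line_diff fF' fF P'X XF'.
rewrite e1 [in RHS]e2 [F' `&` F]setIC in cE.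
exact: (addnI cE).
Qed.

End TwoSets.

(** The points of a slice that belong to exactly one of the two sets form two
    classes, and by convexity neither class meets the hull of the other. *)
Lemma no_difference Lam F F' h c1 c2 c3 c4 :
    convex_subsets Lam F -> convex_subsets Lam F' ->
    [/\ c1 != 0, c2 != 0, c3 != 0 & c4 != 0] ->
    @Xray R (c1 *: plane_vec 1 0) F = @Xray R (c1 *: plane_vec 1 0) F' ->
    @Xray R (c2 *: plane_vec 0 1) F = @Xray R (c2 *: plane_vec 0 1) F' ->
    @Xray R (c3 *: plane_vec 1 1) F = @Xray R (c3 *: plane_vec 1 1) F' ->
    @Xray R (c4 *: plane_vec 1 8) F = @Xray R (c4 *: plane_vec 1 8) F' ->
  slice_diff F F' h = set0.
Proof.
move=> cF cF' [n1 n2 n3 n4] x1 x2 x3 x4; have [fF FL FE] := cF;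
  have [fF' FL' FE'] := cF'.
have fS := finite_slice_diff h fF fF'.
rewrite -subset0 => z0 /mem_set; rewrite -in_fset_set // => z0X.
set X := fset_set _ in z0X.
have inX (i : X) : slice_diff F F' h (val i).
  by have := valP i; rewrite /X in_fset_set // => /set_mem.
have nz (a b : R) : a != 0 -> (a, b) != 0 by move=> a0; apply/eqP => -[/eqP];
  rewrite (negPf a0).
have nz' : ((0 : R), (1 : R)) != 0 by apply/eqP => -[/eqP]; rewrite oner_eq0.
have b1 := balanced_slice h fF fF' n1 (nz _ _ (oner_neq0 _)) x1.
have b2 := balanced_slice h fF fF' n2 nz' x2.
have b3 := balanced_slice h fF fF' n3 (nz _ _ (oner_neq0 _)) x3.
have b4 := balanced_slice h fF fF' n4 (nz _ _ (oner_neq0 _)) x4.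
have bal (I : finType) (sg : I -> bool) (f g : I -> R) (r : R -> R) :
    (forall i c, (f i == r c) = (g i == c)) -> balanced sg f -> balanced sg g.
  move=> fg bf c; have E (q : pred I) :
      #|[pred i | q i && (f i == r c)]| = #|[pred i | q i && (g i == c)]|.
    by apply: eq_card => i; rewrite !inE fg.
  by have := bf (r c); rewrite (E sg) (E (fun i => ~~ sg i)).
apply: (@no_balanced_configuration R X [` z0X]%fset (fun i =>
  `[< F (val i) >]) (fun i => planar (val i))).
- move=> b la j la0 la1 jb e.
  have [jh jD] := inX j.
  case: b la1 jb e => la1 jb e.
    have jF : ~ F (val j) by move=> /asboolP; rewrite (eqb_id) in jb; apply/negP.
    apply: jF; apply: (convex_subset_combination cF la0 la1 _ _ jh _ e).
    + by move=> i; rewrite eqb_id => /asboolP.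
    + by move=> i _; have [] := inX i.
    + by case: jD => -[]; [move=> /FL | move=> /FL'].
  have jF : ~ F' (val j).
    by case: jD => -[] //; move: jb; rewrite eqbF_neg negbK => /asboolP.
  apply: jF; apply: (convex_subset_combination cF' la0 la1 _ _ jh _ e).
  + move=> i; rewrite eqbF_neg => /asboolPn nF.
    by have [_ [[]|[]]] := inX i.
  + by move=> i _; have [] := inX i.
  + by case: jD => -[]; [move=> /FL | move=> /FL'].
- by apply: (bal _ _ _ _ id _ b1) => i c; rewrite mul1r mul0r subr0.
- by apply: (bal _ _ _ _ -%R _ b2) => i c; rewrite mul1r mul0r sub0r eqr_opp.
- by apply: (bal _ _ _ _ id _ b3) => i c; rewrite !mul1r.
- by apply: (bal _ _ _ _ id _ b4) => i c; rewrite mul1r.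
Qed.
End PartA.

Section PartA2.
Variable R : realType.

Definition unit_scale (v : 'rV[R]_3) : R := (Num.sqrt (dot v v))^-1.

Lemma dot_gt0 (v : 'rV[R]_3) : v != 0 -> 0 < dot v v.
Proof.
move=> v0; have d0 : 0 <= dot v v by apply: sumr_ge0 => i _; rewrite -expr2 sqr_ge0.
rewrite lt_neqAle d0 andbT eq_sym; apply: contra v0; rewrite /dot psumr_eq0.
  move=> /allP h; apply/eqP/rowP => i; have := h i (mem_index_enum _).
  by rewrite /= -expr2 sqrf_eq0 mxE => /eqP.
by move=> i _; rewrite -expr2 sqr_ge0.
Qed.

Lemma unit_scale_neq0 v : v != 0 -> unit_scale v != 0.
Proof. by move=> v0; rewrite invr_eq0 sqrtr_eq0 -ltNge dot_gt0. Qed.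

Lemma tau01_direction_plane (L : set 'rV[R]_3) (a b : R) :
    L (plane_vec a b) -> plane_vec a b != 0 ->
  tau01_direction L (unit_scale (plane_vec a b) *: plane_vec a b).
Proof.
move=> Lv v0; set v := plane_vec a b in Lv v0 *; have c0 := unit_scale_neq0 v0.
split.
- rewrite /direction /=.
  have -> : dot (unit_scale v *: v) (unit_scale v *: v) = unit_scale v ^+ 2 * dot v v.
    by rewrite !dot3 !mxE; ring.
  by rewrite /unit_scale exprVn sqr_sqrtr ?ltW ?dot_gt0 // mulVf // gt_eqF ?dot_gt0.
- by apply/plane_tau01E; rewrite /height !mxE /=; ring.
- exists v; split=> //; exists (unit_scale v)^-1; first by rewrite invr_eq0.
  by rewrite scalerA mulVf // scale1r.
Qed.

Lemma plane_vec_eq0 (a b : R) : (plane_vec a b == 0) = ((a, b) == 0).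
Proof.
apply/eqP/eqP => [e|[-> ->]]; last by apply: row3P; rewrite !mxE /= ?oppr0 ?mulr0.
have := congr1 (fun m : 'rV[R]_3 => m ord0 ord0) e.
have := congr1 (fun m : 'rV[R]_3 => m ord0 coord1) e.
by rewrite !mxE /= => -> /eqP; rewrite oppr_eq0 => /eqP ->.
Qed.

(** Four slopes whose cross-ratio is 8, a value not taken by four roots of
    unity. *)
Definition four_coords (k : nat) : R * R :=
  nth 0 [:: (1, 0); (0, 1); (1, 1); (1, 8)] k.
Definition four_vec k := plane_vec (four_coords k).1 (four_coords k).2.
Definition four_dir k := unit_scale (four_vec k) *: four_vec k.

Lemma four_vec_neq0 k : (k < 4)%N -> four_vec k != 0.
Proof.
move=> k4; rewrite plane_vec_eq0 -surjective_pairing.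
have o := oner_eq0 R.
by case: k k4 => [|[|[|[|//]]]] _; rewrite xpair_eqE ?o ?andbF.
Qed.

Lemma four_dir_inj : {in `I_4 &, injective four_dir}.
Proof.
move=> k l /set_mem /= k4 /set_mem /= l4 e.
have ck := unit_scale_neq0 (four_vec_neq0 k4).
have cl := unit_scale_neq0 (four_vec_neq0 l4).
have := congr1 (fun m : 'rV[R]_3 => m ord0 ord0) e.
have := congr1 (fun m : 'rV[R]_3 => m ord0 coord1) e.
rewrite !mxE /=; move: ck cl.
move: (unit_scale (four_vec k)) (unit_scale (four_vec l)) => c d c0 d0 e1 e2.
have : (four_coords k).1 * (four_coords l).2 = (four_coords k).2 * (four_coords l).1.
  apply: (mulfI (mulf_neq0 c0 d0)).
  transitivity ((c * (four_coords k).1) * (d * (four_coords l).2)); first by ring.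
  have -> : d * (four_coords l).2 = c * (four_coords k).2 by lra.
  by rewrite e1; ring.
move: k4 l4; clear.
by case: k => [|[|[|[|//]]]] _; case: l => [|[|[|[|//]]]] _ //= *; exfalso; lra.
Qed.

Theorem determined_by_four (L : set 'rV[R]_3) :
    (forall k, (k < 4)%N -> L (four_vec k)) ->
  exists U : set 'rV[R]_3,
    [/\ U #= `I_4, U `<=` tau01_direction L
      & forall Lambda : set 'rV[R]_3, determined_by (convex_subsets Lambda) U].
Proof.
move=> hL; exists (four_dir @` `I_4); split.
- exact/inj_card_eq/four_dir_inj.
- move=> _ [k /= k4 <-]; apply: tau01_direction_plane; first exact: hL.
  exact: four_vec_neq0.
move=> Lam F F' cF cF' xE.
have xk k : (k < 4)%N -> @Xray R (four_dir k) F = @Xray R (four_dir k) F'.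
  by move=> k4; apply: xE; exists k.
have nk k k4 := unit_scale_neq0 (@four_vec_neq0 k k4).
have nodiff x : ~ slice_diff F F' (height x) x.
  rewrite (no_difference _ cF cF' _ (xk 0 isT) (xk 1 isT) (xk 2 isT) (xk 3 isT)) //.
  by split; apply: nk.
apply/seteqP; split=> x Fx; apply: contrapT => nx; apply: (nodiff x); split=> //;
  [left|right] => //.
Qed.
End PartA2.

(** * A hexagon not determined by three directions *)

(** The points ctr + v k and ctr - v k are the vertices of an affinely regular
    hexagon: by vsum the sum of two of the v k is the opposite of the third
    one, and g k is maximal at v k, and only there, among the six vectors. *)
Section Hexagon.
Variables (R : realType) (Lam : set 'rV[R]_3) (ctr : 'rV[R]_3).
Variables (v : 'I_3 -> 'rV[R]_3) (g : 'I_3 -> {scalar 'rV[R]_3}).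
Hypothesis gv : forall k l, g k (v l) = if k == l then 2 else -1.
Hypothesis vsum : forall k l, k != l -> exists m, v l + v k = - v m.

Definition hex_pos : set 'rV[R]_3 := [set ctr + v k | k in [set: 'I_3]].
Definition hex_neg : set 'rV[R]_3 := [set ctr - v k | k in [set: 'I_3]].
Definition hexagon := conv_hull (hex_pos `|` hex_neg).

Hypothesis pos_Lam : hex_pos `<=` Lam.
Hypothesis neg_Lam : hex_neg `<=` Lam.
Hypothesis fin_hex : finite_set (Lam `&` hexagon).

(** Used to show that a vertex is the only point of the hexagon on a supporting
    plane. *)
Lemma convex_halfspace_point (f : 'rV[R]_3 -> R) (c : R) (e : 'rV[R]_3) :
    (forall x y s t, f (s *: x + t *: y) = s * f x + t * f y) -> f e = c ->
  @convex_set R 'rV[R]_3 [set y | f y < c \/ y = e].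
Proof.
move=> fL fe; apply/convex_setP => x y t t0 t1 hx hy.
have [->|tn0] := eqVneq t 0; first by rewrite scale0r add0r subr0 scale1r.
have [->|tn1] := eqVneq t 1; first by rewrite subrr scale0r addr0 scale1r.
have t0' : 0 < t by rewrite lt_neqAle eq_sym tn0.
have t1' : 0 < 1 - t by rewrite subr_gt0 lt_neqAle tn1.
have hle z : f z < c \/ z = e -> f z <= c by case=> [/ltW//|->]; rewrite fe.
case: (hx) => [fx|ex].
  left; rewrite fL; have fy := hle _ hy.
  have -> : c = t * c + (1 - t) * c by ring.
  by rewrite ltr_leD // ?ltr_pM2l // ler_pM2l.
case: (hy) => [fy|ey].
  left; rewrite fL; have fx := hle _ hx.
  have -> : c = t * c + (1 - t) * c by ring.
  by rewrite ler_ltD // ?ltr_pM2l // ler_pM2l.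
by right; rewrite ex ey -scalerDl addrC subrK scale1r.
Qed.

Lemma convex_halfspace (f : 'rV[R]_3 -> R) (c : R) :
    (forall x y s t, f (s *: x + t *: y) = s * f x + t * f y) ->
  @convex_set R 'rV[R]_3 [set y | f y < c].
Proof.
move=> fL; apply/convex_setP => x y t t0 t1 /= fx fy; rewrite fL.
have -> : c = t * c + (1 - t) * c by ring.
have [t0'|t0'] := ltrP 0 t.
  rewrite ltr_leD // ?ltr_pM2l // ler_wpM2l ?subr_ge0 //; exact: ltW.
have -> : t = 0 by apply: le_anti; rewrite t0 t0'.
by rewrite !mul0r !add0r subr0 !mul1r.
Qed.

Lemma hexagon_convex : @convex_set R 'rV[R]_3 hexagon.
Proof. exact: conv_hull_convex. Qed.

Lemma g_lin k x y s t : g k (s *: x + t *: y) = s * g k x + t * g k y.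
Proof. by rewrite linearD !linearZ. Qed.

Lemma g_neg_lin k x y s t : - g k (s *: x + t *: y) = s * - g k x + t * - g k y.
Proof. by rewrite g_lin; ring. Qed.

Lemma neg_vertex k y : hexagon y -> y != ctr - v k -> - g k y < - g k ctr + 2.
Proof.
move=> hy yne; pose f z := - g k z.
have fe : f (ctr - v k) = - g k ctr + 2 by rewrite /f linearB /= gv eqxx opprB addrC.
have : [set y | f y < - g k ctr + 2 \/ y = ctr - v k] y.
  apply: (conv_hull_min (convex_halfspace_point (g_neg_lin k) fe) _ hy) =>
    z [[l _ <-]|[l _ <-]] /=.
    by left; rewrite /f linearD /= gv; case: ifP => _; lra.
  have [->|kl] := eqVneq k l; first by right.
  by left; rewrite /f linearB /= gv (negPf kl); lra.
by case=> // e; rewrite e eqxx in yne.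
Qed.

Lemma pos_vertex k y : hexagon y -> y != ctr + v k -> g k y < g k ctr + 2.
Proof.
move=> hy yne.
have fe : g k (ctr + v k) = g k ctr + 2 by rewrite linearD /= gv eqxx.
have : [set y | g k y < g k ctr + 2 \/ y = ctr + v k] y.
  apply: (conv_hull_min (convex_halfspace_point (g_lin k) fe) _ hy) =>
    z [[l _ <-]|[l _ <-]] /=.
    have [->|kl] := eqVneq k l; first by right.
    by left; rewrite linearD /= gv (negPf kl); lra.
  by left; rewrite linearB /= gv; case: ifP => _; lra.
by case=> // e; rewrite e eqxx in yne.
Qed.

Lemma pos_neq_neg k l : ctr + v k != ctr - v l.
Proof.
apply/eqP => /addrI e; have := gv k k; rewrite e linearN /= gv eqxx.
by case: eqVneq => _; lra.
Qed.

Definition hex_plus := (Lam `&` hexagon) `\` hex_neg.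
Definition hex_minus := (Lam `&` hexagon) `\` hex_pos.

Lemma pos_sub_plus : hex_pos `<=` hex_plus.
Proof.
move=> y py; split; first by split; [exact: pos_Lam | apply: sub_conv_hull; left].
by case: py => k _ <- [l _ /esym/eqP]; rewrite (negPf (pos_neq_neg k l)).
Qed.

Lemma hex_plus_convex : convex_subsets Lam hex_plus.
Proof.
split; first by apply: sub_finite_set fin_hex => y [].
  by move=> y [[]].
apply/seteqP; split=> y; first by move=> hy; split;
  [apply: sub_conv_hull | case: hy => -[]].
move=> [hy yL]; split.
  split=> //; apply: (conv_hull_min hexagon_convex _ hy) => z [[_ //]].
move=> [k _ e].
have : [set y | - g k y < - g k ctr + 2] y.
  apply: (conv_hull_min (convex_halfspace (g_neg_lin k)) _ hy) => z [[_ hz] nz].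
  by apply: neg_vertex => //; apply/eqP => ez; apply: nz; exists k.
by rewrite /= -e linearB /= gv eqxx; lra.
Qed.

Lemma hex_minus_convex : convex_subsets Lam hex_minus.
Proof.
split; first by apply: sub_finite_set fin_hex => y [].
  by move=> y [[]].
apply/seteqP; split=> y; first by move=> hy; split;
  [apply: sub_conv_hull | case: hy => -[]].
move=> [hy yL]; split.
  split=> //; apply: (conv_hull_min hexagon_convex _ hy) => z [[_ //]].
move=> [k _ e].
have : [set y | g k y < g k ctr + 2] y.
  apply: (conv_hull_min (convex_halfspace (g_lin k)) _ hy) => z [[_ hz] nz].
  by apply: pos_vertex => //; apply/eqP => ez; apply: nz; exists k.
by rewrite /= -e linearD /= gv eqxx; lra.
Qed.

Section Swap.
Variable k : 'I_3.

(** On the vertices this is the affine reflection in direction v k that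
    exchanges the two triples of alternate vertices. *)
Definition hex_swap y :=
  if `[< (hex_pos `|` hex_neg) y >] then y - g k (y - ctr) *: v k else y.

Lemma swap_pos l : exists m, hex_swap (ctr + v l) = ctr - v m.
Proof.
rewrite /hex_swap asboolT; last by left; exists l.
rewrite [ctr + v l - ctr]addrAC subrr add0r gv; case: eqVneq => [->|kl].
  by exists l; rewrite -addrA; congr (_ + _);
    rewrite scaler_nat mulr2n opprD addrA subrr add0r.
have [m e] := vsum kl; exists m; rewrite scaleN1r opprK -addrA e //.
Qed.

Lemma swap_neg l : exists m, hex_swap (ctr - v l) = ctr + v m.
Proof.
rewrite /hex_swap asboolT; last by right; exists l.
rewrite [ctr - v l - ctr]addrAC subrr add0r linearN /= gv; case: eqVneq => [->|kl].
  by exists l; rewrite scaleNr opprK -addrA; congr (_ + _);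
    rewrite scaler_nat mulr2n addKr.
have [m e] := vsum kl; exists m.
by rewrite opprK scale1r -addrA -opprD e opprK.
Qed.

Lemma swapK y : hex_swap (hex_swap y) = y.
Proof.
have [h|h] := pselect ((hex_pos `|` hex_neg) y); last by rewrite /hex_swap !asboolF.
have h' : (hex_pos `|` hex_neg) (hex_swap y).
  case: h => -[l _ <-]; [have [m ->] := swap_pos l; right|have [m ->] := swap_neg l;
    left];
  by exists m.
rewrite {1}/hex_swap asboolT // /hex_swap asboolT //.
have -> : y - g k (y - ctr) *: v k - ctr = (y - ctr) - g k (y - ctr) *:
  v k by rewrite addrAC.
set c := g k _; have -> : g k (y - ctr - c *: v k) = - c.
  by rewrite linearB linearZ /= gv eqxx -/c; ring.
rewrite -addrA -opprD -scalerDl.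
have -> : c + - c = 0 by ring.
by rewrite scale0r subr0.
Qed.

Lemma swap_plus_minus : hex_swap @` hex_plus `<=` hex_minus.
Proof.
move=> _ [y [yLH yn] <-]; have [h|h] := pselect ((hex_pos `|` hex_neg) y).
  case: h => // -[l _ <-]; have [m ->] := swap_pos l; split.
    by split; [apply: neg_Lam | apply: sub_conv_hull; right]; exists m.
  by move=> [j _ /eqP]; rewrite (negPf (pos_neq_neg j m)).
by rewrite /hex_swap asboolF //; split=> // yp; apply: h; left.
Qed.

Lemma swap_minus_plus : hex_swap @` hex_minus `<=` hex_plus.
Proof.
move=> _ [y [yLH yn] <-]; have [h|h] := pselect ((hex_pos `|` hex_neg) y).
  case: h => // -[l _ <-]; have [m ->] := swap_neg l.
  by apply: pos_sub_plus; exists m.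
by rewrite /hex_swap asboolF //; split=> // yp; apply: h; right.
Qed.

Lemma hex_Xray u c : v k = c *: u -> @Xray R u hex_plus = @Xray R u hex_minus.
Proof.
move=> vk; apply/funext => -[l lu]; rewrite /Xray /=.
have [q lE] := set_mem lu.
have swl y : l y -> l (hex_swap y).
  rewrite lE => -[s _ <-]; rewrite /hex_swap; case: ifP => _; last by exists s.
  exists (s - g k (q + s *: u - ctr) * c) => //.
  by rewrite vk scalerA scalerBl addrA.
have -> : hex_minus `&` l = hex_swap @` (hex_plus `&` l).
  apply/seteqP; split=> y.
    move=> [ym yl]; exists (hex_swap y); last exact: swapK.
    by split; [apply: swap_minus_plus; exists y | exact: swl].
  by move=> [z [zp zl] <-]; split; [apply: swap_plus_minus; exists z | exact: swl].
rewrite fset_set_image; last by apply: finite_setIl; case: hex_plus_convex.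
rewrite card_imfset //; exact: (can_inj swapK).
Qed.
End Swap.

Lemma hex_plus_neq_minus : hex_plus <> hex_minus.
Proof.
move=> e; have : hex_plus (ctr + v ord0) by apply: pos_sub_plus; exists ord0.
by rewrite e => -[_]; apply; exists ord0.
Qed.

Theorem hexagon_not_determined (U : set 'rV[R]_3) :
  (forall u, U u -> exists k c, v k = c *: u) -> ~ determined_by (convex_subsets Lam) U.
Proof.
move=> hU det; apply: hex_plus_neq_minus.
apply: det; [exact: hex_plus_convex | exact: hex_minus_convex |].
by move=> u /hU[k [c]]; exact: hex_Xray.
Qed.
End Hexagon.

(** * The ring Z[tau] and its conjugation *)

Section Golden.
Variable R : realType.
Local Notation tau := (tau R).
Local Notation tau' := (tau' R).

Lemma sqrt5_sq : Num.sqrt (5 : R) ^+ 2 = 5.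
Proof. by rewrite sqr_sqrtr // ler0n. Qed.

Lemma sqrt5_bounds : 2 < Num.sqrt (5 : R) < 3.
Proof.
have h0 : 0 <= Num.sqrt (5 : R) := sqrtr_ge0 _.
have h := sqrt5_sq; apply/andP; split; nra.
Qed.

Lemma tau_sq : tau ^+ 2 = tau + 1.
Proof. by rewrite /Defs.tau; have := sqrt5_sq; set s := Num.sqrt _ => h; field: h. Qed.

Lemma tau'_sq : tau' ^+ 2 = tau' + 1.
Proof. by rewrite /Defs.tau'; have := tau_sq; nra. Qed.

Lemma tau'_bounds : -1 < tau' < 0.
Proof. by rewrite /Defs.tau' /Defs.tau; have := sqrt5_bounds; lra. Qed.

(** The denominator divides the square of the numerator, so that q is an
    integer n with n (n - 1) = 1. *)
Lemma no_rat_golden (q : rat) : q ^+ 2 <> q + 1.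
Proof.
move=> qE; set n := numq q; set d := denq q.
have d0 : d%:~R != 0 :> rat by rewrite intr_eq0 denq_neq0.
have qn : q * d%:~R = n%:~R by rewrite -{1}(divq_num_den q) divfK.
have E : n ^+ 2 = d * (n + d).
  apply: (@intr_inj rat); rewrite rmorphXn rmorphM rmorphD /= -qn.
  by rewrite exprMn qE; ring.
have dn : (absz d %| absz n * absz n)%N.
  have : (d %| n ^+ 2)%Z by rewrite E dvdz_mulr.
  by rewrite dvdzE expr2 abszM.
have : coprime (absz d) (absz n) by rewrite coprime_sym coprime_num_den.
move=> cop; have d1 : (absz d %| 1)%N.
  by move: dn; rewrite Gauss_dvdr // -(muln1 (absz n)) Gauss_dvdr.
have dE : d = 1.
  by move: d1; rewrite dvdn1 => /eqP; have := denq_gt0 q; rewrite -/d; lia.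
move: E; rewrite dE mul1r => E.
have : n <= -1 \/ n = 0 \/ n = 1 \/ 2 <= n by lia.
case=> [h|[h|[h|h]]]; [nia|lia|lia|nia].
Qed.

Lemma ratr_tau_inj (a b c d : rat) :
  ratr a + ratr b * tau = ratr c + ratr d * tau -> a = c /\ b = d.
Proof.
move=> e; have [bd|bd] := eqVneq b d.
  split=> //; apply: (fmorph_inj (@ratr R)); rewrite -bd in e; exact: (addIr _ e).
exfalso; apply: (@no_rat_golden ((c - a) / (b - d))).
apply: (fmorph_inj (@ratr R)); rewrite rmorphXn rmorphD rmorph1 /=.
suff -> : ratr ((c - a) / (b - d)) = tau by exact: tau_sq.
have bd0 : ratr (b - d) != 0 :> R by rewrite fmorph_eq0 subr_eq0.
apply: (mulfI bd0); rewrite -rmorphM /= mulrC divfK ?subr_eq0 //.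
by rewrite !rmorphB /= mulrBl; lra.
Qed.

Lemma galoisE (a b : rat) : galois (ratr a + ratr b * tau) = ratr a + ratr b * tau'.
Proof.
rewrite /galois; set P := (X in xget _ X).
have /= Pab : P (xget (0, 0) P) by apply: (xgetPex _ (ex_intro _ (a, b) _)).
by have [<- <-] := ratr_tau_inj Pab.
Qed.

(** The graph of the conjugation of Z[tau], for which compatibility with sums
    and products needs no uniqueness of coordinates. *)
Definition conj_Ztau (x y : R) := exists a b : int,
  x = a%:~R + b%:~R * tau /\ y = a%:~R + b%:~R * tau'.

Lemma conj_Ztau_half x y : conj_Ztau x y -> galois (x / 2) = y / 2.
Proof.
move=> [a [b [-> ->]]].
have h (c : int) : c%:~R / 2 = ratr (c%:~R / 2) :> R by rewrite fmorph_div /= ratr_int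
  rmorph_nat.
have hh (t : R) : (a%:~R + b%:~R * t) / 2 = ratr (a%:~R / 2) + ratr (b%:~R / 2) * t.
  by rewrite -!h; ring.
by rewrite hh galoisE -hh.
Qed.

Lemma conj_Ztau_int (m : int) : conj_Ztau m%:~R m%:~R.
Proof. by exists m, 0; rewrite !mul0r !addr0. Qed.

Lemma conj_Ztau0 : conj_Ztau 0 0. Proof. exact: (conj_Ztau_int 0). Qed.
Lemma conj_Ztau1 : conj_Ztau 1 1. Proof. exact: (conj_Ztau_int 1). Qed.

Lemma conj_Ztau_tau : conj_Ztau tau tau'.
Proof. by exists 0, 1; rewrite !add0r !mul1r. Qed.

Lemma conj_Ztau_tau' : conj_Ztau tau' tau.
Proof. by exists 1, (-1); rewrite !mulN1r; split=> //; rewrite /Defs.tau'; ring. Qed.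

Lemma conj_ZtauD x x' y y' : conj_Ztau x x' -> conj_Ztau y y' ->
  conj_Ztau (x + y) (x' + y').
Proof.
move=> [a [b [-> ->]]] [c [d [-> ->]]]; exists (a + c), (b + d).
by rewrite !rmorphD /=; split; ring.
Qed.

Lemma conj_ZtauN x x' : conj_Ztau x x' -> conj_Ztau (- x) (- x').
Proof.
move=> [a [b [-> ->]]]; exists (- a), (- b).
by rewrite !rmorphN /=; split; ring.
Qed.

Lemma conj_ZtauB x x' y y' : conj_Ztau x x' -> conj_Ztau y y' ->
  conj_Ztau (x - y) (x' - y').
Proof. by move=> h /conj_ZtauN; apply: conj_ZtauD. Qed.

Lemma conj_ZtauM x x' y y' : conj_Ztau x x' -> conj_Ztau y y' ->
  conj_Ztau (x * y) (x' * y').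
Proof.
move=> [a [b [-> ->]]] [c [d [-> ->]]]; exists (a * c + b * d), (a * d + b * c + b * d).
have mulE (t : R) : t ^+ 2 = t + 1 -> (a%:~R + b%:~R * t) * (c%:~R + d%:~R * t) =
   (a * c + b * d)%:~R + (a * d + b * c + b * d)%:~R * t.
  move=> t2; rewrite !rmorphD !rmorphM /=.
  transitivity (a%:~R * c%:~R + (a%:~R * d%:~R + b%:~R * c%:~R) * t + b%:~R * d%:~R * t
    ^+ 2); first by ring.
  by rewrite t2; ring.
by split; apply: mulE; [exact: tau_sq | exact: tau'_sq].
Qed.

Lemma conj_ZtauX x x' n : conj_Ztau x x' -> conj_Ztau (x ^+ n) (x' ^+ n).
Proof.
move=> h; elim: n => [|n IH]; first by rewrite !expr0; exact: conj_Ztau1.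
by rewrite !exprS; apply: conj_ZtauM.
Qed.

Lemma tau'_exp_small (e : R) : 0 < e -> exists n, `|tau' ^+ n| < e.
Proof.
move=> e0; have b := tau'_bounds.
have /cvgrPdist_lt /(_ e e0) : (tau' ^+ n @[n --> \oo] --> (0 : R)).
  by apply: cvg_expr; rewrite ltr0_norm; lra.
by case=> N _ /(_ N (leqnn N)); rewrite /= sub0r normrN; exists N.
Qed.

(** The conjugates of the integer multiples of a power of tau form a grid, as
    fine as desired since tau' has absolute value less than 1. *)
Lemma conj_Ztau_dense (c e : R) : 0 < e -> exists x x', conj_Ztau x x' /\ `|c - x'| < e.
Proof.
move=> e0; have [n ne] := tau'_exp_small e0.
have t0 : tau' ^+ n != 0 by rewrite expf_neq0 // lt_eqF //; have := tau'_bounds; lra.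
pose m := Num.floor (c / tau' ^+ n).
exists (m%:~R * tau ^+ n), (m%:~R * tau' ^+ n); split.
  by apply: conj_ZtauM; [exact: conj_Ztau_int | exact/conj_ZtauX/conj_Ztau_tau].
have -> : c - m%:~R * tau' ^+ n = (c / tau' ^+ n - m%:~R) * tau' ^+ n.
  by rewrite mulrBl divfK.
rewrite normrM; apply: le_lt_trans ne; rewrite ler_piMl //.
have h1 := floor_le (c / tau' ^+ n); have h2 := floorD1_gt (c / tau' ^+ n).
rewrite ger0_norm ?subr_ge0 //; move: h2; rewrite intrD -/m; lra.
Qed.

End Golden.

(** * Modules of icosians *)

Section Icosian.
Variable R : realType.
Local Notation tau := (tau R).
Local Notation tau' := (tau' R).
Implicit Types (x y : 'rV[R]_4).

Lemma icosian_sub_gen : @icosian_generator R `<=` icosian.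
Proof. exact: sub_gen_smallest. Qed.

Lemma icosian0 : @icosian R 0.
Proof. by move=> B [[/set_mem B0 _] _]. Qed.

Lemma icosianB x y : icosian x -> icosian y -> icosian (x - y).
Proof.
move=> hx hy B hB; have [[_ BB] _] := hB.
by apply/set_mem/BB; apply/mem_set; [apply: hx | apply: hy].
Qed.

Lemma icosianN x : icosian x -> icosian (- x).
Proof. by rewrite -sub0r; apply: icosianB; exact: icosian0. Qed.

Lemma icosianD x y : icosian x -> icosian y -> icosian (x + y).
Proof. by move=> hx /icosianN hy; rewrite -[y]opprK; apply: icosianB. Qed.

Lemma icosianMz x (m : int) : icosian x -> icosian (m%:~R *: x).
Proof.
move=> hx; rewrite scaler_int.
have hn n : icosian (x *+ n).
  by elim: n => [|n IH]; [rewrite mulr0n; exact: icosian0 | rewrite mulrS;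
    apply: icosianD].
case: m => n; first exact: hn n.
by rewrite NegzE mulrNz; apply: icosianN; exact: hn n.+1.
Qed.

Definition half_Ztau (t : R) := exists s s', conj_Ztau s s' /\ t = s / 2.

Lemma half_ZtauB (s t : R) : half_Ztau s -> half_Ztau t -> half_Ztau (s - t).
Proof.
move=> [a [a' [ha ->]]] [b [b' [hb ->]]]; exists (a - b), (a' - b').
by split; [exact: conj_ZtauB | rewrite mulrBl].
Qed.

Lemma conj_Ztau_sign (s : bool) : conj_Ztau ((-1) ^+ s : R) ((-1) ^+ s).
Proof. by apply: conj_ZtauX; apply: (conj_Ztau_int _ (-1)). Qed.

(** The vectors with all coordinates in half of Z[tau] form a subgroup that
    contains the generators. *)
Lemma icosian_half x i : icosian x -> half_Ztau (x ord0 i).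
Proof.
move=> hx; suff : icosian `<=` [set x : 'rV[R]_4 | forall i, half_Ztau (x ord0 i)].
  by move/(_ _ hx); apply.
apply: smallest_sub.
  split; first by apply/mem_set => j /=; rewrite mxE; exists 0, 0; rewrite mul0r;
    split=> //; exact: conj_Ztau0.
  by move=> u v /set_mem hu /set_mem hv; apply/mem_set => j /=; rewrite !mxE;
    apply: half_ZtauB.
move=> _ [s _ [v hv <-]] j; rewrite /= mxE; move: (s j) => {s j i}.
have half1 (t : R) t' : conj_Ztau t t' -> half_Ztau t.
  move=> h; exists (2 * t), (2 * t'); split; last by field.
  by apply: conj_ZtauM => //; apply: (conj_Ztau_int _ 2).
have half2 (t : R) t' : conj_Ztau t t' -> half_Ztau (2^-1 * t).
  by move=> h; exists t, t'; rewrite mulrC.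
have Z0 := @conj_Ztau0 R; have Zs := conj_Ztau_sign.
case: hv => [[[s ->]|[s [t [p [q ->]]]]]|[s [t ->]]] i; rewrite !mxE;
  case: i => -[|[|[|[|//]]]] _ /=;
  try (by apply: half1; first exact: Z0);
  try (by apply: half1; first exact: Zs);
  apply: half2; try exact: Z0; try exact: Zs.
- by apply: conj_ZtauM; [exact: Zs | exact: conj_Ztau_tau'].
- exact: conj_Ztau_tau.
Qed.

(** Composing with a transposition of two indices other than m corrects the
    parity. *)
Lemma even_perm_exists (k m : 'I_4) : exists2 s : 'S_4, ~~ odd_perm s & s k = m.
Proof.
have [->|km] := eqVneq k m; first by exists 1%g; rewrite ?odd_perm1 // perm1.
pose a := lift m (ord0 : 'I_3); pose b := lift m (lift ord0 ord0 : 'I_3).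
exists (tperm k m * tperm a b)%g.
  rewrite odd_permM !odd_tperm km /=;
    have -> : a != b by rewrite (inj_eq (@lift_inj _ m)).
  by [].
by rewrite permM tpermL tpermD // eq_sym neq_lift.
Qed.

Lemma col_perm_delta (s : 'S_4) k (c : R) :
  col_perm s (c *: delta_mx (ord0 : 'I_1) (s k)) = c *: delta_mx ord0 k.
Proof. by apply/rowP => j; rewrite !mxE (inj_eq perm_inj). Qed.

Lemma icosian_unit k : @icosian R (delta_mx ord0 k).
Proof.
have [s os sk] := even_perm_exists k ord0.
rewrite -[delta_mx _ _]scale1r -(col_perm_delta s); apply: icosian_sub_gen.
exists s => //; exists (1 *: delta_mx ord0 (s k)) => //; left; left; exists false.
by rewrite sk; apply/rowP => j; rewrite !mxE eqxx /=; case: j => -[|[|[|[|//]]]] hj;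
  rewrite /= ?mulr1 ?mulr0 ?expr0.
Qed.

(** The sum of (0, 1, tau', tau) / 2 and (0, -1, -tau', tau) / 2 is (0, 0, 0,
    tau). *)
Lemma icosian_tau_unit k : @icosian R (tau *: delta_mx ord0 k).
Proof.
have [s os sk] := even_perm_exists k ord_max.
rewrite -(col_perm_delta s).
pose w (b : bool) := (2^-1 : R) *: quat 0 ((-1) ^+ b) ((-1) ^+ b * tau') tau.
have -> : tau *: delta_mx ord0 (s k) = w false + w true.
  by rewrite sk; apply/rowP => j; rewrite !mxE eqxx /=; case: j => -[|[|[|[|//]]]] hj;
    rewrite /= ?expr0 ?expr1; field.
have -> : col_perm s (w false + w true) = col_perm s (w false) + col_perm s (w true).
  by apply/rowP => j; rewrite !mxE.
by apply: icosianD; apply: icosian_sub_gen; exists s => //; (exists (w false) => //;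
  right; exists false, false) || (exists (w true) => //; right; exists true, true).
Qed.

Definition Ztau_vec (x : 'rV[R]_3) := forall i, exists t, conj_Ztau (x ord0 i) t.

Lemma Ztau_I0 (x : 'rV[R]_3) : Ztau_vec x -> I0 x.
Proof.
move=> hx.
have hk (i : 'I_3) : icosian (x ord0 i *: delta_mx (ord0 : 'I_1) (lift ord0 i : 'I_4)).
  have [t [a [b [-> _]]]] := hx i; rewrite scalerDl -scalerA.
  by apply: icosianD; apply: icosianMz; [exact: icosian_unit | exact: icosian_tau_unit].
exists (\sum_(i < 3) x ord0 i *: delta_mx (ord0 : 'I_1) (lift ord0 i : 'I_4)).
  split.
    by apply: big_ind => //; [exact: icosian0 | exact: icosianD].
  by rewrite /= summxE big1 // => i _; rewrite !mxE /= mulr0.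
apply/rowP => j; rewrite !mxE summxE (bigD1 j) //= !mxE !eqxx /= mulr1 big1 ?addr0 //
  => i ij.
by rewrite !mxE (inj_eq (@lift_inj _ ord0)) [j == i]eq_sym (negPf ij) andbF mulr0.
Qed.

Lemma I0_sub_ImI : @I0 R `<=` ImI.
Proof. by move=> _ [x [hx _] <-]; exists x. Qed.

Lemma ImI_half (x : 'rV[R]_3) i : ImI x -> half_Ztau (x ord0 i).
Proof. by move=> [y hy <-]; rewrite mxE; apply: icosian_half. Qed.

(** All that the theorem depends on in the icosians: both modules lie between
    Z[tau]^3 and its half. *)
Lemma lattice_sandwich (L : set 'rV[R]_3) : L = ImI \/ L = I0 ->
  (forall x : 'rV[R]_3, Ztau_vec x -> L x) /\ (forall (x :
    'rV[R]_3) i, L x -> half_Ztau (x ord0 i)).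
Proof.
case=> ->; split=> x.
- by move=> /Ztau_I0/I0_sub_ImI.
- by move=> i; apply: ImI_half.
- exact: Ztau_I0.
- by move=> i /I0_sub_ImI; apply: ImI_half.
Qed.
End Icosian.

(** * Finiteness and density for model sets *)

Section ModelSets.
Variable R : realType.
Local Notation tau := (tau R).
Local Notation tau' := (tau' R).

Lemma coord_le_norm (x : 'rV[R]_3) i : `|x ord0 i| <= `|x|.
Proof.
rewrite -[leRHS]/(mx_norm x) mx_normrE.
exact: (le_bigmax _ (fun ij : 'I_1 * 'I_3 => `|x ij.1 ij.2|) (ord0, i)).
Qed.

Lemma finite_bounded_int (N : R) : finite_set [set m : int | `|m%:~R : R| <= N].
Proof.
pose k := (Num.truncn N).+1.
apply: (@sub_finite_set _ _ ((fun n : nat => n%:Z - k%:Z) @` `I_(2 * k).+1)).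
  move=> m /= mN; have kN : N < k%:R by exact: truncnS_gt.
  have : `|m| < k%:Z.
    by rewrite -(ltr_int R) intr_norm; apply: le_lt_trans mN kN.
  rewrite ltr_norml => /andP[h1 h2].
  by exists (absz (m + k%:Z)); rewrite /=; lia.
exact/finite_image/finite_II.
Qed.

(** Since tau - tau' is the square root of 5, bounds on a number and on its
    conjugate bound its two integer coordinates. *)
Lemma finite_bounded_Ztau (M : R) :
  finite_set [set t : R | exists s s', [/\ conj_Ztau s s', t = s / 2,
    `|s| <= M & `|s'| <= M]].
Proof.
pose Z := [set m : int | `|m%:~R : R| <= M *+ 2].
apply: (@sub_finite_set _ _ ((fun ab : int * int =>
  (ab.1%:~R + ab.2%:~R * tau) / 2) @` (Z `*` Z))).
  move=> t [s [s' [[a [b [sE s'E]]] -> sM s'M]]]; exists (a, b); last by rewrite sE.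
  have t5 := sqrt5_bounds R; have tt := tau'_bounds R.
  have tE : tau - tau' = Num.sqrt 5 by rewrite /Defs.tau' /Defs.tau; field.
  have bE : b%:~R * Num.sqrt 5 = s - s' by rewrite -tE sE s'E; ring.
  have M0 : 0 <= M := le_trans (normr_ge0 _) sM.
  have bM : `|b%:~R : R| <= M.
    rewrite -(ler_pM2r (x := 2)) //; apply: (@le_trans _ _ `|s - s'|).
      by rewrite -bE normrM ler_wpM2l // ger0_norm; lra.
    by apply: le_trans (ler_normB _ _) _; lra.
  split; rewrite /Z /= mulr2n; last lra.
  have -> : a%:~R = s' - b%:~R * tau' by rewrite s'E; ring.
  apply: le_trans (ler_normB _ _) _; apply: lerD => //.
  rewrite normrM; apply: le_trans bM; rewrite ler_piMr // ltr0_norm; lra.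
by apply: finite_image; apply: finite_setX; exact: finite_bounded_int.
Qed.

Lemma window_bounded (W : set 'rV[R]_3) : window W ->
  exists K, forall w i, W w -> `|w ord0 i| <= K.
Proof.
move=> [_ Wc /compact_bounded [K [_ hK]]]; exists (K + 1) => w i Ww.
apply: le_trans (coord_le_norm w i) _; apply: hK; last exact: Wc.
by rewrite ltrDl.
Qed.

Lemma model_set_locally_finite (L W : set 'rV[R]_3) (t : 'rV[R]_3) (M : R) :
    (forall (x : 'rV[R]_3) i, L x -> half_Ztau (x ord0 i)) -> window W ->
  finite_set (ico_model_set L t W `&` [set y | forall i, `|y ord0 i| <= M]).
Proof.
move=> Lhalf /window_bounded[K WK].
pose B := 2 * (M + \sum_i `|t ord0 i|) + 2 * `|K|.
have tB i : `|t ord0 i| <= \sum_i `|t ord0 i|.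
  by rewrite (bigD1 i) //= lerDl sumr_ge0.
have fV := finite_bounded_Ztau B; set V := [set _ | _] in fV.
apply: (@sub_finite_set _ _ ((fun p : R * R * R =>
  t + row3 p.1.1 p.1.2 p.2) @` (V `*` V `*` V))).
  move=> _ [[x [xL xW] <-] xM].
  have xV i : V (x ord0 i).
    have [s [s' [ss' xE]]] := Lhalf x i xL; exists s, s'; split=> //.
      have := xM i; rewrite mxE => h.
      have : `|x ord0 i| <= M + \sum_i `|t ord0 i|.
        have -> : x ord0 i = t ord0 i + x ord0 i - t ord0 i by ring.
        by apply: le_trans (ler_normB _ _) (lerD h (tB i)).
      rewrite xE normrM normfV (@ger0_norm _ 2) //.
      have : 0 <= `|K| := normr_ge0 _; rewrite /B; lra.
    have := WK _ i xW; rewrite mxE xE (conj_Ztau_half ss') normrM normfV (@ger0_norm _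
      2) // => h.
    have M0 : 0 <= M := le_trans (normr_ge0 _) (xM ord0).
    have t0 : 0 <= \sum_i `|t ord0 i| by apply: sumr_ge0.
    have := ler_norm K; rewrite /B; lra.
  exists (x ord0 ord0, x ord0 coord1, x ord0 coord2); first by split; [split|];
    exact: xV.
  by congr (_ + _); apply: row3P; rewrite !mxE.
by apply: finite_image; do 2?apply: finite_setX.
Qed.

Lemma conj_Ztau_galois x x' : conj_Ztau x x' -> galois x = x' :> R.
Proof.
move=> h; have h2 : conj_Ztau (2 * x) (2 * x') by apply: conj_ZtauM => //;
  exact: (conj_Ztau_int _ 2).
have e (y : R) : y = 2 * y / 2 by field.
by rewrite {1}[x]e (conj_Ztau_half h2) -e.
Qed.

Lemma window_center (W : set 'rV[R]_3) : window W ->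
  exists (c : 'rV[R]_3) (e : R), 0 < e /\ forall y :
    'rV[R]_3, (forall i, `|c ord0 i - y ord0 i| < e) -> W y.
Proof.
move=> [[c] + _ _]; rewrite /interior /= => /nbhs_ballP[e /= e0 cW].
exists c, e; split=> // y hy; apply: cW; split=> // i j.
by rewrite ord1; exact: hy.
Qed.

Lemma star_coord (x : 'rV[R]_3) i : star x ord0 i = galois (x ord0 i).
Proof. by rewrite mxE. Qed.

(** The star map turns multiplication by tau into multiplication by tau', so
    that a large power of tau shrinks the star image of any configuration until
    a translate of it fits in the window. *)
Lemma scaled_configuration (W : set 'rV[R]_3) (a b a' b' : 'I_3 -> R) : window W ->
    (forall k, conj_Ztau (a k) (a' k)) -> (forall k, conj_Ztau (b k) (b' k)) ->
  exists (x0 : 'rV[R]_3) (n : nat), forall k (s : bool),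
    let y := x0 + (-1) ^+ s *: plane_vec (tau ^+ n * a k) (tau ^+ n * b k) in
    Ztau_vec y /\ W (star y).
Proof.
move=> wW ha hb; have [c [e [e0 cW]]] := window_center wW.
have e2 : 0 < e / 2 by rewrite divr_gt0.
have /choice[z zP] : forall i : 'I_3, exists p : R * R,
    conj_Ztau p.1 p.2 /\ `|c ord0 i - p.2| < e / 2.
  by move=> i; have [x [x' h]] := conj_Ztau_dense (c ord0 i) e2; exists (x, x').
pose B := 1 + \sum_k (`|a' k| + `|b' k|).
have B0 : 0 < B by rewrite ltr_pwDl // sumr_ge0 // => k _; rewrite addr_ge0.
have aB k : `|a' k| + `|b' k| <= B.
  have S0 : 0 <= \sum_(j | j != k) (`|a' j| + `|b' j|).
    by apply: sumr_ge0 => j _; apply: addr_ge0.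
  by rewrite /B (bigD1 k) //=; lra.
have [n nE] := @tau'_exp_small R (e / 2 / B) (divr_gt0 e2 B0).
exists (\row_i (z i).1), n => k s /=.
set v := plane_vec _ _; pose v' := row3 (- (tau' ^+ n * b' k)) (tau' ^+ n * a' k) (tau'
  * (tau' ^+ n * b' k)).
have tn := conj_ZtauX n (conj_Ztau_tau R).
have vv' i : conj_Ztau (v ord0 i) (v' ord0 i).
  have ca := conj_ZtauM tn (ha k); have cb := conj_ZtauM tn (hb k).
  rewrite !mxE; case: i => -[|[|[|//]]] _ /=; [exact: conj_ZtauN | exact: ca |].
  by apply: conj_ZtauM; [exact: conj_Ztau_tau | exact: cb].
have small i : `|v' ord0 i| < e / 2.
  apply: (@le_lt_trans _ _ (`|tau' ^+ n| * B)); last by rewrite -ltr_pdivlMr.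
  have b1 : `|b' k| <= B by apply: le_trans (aB k); rewrite lerDr.
  have a1 : `|a' k| <= B by apply: le_trans (aB k); rewrite lerDl.
  have t1 : `|tau'| <= 1 by have := tau'_bounds R; rewrite ler_norml; lra.
  rewrite !mxE; case: i => -[|[|[|//]]] _ /=.
  - by rewrite normrN normrM ler_wpM2l.
  - by rewrite normrM ler_wpM2l.
  - rewrite normrM; apply: (@le_trans _ _ (`|tau' ^+ n * b' k|));
      first by rewrite ler_piMl.
    by rewrite normrM ler_wpM2l.
set y := _ + _.
have yy i : conj_Ztau (y ord0 i) ((z i).2 + (-1) ^+ s * v' ord0 i).
  rewrite /y mxE mxE [X in _ + X]mxE; apply: conj_ZtauD; first by have [] := zP i.
  by apply: conj_ZtauM => //; exact: conj_Ztau_sign.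
split=> [i|]; first by eexists; exact: yy.
apply: cW => i; rewrite star_coord (conj_Ztau_galois (yy i)).
rewrite opprD addrA; apply: le_lt_trans (ler_normB _ _) _.
rewrite normrM normrX normrN1 expr1n mul1r.
by have [_] := zP i; have := small i; lra.
Qed.
End ModelSets.

(** * Hexagons inside model sets *)

Section PartB.
Variable R : realType.
Local Notation tau := (tau R).
Implicit Types p q : R * R.

Definition planar_form (al be : R) (x : 'rV[R]_3) : R :=
  al * (planar x).1 + be * (planar x).2.

Lemma planar_form_is_linear al be : linear_for *%R (planar_form al be).
Proof. by move=> c x y; rewrite /planar_form /planar /= !mxE; ring. Qed.

HB.instance Definition _ al be := GRing.isLinear.Build R 'rV[R]_3 R *%R
  (planar_form al be) (planar_form_is_linear al be).

Lemma planar_form_vec al be a b : planar_form al be (plane_vec a b) = al * a + be * b.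
Proof. by rewrite /planar_form /planar /= !mxE /= opprK. Qed.

Definition zero_sum_triple p q (k : 'I_3) : R * R :=
  nth (0, 0) [:: p; q; (- p.1 - q.1, - p.2 - q.2)] k.
Definition pair_vec p := plane_vec p.1 p.2.

(** The vectors p, q and - p - q span an affinely regular hexagon. *)
Lemma locally_finite_hexagon (Lam : set 'rV[R]_3) (ctr : 'rV[R]_3) p q (U :
  set 'rV[R]_3) :
    cross p q != 0 ->
    (forall k (s : bool), Lam (ctr + (-1) ^+ s *: pair_vec (zero_sum_triple p q k))) ->
    (forall M, finite_set (Lam `&` [set y | forall i, `|y ord0 i| <= M])) ->
    (forall u, U u -> exists k c, pair_vec (zero_sum_triple p q k) = c *: u) ->
  ~ determined_by (convex_subsets Lam) U.
Proof.
move=> D0 hL hfin hU; set D := cross p q in D0.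
pose co : 'I_3 -> R * R := fun k => nth (0, 0) [:: (2, -1); (-1, 2); (-1, -1)] k.
(* g k takes the value (co k).1 * alpha + (co k).2 * beta at alpha p + beta q. *)
pose g k : {scalar 'rV[R]_3} := planar_form
  (((co k).1 * q.2 - (co k).2 * p.2) / D) (((co k).2 * p.1 - (co k).1 * q.1) / D).
pose v k := pair_vec (zero_sum_triple p q k).
have vE k : v k = plane_vec (zero_sum_triple p q k).1 (zero_sum_triple p q k).2 by [].
have gv k l : g k (v l) = if k == l then 2 else -1.
  have DE : p.1 * q.2 - p.2 * q.1 != 0 by [].
  rewrite vE /g /= planar_form_vec /D /cross.
  case: k => -[|[|[|//]]] hk; case: l => -[|[|[|//]]] hl;
    rewrite /co /zero_sum_triple /=; field; exact: DE.
have vsum k l : k != l -> exists m, v l + v k = - v m.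
  move=> kl; have [m mE] : exists m : 'I_3, (m + k + l = 3)%N.
    case: k kl => -[|[|[|//]]] hk; case: l => -[|[|[|//]]] hl // _.
    - by exists (@Ordinal 3 2 isT).
    - by exists (@Ordinal 3 1 isT).
    - by exists (@Ordinal 3 2 isT).
    - by exists (@Ordinal 3 0 isT).
    - by exists (@Ordinal 3 1 isT).
    - by exists (@Ordinal 3 0 isT).
  exists m; rewrite !vE; apply: row3P; rewrite !mxE /=;
    move: kl mE; case: k => -[|[|[|//]]] hk; case: l => -[|[|[|//]]] hl //;
    case: m => -[|[|[|//]]] hm // _ _; rewrite /zero_sum_triple /=; ring.
apply: (@hexagon_not_determined R Lam ctr v g gv vsum _ _ _ U hU).
- by move=> _ [k _ <-]; have := hL k false; rewrite expr0 scale1r.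
- by move=> _ [k _ <-]; have := hL k true; rewrite expr1 scaleN1r.
pose M := \sum_i `|ctr ord0 i| + \sum_k \sum_i `|v k ord0 i|.
apply: sub_finite_set (hfin M) => y [yL yH]; split=> //.
have box_convex : @convex_set R 'rV[R]_3 [set y | forall i, `|y ord0 i| <= M].
  apply/convex_setP => x z t t0 t1 /= hx hz i; rewrite !mxE.
  apply: le_trans (ler_normD _ _) _; rewrite !normrM (ger0_norm t0).
  have t1' : 0 <= 1 - t by rewrite subr_ge0.
  rewrite (ger0_norm t1').
  have -> : M = t * M + (1 - t) * M by ring.
  by apply: lerD; apply: ler_wpM2l.
have cM i : `|ctr ord0 i| <= \sum_i `|ctr ord0 i|.
  by rewrite (bigD1 i) //= lerDl sumr_ge0.
have vM k i : `|v k ord0 i| <= \sum_k \sum_i `|v k ord0 i|.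
  rewrite (bigD1 k) //= (bigD1 i) //= -addrA lerDl addr_ge0 ?sumr_ge0 //.
  by move=> j _; rewrite sumr_ge0.
apply: (conv_hull_min box_convex _ yH) => z [[k _ <-]|[k _ <-]] i; rewrite mxE.
  exact: le_trans (ler_normD _ _) (lerD (cM i) (vM k i)).
by rewrite mxE; apply: le_trans (ler_normB _ _) (lerD (cM i) (vM k i)).
Qed.

Definition Ztau_pair p := exists a' b', conj_Ztau p.1 a' /\ conj_Ztau p.2 b'.

Lemma Ztau_hexagon_not_determined (L : set 'rV[R]_3) (Lam U : set 'rV[R]_3) p q :
    L = ImI \/ L = I0 -> generic_ico_model_set L Lam -> Ztau_pair p -> Ztau_pair q ->
    cross p q != 0 ->
    (forall u, U u -> exists k c, pair_vec (zero_sum_triple p q k) = c *: u) ->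
  ~ determined_by (convex_subsets Lam) U.
Proof.
move=> hL [t [W [wW _ ->]]] [pa [pb [hpa hpb]]] [qa [qb [hqa hqb]]] D0 hU.
have [ZL Lhalf] := lattice_sandwich hL.
pose tr := zero_sum_triple p q; pose tr' := zero_sum_triple (pa, pb) (qa, qb).
have ha k : conj_Ztau (tr k).1 (tr' k).1.
  by case: k => -[|[|[|//]]] hk //=; apply: conj_ZtauB => //; apply: conj_ZtauN.
have hb k : conj_Ztau (tr k).2 (tr' k).2.
  by case: k => -[|[|[|//]]] hk //=; apply: conj_ZtauB => //; apply: conj_ZtauN.
have [x0 [n xP]] := scaled_configuration wW ha hb.
have tau0 : tau ^+ n != 0 by rewrite expf_neq0 // gt_eqF // /Defs.tau;
  have := sqrt5_bounds R; lra.
pose p' := (tau ^+ n * p.1, tau ^+ n * p.2);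
  pose q' := (tau ^+ n * q.1, tau ^+ n * q.2).
have trE k : zero_sum_triple p' q' k = (tau ^+ n * (tr k).1, tau ^+ n * (tr k).2).
  by case: k => -[|[|[|//]]] hk; rewrite /tr /zero_sum_triple //=; congr pair; ring.
apply: (@locally_finite_hexagon _ (t + x0) p' q').
- have -> : cross p' q' = tau ^+ n * tau ^+ n * cross p q by rewrite /cross /=; ring.
  by rewrite !mulf_neq0.
- move=> k s; rewrite trE -addrA; have [yZ yW] := xP k s.
  by eexists; [split; [exact: ZL yZ | exact: yW] |].
- by move=> M; apply: (model_set_locally_finite t M Lhalf wW).
- move=> u /hU[k [c e]]; exists k, (tau ^+ n * c); rewrite trE -scalerA -e.
  by apply: row3P; rewrite !mxE /=; ring.
Qed.

Lemma direction_Ztau_pair (L : set 'rV[R]_3) u : L = ImI \/ L = I0 ->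
  tau01_direction L u -> exists p, [/\ Ztau_pair p, p != 0 & exists2 c,
    c != 0 & pair_vec p = c *: u].
Proof.
move=> /lattice_sandwich[_ Lhalf] [_ /plane_tau01E hu [x [Lx x0 [c c0 xE]]]].
have [s1 [s1' [h1 e1]]] := Lhalf x coord1 Lx;
  have [s0 [s0' [h0 e0]]] := Lhalf x ord0 Lx.
have hx : height x = 0 by move: hu; rewrite /height xE !mxE => hu;
  rewrite mulrCA -mulrDr hu mulr0.
have E : pair_vec (s1, - s0) = 2 *: x.
  apply: row3P; rewrite !mxE /=; [by rewrite e0; field | by rewrite -/coord1 e1;
    field |].
  by move: hx; rewrite /height e0 -/coord2; lra.
exists (s1, - s0); split.
- by exists s1', (- s0'); split=> //; exact: conj_ZtauN.
- rewrite -plane_vec_eq0 -[plane_vec _ _]/(pair_vec (s1,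
    - s0)) E scaler_eq0 negb_or x0 andbT.
  by rewrite pnatr_eq0.
- by exists (2 * c); rewrite ?mulf_neq0 ?pnatr_eq0 // E xE scalerA.
Qed.

Lemma cross_eq0_parallel p q : p != 0 -> q != 0 -> cross p q = 0 ->
  exists2 c, c != 0 & pair_vec q = c *: pair_vec p.
Proof.
move=> p0 q0 c0; move: c0; rewrite /cross => e.
have [p1|p1] := eqVneq p.1 0.
  have p2 : p.2 != 0 by apply: contra_neq p0 => p2;
    rewrite (surjective_pairing p) p1 p2.
  have q1 : q.1 = 0.
    by move/eqP: e; rewrite p1 mul0r sub0r oppr_eq0 mulf_eq0 (negPf p2) => /eqP.
  have q2 : q.2 != 0 by apply: contra_neq q0 => q2;
    rewrite (surjective_pairing q) q1 q2.
  exists (q.2 / p.2); first by rewrite mulf_neq0 ?invr_eq0.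
  by apply: row3P; rewrite !mxE /= ?p1 ?q1; field.
have q2E : q.2 = q.1 / p.1 * p.2.
  by apply: (mulfI p1); have -> : p.1 * (q.1 / p.1 * p.2) = p.2 * q.1; [field|lra].
have q1 : q.1 != 0.
  apply: contra_neq q0 => q1; rewrite (surjective_pairing q) q2E q1 mul0r mul0r //.
exists (q.1 / p.1); first by rewrite mulf_neq0 ?invr_eq0.
by apply: row3P; rewrite !mxE /= ?q2E; field.
Qed.

Lemma Ztau_pair_scale p (t t' : R) :
  conj_Ztau t t' -> Ztau_pair p -> Ztau_pair (t * p.1, t * p.2).
Proof.
move=> ht [a' [b' [ha hb]]]; exists (t' * a'), (t' * b').
by split; exact: conj_ZtauM.
Qed.

Lemma Ztau_pair_cross p q : Ztau_pair p -> Ztau_pair q ->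
  exists t', conj_Ztau (cross p q) t'.
Proof.
move=> [a [b [ha hb]]] [c [d [hc hd]]]; exists (a * d - b * c).
by apply: conj_ZtauB; exact: conj_ZtauM.
Qed.

(** Multiplying each of three pairwise independent plane vectors by the cross
    product of the two others, which is in Z[tau], makes their sum zero. *)
Lemma three_not_determined (L : set 'rV[R]_3) (Lam U : set 'rV[R]_3) p1 p2 p3 :
    L = ImI \/ L = I0 -> generic_ico_model_set L Lam -> Ztau_pair p1 -> Ztau_pair p2 ->
      Ztau_pair p3 ->
    cross p1 p2 != 0 -> cross p2 p3 != 0 -> cross p3 p1 != 0 ->
    (forall u, U u -> exists2 p, p \in [:: p1; p2;
      p3] & exists c, pair_vec p = c *: u) ->
  ~ determined_by (convex_subsets Lam) U.
Proof.
move=> hL gL g1 g2 g3 d12 d23 d31 hU.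
have [t1 h1] := Ztau_pair_cross g2 g3; have [t2 h2] := Ztau_pair_cross g3 g1.
pose q1 := (cross p2 p3 * p1.1, cross p2 p3 * p1.2).
pose q2 := (cross p3 p1 * p2.1, cross p3 p1 * p2.2).
apply: (@Ztau_hexagon_not_determined L Lam U q1 q2 hL gL).
- exact: Ztau_pair_scale h1 g1.
- exact: Ztau_pair_scale h2 g2.
- have crossM (A B : R) p q : cross (A * p.1, A * p.2) (B * q.1,
    B * q.2) = A * B * cross p q.
    by rewrite /cross /=; ring.
  rewrite crossM.
  by rewrite !mulf_neq0.
move=> u /hU[p pin [c pc]].
have [k [d kE]] : exists k d, zero_sum_triple q1 q2 k = (d * p.1, d * p.2).
  move: pin; rewrite !inE => /or3P[]/eqP->.
  - by exists ord0, (cross p2 p3).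
  - by exists (@Ordinal 3 1 isT), (cross p3 p1).
  - exists (@Ordinal 3 2 isT), (cross p1 p2); rewrite /zero_sum_triple /= /cross;
      congr pair; ring.
exists k, (d * c); rewrite kE -scalerA -pc.
by apply: row3P; rewrite !mxE /=; ring.
Qed.

Lemma Ztau_pair_units : Ztau_pair (1, 0) /\ Ztau_pair (0, 1).
Proof.
by split; [exists 1, 0 | exists 0, 1]; split;
  by [exact: conj_Ztau0 | exact: conj_Ztau1].
Qed.

Lemma Ztau_pair_add p q : Ztau_pair p -> Ztau_pair q ->
  Ztau_pair (p.1 + q.1, p.2 + q.2).
Proof.
move=> [a [b [ha hb]]] [c [d [hc hd]]]; exists (a + c), (b + d).
by split; exact: conj_ZtauD.
Qed.

(** The sum of the two vectors provides a third direction. *)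
Lemma two_not_determined (L : set 'rV[R]_3) (Lam U : set 'rV[R]_3) p1 p2 :
    L = ImI \/ L = I0 -> generic_ico_model_set L Lam -> Ztau_pair p1 -> Ztau_pair p2 ->
    cross p1 p2 != 0 ->
    (forall u, U u -> exists2 p, p \in [:: p1; p2] & exists c, pair_vec p = c *: u) ->
  ~ determined_by (convex_subsets Lam) U.
Proof.
move=> hL gL g1 g2 d12 hU.
have c21 : cross p2 p1 = - cross p1 p2 by rewrite /cross; ring.
apply: (three_not_determined hL gL g1 g2 (Ztau_pair_add g1 g2) d12).
- have -> : cross p2 (p1.1 + p2.1, p1.2 + p2.2) = - cross p1 p2 by rewrite /cross /=;
    ring.
  by rewrite oppr_eq0.
- have -> : cross (p1.1 + p2.1, p1.2 + p2.2) p1 = - cross p1 p2 by rewrite /cross /=;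
    ring.
  by rewrite oppr_eq0.
move=> u /hU[p pin pc]; exists p => //; move: pin; rewrite !inE => /orP[]->//.
by rewrite orbT.
Qed.

Lemma one_not_determined (L : set 'rV[R]_3) (Lam U : set 'rV[R]_3) p1 :
    L = ImI \/ L = I0 -> generic_ico_model_set L Lam -> Ztau_pair p1 -> p1 != 0 ->
    (forall u, U u -> exists c, pair_vec p1 = c *: u) ->
  ~ determined_by (convex_subsets Lam) U.
Proof.
move=> hL gL g1 n1 hU; have [gx gy] := Ztau_pair_units.
have [e|ne] := eqVneq (cross p1 (1, 0)) 0; last first.
  by apply: (two_not_determined hL gL g1 gx ne) => u /hU h; exists p1;
    rewrite ?inE ?eqxx.
apply: (two_not_determined hL gL g1 gy).
  apply: contra_neq n1; move: e; rewrite /cross /= !mulr0 !mulr1 sub0r subr0 => /eqP.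
  by rewrite oppr_eq0 => /eqP p2 p1'; rewrite (surjective_pairing p1) p2 p1'.
by move=> u /hU h; exists p1; rewrite ?inE ?eqxx.
Qed.

Theorem three_directions_not_determined (L Lam U : set 'rV[R]_3) :
    L = ImI \/ L = I0 -> generic_ico_model_set L Lam ->
    U #<= `I_3 -> U `<=` tau01_direction L ->
    (forall u v, U u -> U v -> u <> v -> ~ parallel u v) ->
  ~ determined_by (convex_subsets Lam) U.
Proof.
move=> hL gL U3 UL nonpar.
have fU : finite_set U by apply/finite_set_leP; exists 3%N.
have sU := geq_card_fset_set U3.
have memU u : U u <-> u \in enum_fset (fset_set U).
  by rewrite -[u \in enum_fset _]/(u \in fset_set U) in_fset_set //;
    split=> [/mem_set|/set_mem].
have := fset_uniq (fset_set U).
move: sU memU; case: (enum_fset _) => [|u1 s] /= sU memU us.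
  have [gx _] := Ztau_pair_units; apply: (one_not_determined hL gL gx).
    by apply/eqP => -[/eqP]; rewrite oner_eq0.
  by move=> u /memU.
have indep u v p q c d : U u -> U v -> u != v -> p != 0 -> q != 0 -> c != 0 -> d != 0 ->
    pair_vec p = c *: u -> pair_vec q = d *: v -> cross p q != 0.
  move=> Uu Uv uv p0 q0 c0 d0 pc qd; apply/eqP => /(cross_eq0_parallel p0 q0)[t t0].
  rewrite pc qd scalerA => e; apply: (nonpar u v Uu Uv (elimN eqP uv)).
  exists (t * c / d); first by rewrite !mulf_neq0 ?invr_eq0.
  by rewrite mulrC -scalerA -e scalerA mulVf ?scale1r.
have U1 : U u1 by apply/memU; rewrite inE eqxx.
have [p1 [g1 n1 [c1 c10 e1]]] := direction_Ztau_pair hL (UL _ U1).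
case: s sU memU us => [|u2 s] /= sU memU us.
  apply: (one_not_determined hL gL g1 n1) => u /memU; rewrite inE => /eqP->.
  by exists c1.
have U2 : U u2 by apply/memU; rewrite !inE eqxx orbT.
have [p2 [g2 n2 [c2 c20 e2]]] := direction_Ztau_pair hL (UL _ U2).
have u12 : u1 != u2 by move: us; rewrite inE negb_or => /andP[/andP[]].
have d12 := indep _ _ _ _ _ _ U1 U2 u12 n1 n2 c10 c20 e1 e2.
case: s sU memU us => [|u3 s] /= sU memU us.
  apply: (two_not_determined hL gL g1 g2 d12) => u /memU; rewrite !inE => /orP[]/eqP->.
    by exists p1; rewrite ?inE ?eqxx //; exists c1.
  by exists p2; rewrite ?inE ?eqxx ?orbT //; exists c2.
have U3' : U u3 by apply/memU; rewrite !inE eqxx !orbT.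
have [p3 [g3 n3 [c3 c30 e3]]] := direction_Ztau_pair hL (UL _ U3').
have [u13 u23] : u1 != u3 /\ u2 != u3.
  by move: us; rewrite !inE !negb_or => /andP[/and3P[_ -> _] /andP[/andP[-> _] _]].
have d23 := indep _ _ _ _ _ _ U2 U3' u23 n2 n3 c20 c30 e2 e3.
have d31 : cross p3 p1 != 0.
  by apply: (indep _ _ _ _ _ _ U3' U1 _ n3 n1 c30 c10 e3 e1); rewrite eq_sym.
have s0 : s = [::] by case: s sU {memU us}.
apply: (three_not_determined hL gL g1 g2 g3 d12 d23 d31) => u /memU;
  rewrite s0 !inE => /or3P[]/eqP->.
- by exists p1; rewrite ?inE ?eqxx //; exists c1.
- by exists p2; rewrite ?inE ?eqxx ?orbT //; exists c2.
- by exists p3; rewrite ?inE ?eqxx ?orbT //; exists c3.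
Qed.

Theorem four_directions_determine (L : set 'rV[R]_3) : L = ImI \/ L = I0 ->
  exists U : set 'rV[R]_3,
    [/\ U #= `I_4, U `<=` tau01_direction L
      & forall Lambda : set 'rV[R]_3, determined_by (convex_subsets Lambda) U].
Proof.
move=> /lattice_sandwich[ZL _]; apply: determined_by_four => k k4; apply: ZL => i.
have iZ (m : int) : exists t : R, conj_Ztau m%:~R t by exists m%:~R;
  exact: conj_Ztau_int.
have nZ (m : nat) : exists t : R, conj_Ztau m%:R t by exact: (iZ m).
have tZ (m : nat) : exists t : R, conj_Ztau (tau * m%:R) t.
  by exists (tau' R * m%:R); apply: conj_ZtauM;
    [exact: conj_Ztau_tau | exact: (conj_Ztau_int _ m)].
have mZ (m : nat) : exists t : R, conj_Ztau (- m%:R) t.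
  by have [t h] := nZ m; exists (- t); exact: conj_ZtauN.
rewrite mxE; case: k k4 => [|[|[|[|//]]]] _; case: i => -[|[|[|//]]] hi /=;
  by [exact: (mZ 0%N) | exact: (mZ 1%N) | exact: (mZ 8%N) | exact: (nZ 0%N) | exact:
    (nZ 1%N)
     | exact: (tZ 0%N) | exact: (tZ 1%N) | exact: (tZ 8%N)].
Qed.
End PartB.

Theorem theorem5p12 (R : realType) (L : set 'rV[R]_3)
    (hL : L = ImI \/ L = I0) :
  (exists U : set 'rV[R]_3,
    [/\ U #= `I_4, U `<=` tau01_direction L
      & forall Lambda : set 'rV[R]_3, generic_ico_model_set L Lambda ->
          determined_by (convex_subsets Lambda) U])
  /\
  (forall Lambda U : set 'rV[R]_3,
     generic_ico_model_set L Lambda ->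
     U #<= `I_3 -> U `<=` tau01_direction L ->
     (forall u v, U u -> U v -> u <> v -> ~ parallel u v) ->
     ~ determined_by (convex_subsets Lambda) U).
Proof.
split; last by move=> Lambda U; exact: three_directions_not_determined.
have [U [U4 UL det]] := four_directions_determine hL.
by exists U; split=> // Lambda _; exact: det.
Qed.
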